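(* Let $k$ and $r$ be fixed nonnegative integers. There is a polynomial-time algorithm which, given a $(P_5+rK_1)$-free graph $G$ and a weight function $\omega: V(G)\to\mathbb{N}$, finds a $k$-colourable induced subgraph $H$ of $G$ maximizing $\omega(H)=\sum_{v\in V(H)}\omega(v)$ over all $k$-colourable induced subgraphs of $G$. That is, the Weighted Maximum $k$-colourable Induced Subgraph problem can be solved in polynomial time on $(P_5+rK_1)$-free graphs.
   Context: $P_5$ denotes the path on $5$ vertices, $rK_1$ the edgeless graph on $r$ vertices, and $P_5+rK_1$ their disjoint union. A graph is $F$-free if it contains no induced subgraph isomorphic to $F$. For a subgraph $H$ of $G$, $\omega(H)=\sum_{v\in V(H)}\omega(v)$. *)

(* Defs.v *)
From HB Require Import structures.
From mathcomp Require Import all_boot all_order all_algebra.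

Set Implicit Arguments.
Unset Strict Implicit.
Unset Printing Implicit Defensive.

Record sgraph := SGraph {
  vert :> finType;
  adj : rel vert;
  adj_sym : symmetric adj;
  adj_irr : irreflexive adj
}.

Section Induced.
Variables (G : sgraph) (S : {set G}).

Definition induced_adj : rel {x : G | x \in S} :=
  fun x y => adj (val x) (val y).

Lemma induced_sym : symmetric induced_adj.
Proof. by move=> x y; apply: adj_sym. Qed.

Lemma induced_irr : irreflexive induced_adj.
Proof. by move=> x; apply: adj_irr. Qed.

Definition induced : sgraph := SGraph induced_sym induced_irr.

End Induced.

Definition graph_iso (F G : sgraph) : Prop :=
  exists2 f : F -> G, bijective f & forall x y, adj (f x) (f y) = adj x y.

Definition induced_free (F G : sgraph) : Prop :=
  forall S : {set G}, ~ graph_iso (induced S) F.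

Section Path.
Variable n : nat.

Definition path_adj : rel 'I_n := fun i j => (i.+1 == j) || (j.+1 == i).

Lemma path_sym : symmetric path_adj.
Proof. by move=> i j; rewrite /path_adj orbC. Qed.

Lemma path_irr : irreflexive path_adj.
Proof. by move=> i; rewrite /path_adj orbb gtn_eqF. Qed.

Definition path_graph : sgraph := SGraph path_sym path_irr.

End Path.

Section Edgeless.
Variable n : nat.

Definition edgeless_adj : rel 'I_n := fun _ _ => false.

Lemma edgeless_sym : symmetric edgeless_adj.
Proof. by []. Qed.

Lemma edgeless_irr : irreflexive edgeless_adj.
Proof. by []. Qed.

Definition edgeless_graph : sgraph := SGraph edgeless_sym edgeless_irr.

End Edgeless.

Section DisjointUnion.
Variables F G : sgraph.

Definition dunion_adj : rel (F + G)%type := fun x y =>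
  match x, y with
  | inl a, inl b => adj a b
  | inr a, inr b => adj a b
  | _, _ => false
  end.

Lemma dunion_sym : symmetric dunion_adj.
Proof. by move=> [a|a] [b|b] //=; apply: adj_sym. Qed.

Lemma dunion_irr : irreflexive dunion_adj.
Proof. by move=> [a|a] /=; apply: adj_irr. Qed.

Definition dunion : sgraph := SGraph dunion_sym dunion_irr.

End DisjointUnion.

Definition colourable (k : nat) (G : sgraph) : Prop :=
  exists c : G -> 'I_k, forall x y, adj x y -> c x != c y.

Definition set_weight (G : sgraph) (w : G -> nat) (S : {set G}) : nat :=
  \sum_(v in S) w v.

Definition max_weight_colourable (k : nat) (G : sgraph) (w : G -> nat)
    (S : {set G}) : Prop :=
  colourable k (induced S) /\
  forall S' : {set G}, colourable k (induced S') ->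
    set_weight w S' <= set_weight w S.

(* The model of computation is the language of while-programs over binary     *)
(* trees of N. D. Jones (Computability and Complexity from a Programming      *)
(* Perspective), with a cost that charges for the size of the data: an        *)
(* assignment costs one plus the size of the tree it writes. With unit cost,  *)
(* iterating x := cons x x would build exponentially large values in linear   *)
(* time; here the total size of the store never exceeds the size of the input *)
(* plus the cost spent so far (plus a constant), so that a run of cost t is   *)
(* simulated by a Turing machine in time polynomial in t and the input size,  *)
(* and conversely.                                                            *)

Inductive tree := Leaf | Node of tree & tree.

Fixpoint tree_size (x : tree) : nat :=
  if x is Node l r then (tree_size l + tree_size r).+1 else 1.

Inductive expr :=
  | EVar of nat
  | ENil
  | ECons of expr & expr
  | EHd of expr
  | ETl of expr.

Inductive cmd :=
  | CSkip
  | CAssign of nat & expr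
  | CSeq of cmd & cmd
  | CIf of expr & cmd & cmd
  | CWhile of expr & cmd.

Definition store := nat -> tree.

Definition update (s : store) (i : nat) (x : tree) : store :=
  fun j => if j == i then x else s j.

Fixpoint eval (s : store) (e : expr) : tree :=
  match e with
  | EVar i => s i
  | ENil => Leaf
  | ECons a b => Node (eval s a) (eval s b)
  | EHd a => if eval s a is Node l _ then l else Leaf
  | ETl a => if eval s a is Node _ r then r else Leaf
  end.

Definition truth (x : tree) : bool := if x is Leaf then false else true.

(* exec c s t s': started in s, the command c halts in s' at cost t. *)
Inductive exec : cmd -> store -> nat -> store -> Prop :=
  | exec_skip s : exec CSkip s 1 s
  | exec_assign s i e :
      exec (CAssign i e) s (tree_size (eval s e)).+1 (update s i (eval s e))
  | exec_seq c1 c2 s1 s2 s3 t1 t2 :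
      exec c1 s1 t1 s2 -> exec c2 s2 t2 s3 ->
      exec (CSeq c1 c2) s1 (t1 + t2).+1 s3
  | exec_if_true e c1 c2 s s' t :
      truth (eval s e) -> exec c1 s t s' -> exec (CIf e c1 c2) s t.+1 s'
  | exec_if_false e c1 c2 s s' t :
      ~~ truth (eval s e) -> exec c2 s t s' -> exec (CIf e c1 c2) s t.+1 s'
  | exec_while_true e c s1 s2 s3 t1 t2 :
      truth (eval s1 e) -> exec c s1 t1 s2 -> exec (CWhile e c) s2 t2 s3 ->
      exec (CWhile e c) s1 (t1 + t2).+1 s3
  | exec_while_false e c s :
      ~~ truth (eval s e) -> exec (CWhile e c) s 1 s.

(* Input and output are both in variable 0. *)
Definition init_store (x : tree) : store := update (fun _ => Leaf) 0 x.

Definition runs_within (c : cmd) (x y : tree) (b : nat) : Prop :=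
  exists t s, [/\ exec c (init_store x) t s, s 0 = y & t <= b].

Definition enc_bool (b : bool) : tree := if b then Node Leaf Leaf else Leaf.

Definition enc_seq (T : Type) (enc : T -> tree) (s : seq T) : tree :=
  foldr (fun a x => Node (enc a) x) Leaf s.

(* Binary digits, least significant first, without leading zeros. *)
Definition bits (m : nat) : seq bool :=
  mkseq (fun i => odd (m %/ 2 ^ i)) (up_log 2 m.+1).

Definition enc_nat (m : nat) : tree := enc_seq enc_bool (bits m).

(* Adjacency matrix, in the order of enum G. *)
Definition enc_graph (G : sgraph) : tree :=
  enc_seq (fun x => enc_seq (fun y => enc_bool (adj x y)) (enum G)) (enum G).

Definition enc_weights (G : sgraph) (w : G -> nat) : tree :=
  enc_seq (fun x => enc_nat (w x)) (enum G).

Definition enc_instance (G : sgraph) (w : G -> nat) : tree :=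
  Node (enc_graph G) (enc_weights w).

(* Characteristic vector, in the order of enum G. *)
Definition enc_set (G : sgraph) (S : {set G}) : tree :=
  enc_seq (fun x => enc_bool (x \in S)) (enum G).

(* Main.v *)
Require Import Defs.
From mathcomp Require Import all_boot all_order all_algebra.
From mathcomp Require Import zify.

Set Implicit Arguments.
Unset Strict Implicit.
Unset Printing Implicit Defensive.

(* Colourings are found as list colourings, by recursion on the number of colours whose list is not
   empty. A k-coloured connected P5-free set has a connected dominating set of size 1 + 2k^2. If an
   optimal solution H contains an induced P5, then that path and at most k r further vertices
   dominate H; if H has at most r components and no P5, dominate each component. Otherwise r + 1
   components of H are available, and representatives of r of them are an edgeless graph on r
   vertices that makes everything far from them P5-free: every component then has a bounded
   dominating set D such that the component has no neighbour outside N[D], and outside the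
   neighbourhood of r + 1 such sets the whole graph is P5-free. There the candidate pieces, with
   two pieces adjacent when they touch, again form a P5-free graph, so that the best union is an
   independent set of maximum weight in a P5-free graph.

   In the dominated case, guess a dominating set D0 with its colours and a bounded enlargement D.
   The (P5 + rK1)-freeness shows that the lists can be pruned so that vertices with a common colour
   and different neighbourhoods in D0 are not adjacent. The instance splits into one instance for
   each neighbourhood, and each of them lost the colour of a vertex of D0.

   Independent sets in P5-free graphs are found by dynamic programming over polynomially many
   pieces, the hulls: a piece splits along a set described by at most four vertices into components
   that are smaller pieces, all but at most three of which can be read off from that set.

   Polynomial running time is closed under composition, bounded iteration over lists and
   quantification over vertices, so each definition of the algorithm is realised by a program that
   follows its syntax. *)

(** * Polynomial time for while-programs *)

Lemma tree_size_gt0 x : 0 < tree_size x.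
Proof. by case: x. Qed.

Section PolynomialBounds.
Variables (E : Type) (a : E -> tree).

Definition poly_bounded (F : E -> nat) : Prop :=
  exists d, forall x, F x <= (tree_size (a x)).+1 ^ d.

Lemma poly_bounded_le (F F' : E -> nat) :
  (forall x, F x <= F' x) -> poly_bounded F' -> poly_bounded F.
Proof. by move=> le_F [d bound_F']; exists d => x; apply: leq_trans (le_F x) (bound_F' x). Qed.

Lemma poly_bounded_const n : poly_bounded (fun=> n).
Proof.
exists n => x; apply: leq_trans (ltnW (ltn_expl n (isT : 1 < 2))) _.
by case: n => // n; rewrite leq_exp2r // ltnS tree_size_gt0.
Qed.

Lemma poly_bounded_size : poly_bounded (fun x => tree_size (a x)).
Proof. by exists 1 => x; rewrite expn1. Qed.

Lemma poly_bounded_mul F F' :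
  poly_bounded F -> poly_bounded F' -> poly_bounded (fun x => F x * F' x).
Proof.
move=> [d bound_F] [d' bound_F']; exists (d + d') => x.
by rewrite expnD leq_mul.
Qed.

Lemma poly_bounded_add F F' :
  poly_bounded F -> poly_bounded F' -> poly_bounded (fun x => F x + F' x).
Proof.
move=> [d bound_F] [d' bound_F'].
apply: (@poly_bounded_le _ (fun x => 2 * (tree_size (a x)).+1 ^ (d + d'))).
  move=> x; rewrite mul2n -addnn expnD; apply: leq_add.
    by apply: leq_trans (bound_F x) (leq_pmulr _ _); rewrite expn_gt0.
  by apply: leq_trans (bound_F' x) (leq_pmull _ _); rewrite expn_gt0.
by apply: poly_bounded_mul; [apply: poly_bounded_const | exists (d + d')].
Qed.

Lemma poly_bounded_succ F : poly_bounded F -> poly_bounded (fun x => (F x).+1).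
Proof.
move=> bound_F; apply: (@poly_bounded_le _ (fun x => F x + 1)) => [x|]; first by rewrite addn1.
exact: poly_bounded_add bound_F (poly_bounded_const 1).
Qed.

Lemma poly_bounded_exp F d : poly_bounded F -> poly_bounded (fun x => F x ^ d).
Proof.
move=> [d' bound_F]; exists (d' * d) => x; rewrite expnM.
by case: d => // d; rewrite leq_exp2r.
Qed.

Lemma poly_bounded_comp (g : E -> tree) F :
  poly_bounded (fun x => tree_size (g x)) ->
  (exists d, forall x, F x <= (tree_size (g x)).+1 ^ d) -> poly_bounded F.
Proof.
move=> bound_g [d bound_F]; apply: (poly_bounded_le bound_F).
exact/poly_bounded_exp/poly_bounded_succ.
Qed.

End PolynomialBounds.

Ltac poly_bound :=
  repeat first [ assumption | apply: poly_bounded_const | apply: poly_bounded_size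
    | apply: poly_bounded_add | apply: poly_bounded_mul | apply: poly_bounded_exp
    | apply: poly_bounded_succ ].

Section Stores.
Variables (s : store) (i : nat) (x : tree).

Lemma update_same : update s i x i = x.
Proof. by rewrite /update eqxx. Qed.

Lemma update_below j : j < i -> update s i x j = s j.
Proof. by move=> lt_ji; rewrite /update ltn_eqF. Qed.

Lemma update_above j : i < j -> update s i x j = s j.
Proof. by move=> lt_ij; rewrite /update gtn_eqF. Qed.

End Stores.

Lemma exec_size c s t s' : exec c s t s' ->
  forall v, tree_size (s' v) <= maxn (tree_size (s v)) t.
Proof.
elim=> {c s t s'} //.
- by move=> s v; rewrite leq_maxl.
- by move=> s i ex v; rewrite /update; case: eqP => _; lia.
- by move=> c1 c2 s1 s2 s3 t1 t2 _ le12 _ le23 v; have := le12 v; have := le23 v; lia.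
- by move=> ex c1 c2 s s' t _ _ le_t v; have := le_t v; lia.
- by move=> ex c1 c2 s s' t _ _ le_t v; have := le_t v; lia.
- by move=> ex c s1 s2 s3 t1 t2 _ _ le12 _ le23 v; have := le12 v; have := le23 v; lia.
- by move=> ex c s _ v; rewrite leq_maxl.
Qed.

Definition computes (c : cmd) (b : nat) (s : store) (y : tree) (n : nat) : Prop :=
  exists t s', [/\ exec c s t s', s' b = y, forall j, j < b -> s' j = s j & t <= n].

(* The program is relocatable: it runs at any base register b, finding its input and leaving its
   output there, and does not change the registers below b. The index type E carries the
   mathematical objects that a x and g x encode. *)
Definition ptime (E : Type) (a g : E -> tree) : Prop :=
  exists (c : nat -> cmd) (F : E -> nat), poly_bounded a F /\
  forall x b s, s b = a x -> computes (c b) b s (g x) (F x).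

Section Basics.
Variables (E : Type).
Implicit Types a g h : E -> tree.

Lemma ptime_size a g : ptime a g -> poly_bounded a (fun x => tree_size (g x)).
Proof.
move=> [c [F [bound_F run_c]]].
apply: (@poly_bounded_le _ _ _ (fun x => tree_size (a x) + F x)); last by poly_bound.
move=> x; have [t [s' [run <- _ le_t]]] := run_c x 0 (fun=> a x) erefl.
by have := exec_size run 0; lia.
Qed.

Lemma ptime_ext a g h : g =1 h -> ptime a g -> ptime a h.
Proof.
move=> eq_gh [c [F [bound_F run_c]]]; exists c, F; split=> // x b s sb.
by rewrite -eq_gh; apply: run_c.
Qed.

Lemma ptime_id a : ptime a a.
Proof.
exists (fun=> CSkip), (fun=> 1); split; first by poly_bound.
by move=> x b s sb; exists 1, s; split=> //; constructor.
Qed.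

Lemma ptime_comp a g h : ptime a g -> ptime g h -> ptime a h.
Proof.
move=> g_ptime [c' [F' [bound_F' run_c']]]; have size_g := ptime_size g_ptime.
move: g_ptime => [c [F [bound_F run_c]]].
exists (fun b => CSeq (c b) (c' b)), (fun x => (F x + F' x).+1); split.
  by have bound_F'a := poly_bounded_comp size_g bound_F'; poly_bound.
move=> x b s sb; have [t [s1 [run1 s1b kept1 le_t]]] := run_c x b s sb.
have [t' [s2 [run2 s2b kept2 le_t']]] := run_c' x b s1 s1b.
exists (t + t').+1, s2; split=> //; [exact: exec_seq run1 run2 | | lia].
by move=> j lt_jb; rewrite kept2 // kept1.
Qed.

Lemma ptime_node a g h : ptime a g -> ptime a h ->
  ptime a (fun x => Node (g x) (h x)).
Proof.
move=> g_ptime h_ptime; have size_g := ptime_size g_ptime; have size_h := ptime_size h_ptime.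
move: g_ptime h_ptime => [c [F [bound_F run_c]]] [c' [F' [bound_F' run_c']]].
exists (fun b => CSeq (CAssign b.+1 (EVar b)) (CSeq (c b.+1)
  (CSeq (CAssign b.+2 (EVar b)) (CSeq (c' b.+2)
     (CAssign b (ECons (EVar b.+1) (EVar b.+2))))))).
exists (fun x => tree_size (a x) + tree_size (a x) +
  ((F x + F' x) + (tree_size (g x) + tree_size (h x) + 8))); split; first by poly_bound.
move=> x b s sb; set s1 := update s b.+1 (s b).
have s1b1 : s1 b.+1 = a x by rewrite /s1 update_same.
have [t1 [s2 [run_g s2b1 kept_g le_t1]]] := run_c x b.+1 s1 s1b1.
have s2b : s2 b = a x by rewrite kept_g // /s1 update_below.
set s3 := update s2 b.+2 (s2 b).
have s3b2 : s3 b.+2 = a x by rewrite /s3 update_same.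
have [t2 [s4 [run_h s4b2 kept_h le_t2]]] := run_c' x b.+2 s3 s3b2.
have s4b1 : s4 b.+1 = g x by rewrite kept_h // /s3 update_below.
eexists _, (update s4 b (Node (g x) (h x))); split.
- refine (exec_seq (exec_assign s b.+1 (EVar b)) (exec_seq run_g
    (exec_seq (exec_assign s2 b.+2 (EVar b)) (exec_seq run_h _)))).
  have -> : Node (g x) (h x) = eval s4 (ECons (EVar b.+1) (EVar b.+2)).
    by rewrite /= s4b1 s4b2.
  exact: exec_assign.
- exact: update_same.
- move=> j lt_jb; rewrite update_below // kept_h /s3 ?update_below ?kept_g /s1 ?update_below //;
  lia.
- by rewrite /= s4b1 s4b2 sb s2b; lia.
Qed.

Lemma ptime_expr a g (ex : nat -> expr) :
  (forall x b s, s b = a x -> eval s (ex b) = g x) ->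
  poly_bounded a (fun x => tree_size (g x)) -> ptime a g.
Proof.
move=> eval_ex size_g; exists (fun b => CAssign b (ex b)), (fun x => (tree_size (g x)).+1).
split; first by poly_bound.
move=> x b s sb; eexists _, _; split; first exact: exec_assign.
- by rewrite update_same; apply: eval_ex sb.
- by move=> j lt_jb; rewrite update_below.
- by rewrite (eval_ex _ _ _ sb).
Qed.

Definition tree_hd (x : tree) : tree := if x is Node l _ then l else Leaf.
Definition tree_tl (x : tree) : tree := if x is Node _ r then r else Leaf.

Lemma tree_size_hd x : tree_size (tree_hd x) <= tree_size x.
Proof. by case: x => //= l r; lia. Qed.

Lemma tree_size_tl x : tree_size (tree_tl x) <= tree_size x.
Proof. by case: x => //= l r; lia. Qed.

Lemma ptime_hd a g : ptime a g -> ptime a (fun x => tree_hd (g x)).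
Proof.
move=> g_ptime; apply: ptime_comp g_ptime _; apply: (ptime_expr (ex := fun b => EHd (EVar b))).
  by move=> x b s /= ->.
exact: poly_bounded_le (fun x => tree_size_hd _) (poly_bounded_size _).
Qed.

Lemma ptime_tl a g : ptime a g -> ptime a (fun x => tree_tl (g x)).
Proof.
move=> g_ptime; apply: ptime_comp g_ptime _; apply: (ptime_expr (ex := fun b => ETl (EVar b))).
  by move=> x b s /= ->.
exact: poly_bounded_le (fun x => tree_size_tl _) (poly_bounded_size _).
Qed.

Fixpoint const_expr (t : tree) : expr :=
  if t is Node l r then ECons (const_expr l) (const_expr r) else ENil.

Lemma ptime_const a (t : tree) : ptime a (fun=> t).
Proof.
apply: (ptime_expr (ex := fun=> const_expr t)); last exact: poly_bounded_const.
by move=> _ _ s _; elim: t => //= l -> r ->.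
Qed.

Lemma ptime_if a (A : E -> Type) (enc : forall x, A x -> tree) (p : E -> bool)
    (u v : forall x, A x) :
  ptime a (fun x => enc_bool (p x)) -> ptime a (fun x => enc x (u x)) ->
  ptime a (fun x => enc x (v x)) -> ptime a (fun x => enc x (if p x then u x else v x)).
Proof.
move=> [cp [Fp [bound_Fp run_cp]]] [c [F [bound_F run_c]]] [c' [F' [bound_F' run_c']]].
exists (fun b => CSeq (CAssign b.+1 (EVar b)) (CSeq (cp b.+1)
  (CIf (EVar b.+1) (c b) (c' b)))).
exists (fun x => tree_size (a x) + (Fp x + (F x + (F' x + 6)))); split; first by poly_bound.
move=> x b s sb; set s1 := update s b.+1 (s b).
have s1b1 : s1 b.+1 = a x by rewrite /s1 update_same.
have [t1 [s2 [run_p s2b1 kept_p le_t1]]] := run_cp x b.+1 s1 s1b1.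
have s2b : s2 b = a x by rewrite kept_p // /s1 update_below.
have kept j : j < b -> s2 j = s j by move=> lt_jb; rewrite kept_p /s1 ?update_below //; lia.
case p_x: (p x) in s2b1 *.
  have [t2 [s3 [run3 s3b kept3 le_t2]]] := run_c x b s2 s2b.
  have test : truth (eval s2 (EVar b.+1)) by rewrite /= s2b1.
  eexists _, s3; split; [exact (exec_seq (exec_assign s b.+1 (EVar b))
    (exec_seq run_p (exec_if_true _ test run3))) | by [] | | by rewrite /= sb; lia].
  by move=> j lt_jb; rewrite kept3 // kept.
have [t2 [s3 [run3 s3b kept3 le_t2]]] := run_c' x b s2 s2b.
have test : ~~ truth (eval s2 (EVar b.+1)) by rewrite /= s2b1.
eexists _, s3; split; [exact (exec_seq (exec_assign s b.+1 (EVar b))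
  (exec_seq run_p (exec_if_false _ test run3))) | by [] | | by rewrite /= sb; lia].
by move=> j lt_jb; rewrite kept3 // kept.
Qed.

End Basics.

Lemma ptime_reindex E E' (f : E' -> E) (a g : E -> tree) :
  ptime a g -> ptime (fun x => a (f x)) (fun x => g (f x)).
Proof.
move=> [c [F [[d bound_F] run_c]]]; exists c, (fun x => F (f x)).
by split=> [|x b s sb]; [exists d => x; apply: bound_F | apply: run_c].
Qed.

(* Passing from a to env a enc adds one bound variable to the context of a program. *)
Definition env (E : Type) (B : E -> Type) (a : E -> tree)
    (enc : forall x, B x -> tree) (s : {x : E & B x}) : tree :=
  Node (a (tag s)) (enc (tag s) (tagged s)).

Section Env.
Variables (E : Type) (a : E -> tree).

Lemma ptime_lift (B : E -> Type) (enc : forall x, B x -> tree) g : ptime a g ->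
  ptime (env a enc) (fun s => g (tag s)).
Proof.
move=> g_ptime; apply: (@ptime_comp _ _ (fun s => a (tag s))).
  exact: (@ptime_hd _ _ _ (ptime_id (env a enc))).
exact: (ptime_reindex (fun s : {x : E & B x} => tag s) g_ptime).
Qed.

Lemma ptime_var (B : E -> Type) (enc : forall x, B x -> tree) :
  ptime (env a enc) (fun s => enc _ (tagged s)).
Proof. exact: (@ptime_tl _ _ _ (ptime_id (env a enc))). Qed.

Lemma ptime_lift_under (A B : E -> Type) (encA : forall x, A x -> tree)
    (encB : forall x, B x -> tree) (g : forall x, B x -> tree) :
  ptime (env a encB) (fun s => g _ (tagged s)) ->
  ptime (env (env a encA) (fun s => @encB (tag s))) (fun s => g _ (tagged s)).
Proof.
move=> g_ptime; set a2 := env _ _.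
pose forget (s : {s : {x : E & A x} & B (tag s)}) := existT B (tag (tag s)) (tagged s).
refine (@ptime_comp _ a2 (fun s => env a encB (forget s)) _ _ (ptime_reindex forget g_ptime)).
exact: (ptime_node (ptime_hd (ptime_hd (ptime_id a2))) (ptime_tl (ptime_id a2))).
Qed.

End Env.

Lemma tree_size_seq (A : Type) (enc : A -> tree) (s : seq A) :
  tree_size (enc_seq enc s) = (size s + \sum_(y <- s) tree_size (enc y)).+1.
Proof. by elim: s => [|y s IH] /=; rewrite ?big_nil ?big_cons //; lia. Qed.

Section FoldLoop.
Variables (A B : Type) (encA : A -> tree) (encB : B -> tree) (step : A -> B -> A).
Variables (step_cmd : nat -> cmd) (input : tree) (z : A) (l : seq B) (n m : nat).

Hypothesis step_run : forall l1 y l2, l = l1 ++ y :: l2 -> forall b s,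
  s b = Node (Node input (encA (foldl step z l1))) (encB y) ->
  computes (step_cmd b) b s (encA (step (foldl step z l1) y)) n.
Hypothesis acc_size : forall l1 l2, l = l1 ++ l2 -> tree_size (encA (foldl step z l1)) <= m.

Definition fold_body (b : nat) : cmd :=
  CSeq (CAssign b.+3 (ECons (ECons (EVar b) (EVar b.+2)) (EHd (EVar b.+1))))
    (CSeq (step_cmd b.+3)
      (CSeq (CAssign b.+2 (EVar b.+3)) (CAssign b.+1 (ETl (EVar b.+1))))).

Let lsize := tree_size (enc_seq encB l).
Let body_cost := tree_size input + n + 2 * m + 2 * lsize + 8.

Let suffix_size l1 l2 : l = l1 ++ l2 -> tree_size (enc_seq encB l2) <= lsize.
Proof. by move=> eq_l; rewrite /lsize eq_l !tree_size_seq size_cat big_cat /=; lia. Qed.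

Lemma fold_body_exec b s l1 y l2 : l = l1 ++ y :: l2 -> s b = input ->
  s b.+1 = enc_seq encB (y :: l2) -> s b.+2 = encA (foldl step z l1) ->
  exists t s', [/\ exec (fold_body b) s t s', s' b.+1 = enc_seq encB l2,
    s' b.+2 = encA (foldl step z (rcons l1 y)), forall j, j <= b -> s' j = s j &
    t <= body_cost].
Proof.
move=> eq_l sb sb1 sb2; set arg := Node (Node input (encA (foldl step z l1))) (encB y).
have [t [s2 [run s2b3 kept le_t]]] := step_run eq_l (update_same s b.+3 arg).
rewrite -[step _ y]foldl_rcons in s2b3.
have s2b1 : s2 b.+1 = enc_seq encB (y :: l2) by rewrite kept ?update_below.
set s3 := update s2 b.+2 (s2 b.+3); set s4 := update s3 b.+1 (enc_seq encB l2).
have load : exec (CAssign b.+3 (ECons (ECons (EVar b) (EVar b.+2)) (EHd (EVar b.+1)))) s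
    (tree_size arg).+1 (update s b.+3 arg).
  by have -> : arg = eval s (ECons (ECons (EVar b) (EVar b.+2)) (EHd (EVar b.+1)));
    [rewrite /= sb sb1 sb2 | apply: exec_assign].
have advance : exec (CAssign b.+1 (ETl (EVar b.+1))) s3 (tree_size (enc_seq encB l2)).+1 s4.
  rewrite /s4; have -> : enc_seq encB l2 = eval s3 (ETl (EVar b.+1)).
    by rewrite /s3 /= update_below // s2b1.
  exact: exec_assign.
exists (((tree_size arg).+1 + (t + ((tree_size (s2 b.+3)).+1
  + (tree_size (enc_seq encB l2)).+1).+1).+1).+1), s4; split.
- exact (exec_seq load (exec_seq run (exec_seq (exec_assign s2 b.+2 (EVar b.+3)) advance))).
- exact: update_same.
- by rewrite /s4 update_above // /s3 update_same.
- by move=> j le_jb; rewrite /s4 /s3 !update_below ?kept ?update_below //; lia.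
have eq_rcons : l = rcons l1 y ++ l2 by rewrite cat_rcons.
have := acc_size eq_l; have := acc_size eq_rcons; have := suffix_size eq_l.
by rewrite s2b3 /body_cost /arg /=; lia.
Qed.

Lemma fold_loop_exec l2 l1 b s : l = l1 ++ l2 -> s b = input -> s b.+1 = enc_seq encB l2 ->
  s b.+2 = encA (foldl step z l1) ->
  exists t s', [/\ exec (CWhile (EVar b.+1) (fold_body b)) s t s',
    s' b.+2 = encA (foldl step z l), forall j, j <= b -> s' j = s j &
    t <= (size l2 * body_cost.+1).+1].
Proof.
elim: l2 l1 s => [|y l2 IH] l1 s eq_l sb sb1 sb2.
  exists 1, s; split=> //; first by apply: exec_while_false; rewrite /= sb1.
  by rewrite eq_l cats0.
have [t [s1 [run s1b1 s1b2 kept le_t]]] := fold_body_exec eq_l sb sb1 sb2.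
have eq_rcons : l = rcons l1 y ++ l2 by rewrite cat_rcons.
have s1b : s1 b = input by rewrite kept.
have [t' [s2 [loop s2b2 kept' le_t']]] := IH _ s1 eq_rcons s1b s1b1 s1b2.
have test : truth (eval s (EVar b.+1)) by rewrite /= sb1.
eexists _, s2; split; [exact: exec_while_true test run loop | by [] | | ].
  by move=> j le_jb; rewrite kept' // kept.
by rewrite /= mulSn; lia.
Qed.

End FoldLoop.

Section Fold.
Variables (E : Type) (A B : E -> Type) (a : E -> tree).
Variables (encA : forall x, A x -> tree) (encB : forall x, B x -> tree).
Variables (step : forall x, A x -> B x -> A x) (z : forall x, A x) (l : forall x, seq (B x)).
Variable acc_bound : E -> nat.

Hypothesis l_ptime : ptime a (fun x => enc_seq (@encB x) (l x)).
Hypothesis z_ptime : ptime a (fun x => encA (z x)).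
Hypothesis step_ptime : ptime (env (env a encA) (fun s => @encB (tag s)))
  (fun s => encA (step (tagged (tag s)) (tagged s))).
Hypothesis acc_poly : poly_bounded a acc_bound.
Hypothesis acc_size : forall x i,
  tree_size (encA (foldl (@step x) (z x) (take i (l x)))) <= acc_bound x.

Let lsize x := tree_size (enc_seq (@encB x) (l x)).

Lemma fold_step_computes : exists (c : nat -> cmd) (n : E -> nat), poly_bounded a n /\
  forall x l1 y l2, l x = l1 ++ y :: l2 -> forall b s,
    s b = Node (Node (a x) (encA (foldl (@step x) (z x) l1))) (encB y) ->
    computes (c b) b s (encA (step (foldl (@step x) (z x) l1) y)) (n x).
Proof.
case: step_ptime => [c [F [[d bound_F] run_c]]].
exists c, (fun x => (tree_size (a x) + (acc_bound x + (lsize x + 3))) ^ d); split.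
  by have size_l := ptime_size l_ptime; poly_bound.
move=> x l1 y l2 eq_l b s sb.
pose arg := existT (fun t : {x : E & A x} => B (tag t)) (existT A x (foldl (@step x) (z x) l1)) y.
have [t [s' [run s'b kept le_t]]] := run_c arg b s sb.
exists t, s'; split=> //; apply: leq_trans le_t (leq_trans (bound_F _) _).
case: (d) => // d'; rewrite leq_exp2r // /env /=.
have /= := acc_size x (size l1); rewrite {1}eq_l take_size_cat //.
by rewrite /lsize eq_l tree_size_seq size_cat big_cat big_cons /=; lia.
Qed.

Lemma ptime_foldl : ptime a (fun x => encA (foldl (@step x) (z x) (l x))).
Proof.
have size_l := ptime_size l_ptime.
have [step_cmd [n [n_poly run_step]]] := fold_step_computes.
case: l_ptime z_ptime => [cl [Fl [bound_Fl run_l]]] [cz [Fz [bound_Fz run_z]]].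
exists (fun b => CSeq (CAssign b.+1 (EVar b)) (CSeq (cl b.+1)
  (CSeq (CAssign b.+2 (EVar b)) (CSeq (cz b.+2)
    (CSeq (CWhile (EVar b.+1) (fold_body step_cmd b)) (CAssign b (EVar b.+2))))))).
exists (fun x => 2 * tree_size (a x) + (Fl x + Fz x) +
  (lsize x * (tree_size (a x) + n x + 2 * acc_bound x + 2 * lsize x + 9) + acc_bound x + 12)).
split; first by poly_bound.
move=> x b s sb; set s1 := update s b.+1 (s b).
have s1b1 : s1 b.+1 = a x by rewrite /s1 update_same.
have [t1 [s2 [run2 s2b1 kept2 le_t1]]] := run_l x b.+1 s1 s1b1.
have s2b : s2 b = a x by rewrite kept2 // /s1 update_below.
set s3 := update s2 b.+2 (s2 b); have s3b2 : s3 b.+2 = a x by rewrite /s3 update_same.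
have [t2 [s4 [run4 s4b2 kept4 le_t2]]] := run_z x b.+2 s3 s3b2.
have kept j : j <= b -> s4 j = s j.
  by move=> le_jb; rewrite kept4 /s3 ?update_below ?kept2 /s1 ?update_below //; lia.
have s4b1 : s4 b.+1 = enc_seq (@encB x) (l x) by rewrite kept4 // /s3 update_below.
have acc_le l1 l2 : l x = l1 ++ l2 -> tree_size (encA (foldl (@step x) (z x) l1)) <= acc_bound x.
  by move=> eq_l; have := acc_size x (size l1); rewrite eq_l take_size_cat.
have s4b : s4 b = a x by rewrite kept.
have [t5 [s5 [loop s5b2 kept5 le_t5]]] :=
  fold_loop_exec (run_step x) acc_le (l1 := [::]) erefl s4b s4b1 s4b2.
eexists _, (update s5 b (eval s5 (EVar b.+2))); split.
- exact (exec_seq (exec_assign s b.+1 (EVar b)) (exec_seq run2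
    (exec_seq (exec_assign s2 b.+2 (EVar b)) (exec_seq run4 (exec_seq loop
    (exec_assign _ _ _)))))).
- by rewrite update_same.
- by move=> j lt_jb; rewrite update_below // kept5 ?kept //; lia.
have := acc_le (l x) [::] (esym (cats0 _)).
set K := tree_size (a x) + n x + 2 * acc_bound x + 2 * lsize x + 9.
have : size (l x) * K <= lsize x * K.
  by rewrite leq_mul2r /lsize tree_size_seq; apply/orP; right; lia.
rewrite -addnS -/K in le_t5; rewrite /= s5b2 sb s2b; lia.
Qed.

End Fold.

Section Booleans.
Variables (E : Type) (a : E -> tree) (p q : E -> bool).
Hypotheses (p_ptime : ptime a (fun x => enc_bool (p x)))
  (q_ptime : ptime a (fun x => enc_bool (q x))).

Lemma ptime_if_bool q' : ptime a (fun x => enc_bool (q' x)) ->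
  ptime a (fun x => enc_bool (if p x then q x else q' x)).
Proof. exact: (ptime_if (enc := fun=> enc_bool) p_ptime q_ptime). Qed.

Lemma ptime_negb : ptime a (fun x => enc_bool (~~ p x)).
Proof.
by apply: (ptime_if (enc := fun=> enc_bool) (u := fun=> false) (v := fun=> true) p_ptime);
  apply: ptime_const.
Qed.

Lemma ptime_andb : ptime a (fun x => enc_bool (p x && q x)).
Proof. by apply: (ptime_if_bool (q' := fun=> false)); apply: ptime_const. Qed.

Lemma ptime_orb : ptime a (fun x => enc_bool (p x || q x)).
Proof.
by apply: (ptime_if (enc := fun=> enc_bool) (u := fun=> true) (v := q) p_ptime) => //;
  apply: ptime_const.
Qed.

Lemma ptime_implyb : ptime a (fun x => enc_bool (p x ==> q x)).
Proof. by apply: (ptime_if_bool (q' := fun=> true)); apply: ptime_const. Qed.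

End Booleans.

Lemma ptime_eqb (E : Type) (a : E -> tree) (p q : E -> bool) :
  ptime a (fun x => enc_bool (p x)) -> ptime a (fun x => enc_bool (q x)) ->
  ptime a (fun x => enc_bool (p x == q x)).
Proof.
move=> p_ptime q_ptime.
apply: ptime_ext (ptime_if_bool p_ptime q_ptime (ptime_negb q_ptime)) => x.
by case: (p x); case: (q x).
Qed.

Definition enc_pair (A B : Type) (encA : A -> tree) (encB : B -> tree) (p : A * B) : tree :=
  Node (encA p.1) (encB p.2).

Section Pairs.
Variables (E : Type) (A B : E -> Type) (a : E -> tree).
Variables (encA : forall x, A x -> tree) (encB : forall x, B x -> tree).

Lemma ptime_fst (p : forall x, A x * B x) :
  ptime a (fun x => enc_pair (@encA x) (@encB x) (p x)) -> ptime a (fun x => encA (p x).1).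
Proof. exact: ptime_hd. Qed.

Lemma ptime_snd (p : forall x, A x * B x) :
  ptime a (fun x => enc_pair (@encA x) (@encB x) (p x)) -> ptime a (fun x => encB (p x).2).
Proof. exact: ptime_tl. Qed.

Lemma ptime_pair (u : forall x, A x) (v : forall x, B x) :
  ptime a (fun x => encA (u x)) -> ptime a (fun x => encB (v x)) ->
  ptime a (fun x => enc_pair (@encA x) (@encB x) (u x, v x)).
Proof. exact: ptime_node. Qed.

End Pairs.

Lemma enc_seq_map (A B : Type) (enc : B -> tree) (f : A -> B) s :
  enc_seq enc [seq f y | y <- s] = enc_seq (fun y => enc (f y)) s.
Proof. by elim: s => //= y s ->. Qed.

Lemma eq_in_enc_seq (A : eqType) (f g : A -> tree) s :
  {in s, f =1 g} -> enc_seq f s = enc_seq g s.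
Proof.
elim: s => //= y s IH eq_fg; rewrite eq_fg ?mem_head // IH // => z zs.
by apply: eq_fg; rewrite inE zs orbT.
Qed.

Section EncodedSize.
Variables (A : Type) (enc : A -> tree).
Implicit Types s : seq A.

Lemma tree_size_seq_cat s s' :
  tree_size (enc_seq enc s) + tree_size (enc_seq enc s') = (tree_size (enc_seq enc (s ++ s'))).+1.
Proof. by rewrite !tree_size_seq size_cat big_cat /=; lia. Qed.

Lemma tree_size_seq_rev s : tree_size (enc_seq enc (rev s)) = tree_size (enc_seq enc s).
Proof. by rewrite !tree_size_seq size_rev big_rev. Qed.

Lemma tree_size_seq_take s i : tree_size (enc_seq enc (take i s)) <= tree_size (enc_seq enc s).
Proof. by rewrite -[s in leqRHS](cat_take_drop i) !tree_size_seq size_cat big_cat /=; lia. Qed.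

Lemma tree_size_seq_drop s i : tree_size (enc_seq enc (drop i s)) <= tree_size (enc_seq enc s).
Proof. by rewrite -[s in leqRHS](cat_take_drop i) !tree_size_seq size_cat big_cat /=; lia. Qed.

Lemma leq_tree_size_seq (g : A -> tree) (h : nat -> nat) s : {homo h : m n / m <= n} ->
  (forall y, tree_size (g y) <= h (tree_size (enc y))) ->
  tree_size (enc_seq g s) <= (size s * (h (tree_size (enc_seq enc s))).+1).+1.
Proof.
move=> h_mono le_g; elim: s => //= y s IH; set M := (tree_size (enc y) + _).+1.
have le_h : h (tree_size (enc_seq enc s)) <= h M by apply: h_mono; rewrite /M; lia.
have := leq_mul (leqnn (size s)) (le_h : (h _).+1 <= (h M).+1).
have : tree_size (g y) <= h M by apply: leq_trans (le_g y) (h_mono _ _ _); rewrite /M; lia.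
by rewrite mulSn; lia.
Qed.

End EncodedSize.

Lemma foldl_cons_rev (A B : Type) (f : A -> B) s z :
  foldl (fun acc y => f y :: acc) z s = rev (map f s) ++ z.
Proof. by elim: s z => //= y s IH z; rewrite IH rev_cons cat_rcons. Qed.

Lemma foldl_orb (A : Type) (p : pred A) s b : foldl (fun c y => c || p y) b s = b || has p s.
Proof. by elim: s b => [|y s IH] b /=; rewrite ?orbF // IH orbA. Qed.

Lemma foldl_cat (A : Type) (s : seq (seq A)) z : foldl cat z s = z ++ flatten s.
Proof. by elim: s z => [|y s IH] z /=; rewrite ?cats0 // IH catA. Qed.

Section Lists.
Variables (E : Type) (B : E -> Type) (a : E -> tree) (enc : forall x, B x -> tree).
Implicit Types (l : forall x, seq (B x)) (p : forall x, B x -> bool).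

Lemma ptime_cons (u : forall x, B x) l :
  ptime a (fun x => enc (u x)) -> ptime a (fun x => enc_seq (@enc x) (l x)) ->
  ptime a (fun x => enc_seq (@enc x) (u x :: l x)).
Proof. exact: ptime_node. Qed.

Lemma ptime_behead l :
  ptime a (fun x => enc_seq (@enc x) (l x)) -> ptime a (fun x => enc_seq (@enc x) (behead (l x))).
Proof. by move=> /ptime_tl; apply: ptime_ext => x; case: (l x). Qed.

Lemma ptime_has l p :
  ptime a (fun x => enc_seq (@enc x) (l x)) ->
  ptime (env a enc) (fun s => enc_bool (p _ (tagged s))) ->
  ptime a (fun x => enc_bool (has (p x) (l x))).
Proof.
move=> l_ptime p_ptime.
apply: (ptime_ext (g := fun x => enc_bool (foldl (fun c y => c || p x y) false (l x)))).
  by move=> x; rewrite foldl_orb.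
apply: (ptime_foldl (encA := fun=> enc_bool) l_ptime (acc_bound := fun=> 3)).
- exact: ptime_const.
- apply: ptime_orb (ptime_lift _ (ptime_var _ _)) _.
  exact: (ptime_lift_under _ (g := fun x y => enc_bool (p x y)) p_ptime).
- by poly_bound.
- by move=> x i; case: (foldl _ _ _).
Qed.

Lemma ptime_all l p :
  ptime a (fun x => enc_seq (@enc x) (l x)) ->
  ptime (env a enc) (fun s => enc_bool (p _ (tagged s))) ->
  ptime a (fun x => enc_bool (all (p x) (l x))).
Proof.
move=> l_ptime /ptime_negb p_ptime.
have := ptime_negb (ptime_has (p := fun x y => ~~ p x y) l_ptime p_ptime).
apply: ptime_ext => x; rewrite -all_predC; congr enc_bool.
by apply: eq_all => y /=; rewrite negbK.
Qed.

Lemma ptime_nilp l :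
  ptime a (fun x => enc_seq (@enc x) (l x)) -> ptime a (fun x => enc_bool (nilp (l x))).
Proof.
move=> l_ptime; have := ptime_negb (ptime_has (p := fun=> xpredT) l_ptime (ptime_const _ _)).
by apply: ptime_ext => x; case: (l x).
Qed.

Lemma ptime_rev_map l (g : forall x, B x -> tree) :
  ptime a (fun x => enc_seq (@enc x) (l x)) ->
  ptime (env a enc) (fun s => g _ (tagged s)) ->
  ptime a (fun x => enc_seq id (rev (map (g x) (l x)))).
Proof.
move=> l_ptime g_ptime; have [d size_g] := ptime_size g_ptime.
have size_l := ptime_size l_ptime.
pose cost x n := (tree_size (a x) + (n + 2)) ^ d.
pose L x := tree_size (enc_seq (@enc x) (l x)).
apply: (ptime_ext (g := fun x => enc_seq id (foldl (fun acc y => g x y :: acc) [::] (l x)))).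
  by move=> x; rewrite foldl_cons_rev cats0.
apply: (ptime_foldl (A := fun=> seq tree) (encA := fun=> enc_seq id) l_ptime
  (acc_bound := fun x => (L x * (cost x (L x)).+1).+1)).
- exact: ptime_const.
- apply: ptime_node (ptime_lift _ (ptime_var _ _)).
  exact: (ptime_lift_under _ (g := g) g_ptime).
- by rewrite /cost; poly_bound.
move=> x i; rewrite foldl_cons_rev cats0 tree_size_seq_rev enc_seq_map.
apply: leq_trans (tree_size_seq_take _ _ _) _.
have cost_mono : {homo cost x : m n / m <= n}.
  by move=> m n le_mn; rewrite /cost; case: (d) => // d'; rewrite leq_exp2r //; lia.
apply: leq_trans (leq_tree_size_seq (enc := @enc x) (l x) cost_mono _) _ => [y|].
  apply: leq_trans (size_g (existT _ x y)) _; rewrite /cost /env /=.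
  by case: (d) => // d'; rewrite leq_exp2r //; lia.
by rewrite ltnS leq_mul // /L tree_size_seq; lia.
Qed.

End Lists.

Section ListTransforms.
Variables (E : Type) (B : E -> Type) (a : E -> tree) (enc : forall x, B x -> tree).
Implicit Types (l : forall x, seq (B x)) (p : forall x, B x -> bool).

Lemma ptime_enc_seq l (g : forall x, B x -> tree) :
  ptime a (fun x => enc_seq (@enc x) (l x)) ->
  ptime (env a enc) (fun s => g _ (tagged s)) ->
  ptime a (fun x => enc_seq (g x) (l x)).
Proof.
move=> l_ptime g_ptime.
have := ptime_rev_map (g := fun=> id) (ptime_rev_map l_ptime g_ptime) (ptime_var _ _).
by apply: ptime_ext => x; rewrite map_id revK enc_seq_map.
Qed.

Lemma ptime_map (C : E -> Type) (encC : forall x, C x -> tree) (f : forall x, B x -> C x) l :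
  ptime a (fun x => enc_seq (@enc x) (l x)) ->
  ptime (env a enc) (fun s => encC _ (f _ (tagged s))) ->
  ptime a (fun x => enc_seq (@encC x) [seq f x y | y <- l x]).
Proof.
move=> l_ptime f_ptime; have := ptime_enc_seq (g := fun x y => encC x (f x y)) l_ptime f_ptime.
by apply: ptime_ext => x; rewrite enc_seq_map.
Qed.

Lemma ptime_cat l l' :
  ptime a (fun x => enc_seq (@enc x) (l x)) ->
  ptime a (fun x => enc_seq (@enc x) (l' x)) ->
  ptime a (fun x => enc_seq (@enc x) (l x ++ l' x)).
Proof.
move=> l_ptime l'_ptime; have rev_ptime := ptime_rev_map l_ptime (ptime_var a enc).
have size_l := ptime_size l_ptime; have size_l' := ptime_size l'_ptime.
apply: (ptime_ext (g := fun x => enc_seq id (foldl (fun acc y => y :: acc)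
  (map (@enc x) (l' x)) (rev (map (@enc x) (l x)))))).
  by move=> x; rewrite foldl_cons_rev map_id revK -map_cat enc_seq_map.
apply: (ptime_foldl (A := fun=> seq tree) (encA := fun=> enc_seq id) rev_ptime (acc_bound :=
  fun x => tree_size (enc_seq (@enc x) (l x)) + tree_size (enc_seq (@enc x) (l' x)))).
- by apply: ptime_ext l'_ptime => x; rewrite enc_seq_map.
- exact: (ptime_node (ptime_var _ _) (ptime_lift _ (ptime_var _ _))).
- by poly_bound.
move=> x i; rewrite foldl_cons_rev map_id.
have := tree_size_seq_cat id (rev (take i (rev (map (@enc x) (l x))))) (map (@enc x) (l' x)).
have := tree_size_seq_take id (rev (map (@enc x) (l x))) i.
rewrite !tree_size_seq_rev !enc_seq_map /= => le_take eq_cat.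
by apply: leq_trans (leq_add le_take (leqnn _)); rewrite eq_cat.
Qed.

End ListTransforms.

Definition enc_unary (n : nat) : tree := enc_seq (fun=> Leaf) (nseq n tt).

Lemma tree_size_unary n : tree_size (enc_unary n) = n.*2.+1.
Proof. by rewrite tree_size_seq size_nseq big_nseq iter_addn /=; lia. Qed.

Lemma ptime_size_seq (E : Type) (a : E -> tree) (B : E -> Type) (enc : forall x, B x -> tree)
    (l : forall x, seq (B x)) :
  ptime a (fun x => enc_seq (@enc x) (l x)) -> ptime a (fun x => enc_unary (size (l x))).
Proof.
move=> l_ptime; have := ptime_enc_seq (g := fun=> fun=> Leaf) l_ptime (ptime_const _ _).
by apply: ptime_ext => x; rewrite /enc_unary; elim: (l x) => //= y s ->.
Qed.

Section Flatten.
Variables (E : Type) (B : E -> Type) (a : E -> tree) (enc : forall x, B x -> tree).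

Lemma ptime_flatten (ll : forall x, seq (seq (B x))) :
  ptime a (fun x => enc_seq (enc_seq (@enc x)) (ll x)) ->
  ptime a (fun x => enc_seq (@enc x) (flatten (ll x))).
Proof.
move=> ll_ptime; have size_ll := ptime_size ll_ptime.
apply: (ptime_ext (g := fun x => enc_seq (@enc x) (foldl cat [::] (ll x)))).
  by move=> x; rewrite foldl_cat.
apply: (ptime_foldl (A := fun x => seq (B x)) (encA := fun x => enc_seq (@enc x)) ll_ptime
  (acc_bound := fun x => tree_size (enc_seq (enc_seq (@enc x)) (ll x)))) => //.
- exact: ptime_const.
- apply: ptime_cat (ptime_lift _ (ptime_var _ _)) (ptime_var _ _).
move=> x i; rewrite foldl_cat /=; apply: leq_trans (tree_size_seq_take _ _ i).
elim: (take i (ll x)) => //= s ss IH.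
by have := tree_size_seq_cat (@enc x) s (flatten ss); lia.
Qed.

Lemma ptime_filter (l : forall x, seq (B x)) (p : forall x, B x -> bool) :
  ptime a (fun x => enc_seq (@enc x) (l x)) ->
  ptime (env a enc) (fun s => enc_bool (p _ (tagged s))) ->
  ptime a (fun x => enc_seq (@enc x) (filter (p x) (l x))).
Proof.
move=> l_ptime p_ptime.
apply: (ptime_ext (g := fun x => enc_seq (@enc x)
    (flatten [seq if p x y then [:: y] else [::] | y <- l x]))).
  by move=> x; congr enc_seq; elim: (l x) => //= y s ->; case: (p x y).
apply/ptime_flatten/(ptime_map (encC := fun x => enc_seq (@enc x)) l_ptime).
apply: (ptime_if (enc := fun s => enc_seq (@enc (tag s))) p_ptime); last exact: ptime_const.
exact: (ptime_cons (enc := fun s => @enc (tag s)) (u := fun s => tagged s) (l := fun=> [::])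
  (ptime_var a enc) (ptime_const _ Leaf)).
Qed.

Lemma ptime_count (l : forall x, seq (B x)) (p : forall x, B x -> bool) :
  ptime a (fun x => enc_seq (@enc x) (l x)) ->
  ptime (env a enc) (fun s => enc_bool (p _ (tagged s))) ->
  ptime a (fun x => enc_unary (count (p x) (l x))).
Proof.
move=> l_ptime p_ptime; have := ptime_size_seq (ptime_filter l_ptime p_ptime).
by apply: ptime_ext => x; rewrite size_filter.
Qed.

End Flatten.

Section Iteration.
Variables (E : Type) (a : E -> tree) (A : E -> Type) (enc : forall x, A x -> tree).

Lemma ptime_iter (f : forall x, A x -> A x) (z : forall x, A x) (n acc_bound : E -> nat) :
  ptime a (fun x => enc_unary (n x)) -> ptime a (fun x => enc (z x)) ->
  ptime (env a enc) (fun s => enc (f _ (tagged s))) -> poly_bounded a acc_bound ->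
  (forall x i, i <= n x -> tree_size (enc (iter i (f x) (z x))) <= acc_bound x) ->
  ptime a (fun x => enc (iter (n x) (f x) (z x))).
Proof.
move=> n_ptime z_ptime f_ptime acc_poly acc_size.
have foldl_iter x i : foldl (fun acc (_ : unit) => f x acc) (z x) (nseq i tt) = iter i (f x) (z x).
  by elim: i (z x) => //= i IH y; rewrite IH -iterSr.
apply: (ptime_ext
  (g := fun x => enc (foldl (fun acc (_ : unit) => f x acc) (z x) (nseq (n x) tt)))).
  by move=> x; rewrite foldl_iter.
apply: (ptime_foldl (step := fun x acc (_ : unit) => f x acc) n_ptime z_ptime _ acc_poly).
  exact: (ptime_lift _ f_ptime).
move=> x i; have [le_in|/ltnW le_ni] := leqP i (n x).
  by rewrite take_nseq // foldl_iter acc_size.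
by rewrite take_oversize ?size_nseq // foldl_iter acc_size.
Qed.

End Iteration.

Lemma ptime_drop (E : Type) (a : E -> tree) (A : E -> Type) (enc : forall x, A x -> tree)
    (l : forall x, seq (A x)) (i : E -> nat) :
  ptime a (fun x => enc_seq (@enc x) (l x)) -> ptime a (fun x => enc_unary (i x)) ->
  ptime a (fun x => enc_seq (@enc x) (drop (i x) (l x))).
Proof.
move=> l_ptime i_ptime; have size_l := ptime_size l_ptime.
apply: (ptime_ext (g := fun x => enc_seq (@enc x) (iter (i x) behead (l x)))).
  by move=> x; rewrite drop_behead.
have drop_step : ptime (env a (fun x => enc_seq (@enc x)))
    (fun s => enc_seq (@enc _) (behead (tagged s))).
  exact: (ptime_behead (enc := fun s => @enc (tag s)) (ptime_var _ _)).
refine (ptime_iter (enc := fun x => enc_seq (@enc x)) (f := fun=> behead) i_ptime l_ptime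
  drop_step size_l _).
by move=> x j _; rewrite -drop_behead tree_size_seq_drop.
Qed.

Lemma ptime_nth (E : Type) (a : E -> tree) (l : E -> seq tree) (i : E -> nat) :
  ptime a (fun x => enc_seq id (l x)) -> ptime a (fun x => enc_unary (i x)) ->
  ptime a (fun x => nth Leaf (l x) (i x)).
Proof.
move=> l_ptime i_ptime; have := ptime_hd (ptime_drop (enc := fun=> id) l_ptime i_ptime).
by apply: ptime_ext => x; rewrite -[i x in RHS]addn0 -nth_drop; case: (drop _ _).
Qed.

Lemma ptime_leq_unary (E : Type) (a : E -> tree) (m n : E -> nat) :
  ptime a (fun x => enc_unary (m x)) -> ptime a (fun x => enc_unary (n x)) ->
  ptime a (fun x => enc_bool (m x <= n x)).
Proof.
move=> m_ptime n_ptime; have := ptime_nilp (ptime_drop (enc := fun=> fun=> Leaf) m_ptime n_ptime).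
by apply: ptime_ext => x; rewrite /nilp size_drop size_nseq.
Qed.

Lemma ptime_eq_unary (E : Type) (a : E -> tree) (m n : E -> nat) :
  ptime a (fun x => enc_unary (m x)) -> ptime a (fun x => enc_unary (n x)) ->
  ptime a (fun x => enc_bool (m x == n x)).
Proof.
move=> m_ptime n_ptime.
have := ptime_andb (ptime_leq_unary m_ptime n_ptime) (ptime_leq_unary n_ptime m_ptime).
by apply: ptime_ext => x; rewrite eqn_leq.
Qed.

Lemma ptime_iota (E : Type) (a : E -> tree) (n : E -> nat) :
  ptime a (fun x => enc_unary (n x)) -> ptime a (fun x => enc_seq enc_unary (iota 0 (n x))).
Proof.
move=> n_ptime; have size_n := ptime_size n_ptime.
have iter_iota k : iter k (fun s => 0 :: map succn s) [::] = iota 0 k.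
  by elim: k => //= k ->; rewrite (iotaDl 1 0).
apply: (ptime_ext (g := fun x => enc_seq enc_unary (iter (n x) (fun s => 0 :: map succn s) [::]))).
  by move=> x; rewrite iter_iota.
pose bound x := ((n x).+1 * (n x).*2.+2).+1.
refine (ptime_iter (enc := fun=> enc_seq enc_unary) (f := fun=> fun s => 0 :: map succn s)
  (z := fun=> [::]) (acc_bound := bound) n_ptime (ptime_const _ Leaf) _ _ _).
- apply: (ptime_cons (enc := fun=> enc_unary)); first exact: (ptime_const _ (enc_unary 0)).
  apply: (ptime_map (enc := fun=> enc_unary) (encC := fun=> enc_unary) (f := fun=> succn)
    (l := fun s => tagged s) (ptime_var _ _)).
  exact: (ptime_node (ptime_const _ Leaf) (ptime_var _ _)).
- pose T x := tree_size (enc_unary (n x));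
  apply: (@poly_bounded_le _ _ _ (fun x => (T x * (T x + 1)).+1)).
    by move=> x; rewrite /bound /T tree_size_unary; nia.
  by poly_bound.
move=> x i le_in; rewrite iter_iota tree_size_seq size_iota /bound.
have : \sum_(k <- iota 0 i) tree_size (enc_unary k) <= \sum_(k <- iota 0 i) i.*2.+1.
  by rewrite !big_seq leq_sum // => k; rewrite mem_iota tree_size_unary; lia.
by rewrite big_const_seq count_predT size_iota iter_addn_0; nia.
Qed.

Ltac ptime_split H :=
  lazymatch type of H with
  | ptime _ (fun s => @enc_pair _ _ _ _ _) =>
    let fst_ptime := fresh "fst_ptime" in let snd_ptime := fresh "snd_ptime" in
    pose proof (ptime_fst H) as fst_ptime; pose proof (ptime_snd H) as snd_ptime;
    cbv beta in fst_ptime, snd_ptime; ptime_split fst_ptime; ptime_split snd_ptime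
  | _ => idtac
  end.

Ltac ptime_lift_context a enc :=
  repeat match goal with
  | H : ptime a ?g |- _ =>
    let lifted := fresh "lifted" in
    pose proof (ptime_lift enc H) as lifted; cbv beta in lifted; clear H
  end;
  let bound := fresh "bound" in
  pose proof (ptime_var a enc) as bound; cbv beta in bound; ptime_split bound.

Ltac ptime_under :=
  cbv beta; lazymatch goal with |- ptime (@env _ _ ?a ?enc) _ => ptime_lift_context a enc end.

Ltac ptime_under2 :=
  cbv beta; lazymatch goal with
  | |- ptime (@env _ _ (@env _ _ ?a ?enc) ?enc') _ =>
    ptime_lift_context a enc; let a' := constr:(env a enc) in ptime_lift_context a' enc'
  end.

Create HintDb ptime.

(* Follows the syntax of the encoded function; the rule for each operation is a hint in ptime,
   registered once the operation is known to be polynomial. *)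
Ltac ptime_auto :=
  cbv beta;
  first [ match goal with H : ptime ?a ?g |- ptime ?a ?g => exact H end
  | lazymatch goal with |- ptime _ (fun s => ?t) => apply: ptime_const end
  | solve [auto 1 with ptime nocore]
  | match goal with H : ptime ?a _ |- ptime ?a _ => refine H end ].

#[export] Hint Extern 1 (ptime _ (fun _ => enc_bool (andb _ _))) =>
  apply: ptime_andb; ptime_auto : ptime.
#[export] Hint Extern 1 (ptime _ (fun _ => enc_bool (orb _ _))) =>
  apply: ptime_orb; ptime_auto : ptime.
#[export] Hint Extern 1 (ptime _ (fun _ => enc_bool (implb _ _))) =>
  apply: ptime_implyb; ptime_auto : ptime.
#[export] Hint Extern 3 (ptime _ (fun _ => enc_bool (negb _))) =>
  apply: ptime_negb; ptime_auto : ptime.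
#[export] Hint Extern 1 (ptime _ (fun _ => enc_bool (if _ then _ else _))) =>
  apply: ptime_if_bool; ptime_auto : ptime.
#[export] Hint Extern 1 (ptime _ (fun _ => enc_bool (leq _ _))) =>
  apply: ptime_leq_unary; ptime_auto : ptime.
#[export] Hint Extern 3 (ptime _ (fun _ => enc_bool (eq_op _ _))) =>
  apply: ptime_eqb; ptime_auto : ptime.
#[export] Hint Extern 1 (ptime _ (fun _ => enc_bool (eq_op _ _))) =>
  apply: ptime_eq_unary; ptime_auto : ptime.
#[export] Hint Extern 1 (ptime _ (fun _ => enc_bool (has _ _))) =>
  apply: ptime_has; [ptime_auto | ptime_under; ptime_auto] : ptime.
#[export] Hint Extern 1 (ptime _ (fun _ => enc_bool (all _ _))) =>
  apply: ptime_all; [ptime_auto | ptime_under; ptime_auto] : ptime.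
#[export] Hint Extern 1 (ptime _ (fun _ => enc_bool (nilp _))) =>
  apply: ptime_nilp; ptime_auto : ptime.
#[export] Hint Extern 1 (ptime _ (fun _ => enc_unary (count _ _))) =>
  apply: ptime_count; [ptime_auto | ptime_under; ptime_auto] : ptime.
#[export] Hint Extern 1 (ptime _ (fun _ => enc_pair _ _ (_, _))) =>
  apply: ptime_pair; ptime_auto : ptime.
#[export] Hint Extern 1 (ptime _ (fun _ => enc_seq _ (cons _ _))) =>
  apply: ptime_cons; ptime_auto : ptime.
#[export] Hint Extern 1 (ptime _ (fun _ => enc_seq _ (behead _))) =>
  apply: ptime_behead; ptime_auto : ptime.
#[export] Hint Extern 1 (ptime _ (fun _ => enc_seq _ (map _ _))) =>
  apply: ptime_map; [ptime_auto | ptime_under; ptime_auto] : ptime.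
#[export] Hint Extern 1 (ptime _ (fun _ => enc_seq _ (filter _ _))) =>
  apply: ptime_filter; [ptime_auto | ptime_under; ptime_auto] : ptime.
#[export] Hint Extern 1 (ptime _ (fun _ => enc_seq _ (cat _ _))) =>
  apply: ptime_cat; ptime_auto : ptime.
#[export] Hint Extern 1 (ptime _ (fun _ => enc_seq _ (iota 0 _))) =>
  apply: ptime_iota; ptime_auto : ptime.

Lemma ptime_allpairs (E : Type) (a : E -> tree) (A B : E -> Type) (encA : forall x, A x -> tree)
    (encB : forall x, B x -> tree) (l : forall x, seq (A x)) (l' : forall x, seq (B x)) :
  ptime a (fun x => enc_seq (@encA x) (l x)) -> ptime a (fun x => enc_seq (@encB x) (l' x)) ->
  ptime a (fun x => enc_seq (enc_pair (@encA x) (@encB x)) [seq (u, v) | u <- l x, v <- l' x]).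
Proof.
move=> l_ptime l'_ptime; apply: ptime_flatten.
apply: (ptime_map (encC := fun x => enc_seq (enc_pair (encA x) (encB x))) l_ptime).
by ptime_under; ptime_auto.
Qed.

#[export] Hint Extern 1 (ptime _ (fun _ => enc_seq _ (flatten (map _ _)))) =>
  apply: ptime_allpairs; ptime_auto : ptime.

Fixpoint short_seqs (A : Type) n (l : seq A) : seq (seq A) :=
  if n is m.+1 then [::] :: flatten [seq [seq x :: s | s <- short_seqs m l] | x <- l] else [::
    [::]].

Lemma mem_short_seqs (A : eqType) n (l s : seq A) :
  (s \in short_seqs n l) = (size s <= n) && all (mem l) s.
Proof.
elim: n s => [|n IH] [|x s] //=; rewrite inE /=.
apply/flatten_mapP/and3P => [[y yl /mapP[s' s's [-> ->]]]|[le_sn xl sl]].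
  by move: s's; rewrite IH => /andP[? ?]; split.
by exists x => //; apply/mapP; exists s; rewrite // IH -ltnS le_sn.
Qed.

Arguments short_seqs : simpl never.

Lemma ptime_short_seqs (E : Type) (a : E -> tree) (A : E -> Type) (enc : forall x, A x -> tree) n
    (l : forall x, seq (A x)) : ptime a (fun x => enc_seq (@enc x) (l x)) ->
  ptime a (fun x => enc_seq (enc_seq (@enc x)) (short_seqs n (l x))).
Proof.
move=> l_ptime; elim: n => [|n IH]; first exact: (ptime_const a (Node Leaf Leaf)).
apply: (ptime_cons (enc := fun x => enc_seq (@enc x)) (u := fun=> [::])
  (l := fun x => flatten [seq [seq y :: s | s <- short_seqs n (l x)] | y <- l x])).
  exact: (ptime_const a Leaf).
apply: (ptime_flatten (enc := fun x => enc_seq (@enc x))).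
apply: (ptime_map (encC := fun x => enc_seq (enc_seq (enc x))) l_ptime).
by ptime_under; ptime_auto.
Qed.

#[export] Hint Extern 1 (ptime _ (fun _ => enc_seq _ (short_seqs _ _))) =>
  apply: ptime_short_seqs; ptime_auto : ptime.

Definition enc_elt (T : finType) (v : T) : tree := enc_unary (index v (enum T)).
Definition enc_subset (T : finType) (S : {set T}) : tree :=
  enc_seq (fun v => enc_bool (v \in S)) (enum T).
Definition enc_rel (T : finType) (e : rel T) : tree :=
  enc_seq (fun u => enc_seq (fun v => enc_bool (e u v)) (enum T)) (enum T).
Definition enc_weighting (T : finType) (w : T -> nat) : tree :=
  enc_seq (fun v => enc_nat (w v)) (enum T).

Lemma map_index_enum (T : finType) : [seq index v (enum T) | v <- enum T] = iota 0 (size (enum T)).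
Proof.
apply: (@eq_from_nth _ 0); rewrite size_map ?size_iota // => i lt_i.
case: (enum T) (enum_uniq T) lt_i => // v s uniq_vs lt_i.
by rewrite (nth_map v) // nth_iota // index_uniq.
Qed.

Lemma nth_enum_index (T : finType) (f : T -> tree) (v : T) :
  nth Leaf (map f (enum T)) (index v (enum T)) = f v.
Proof. by rewrite (nth_map v) ?nth_index // ?index_mem mem_enum. Qed.

Lemma tree_size_elt (T : finType) (v : T) : tree_size (enc_elt v) <= (size (enum T)).*2.+1.
Proof. by rewrite tree_size_unary ltnS leq_double index_size. Qed.

Lemma tree_size_subset (T : finType) (S : {set T}) :
  tree_size (enc_subset S) <= (size (enum T) * 4).+1.
Proof. by apply: (leq_tree_size_seq (enc := fun=> Leaf) (h := fun=> 3)) => // v; case: (v \in S).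
Qed.

Section FinTypes.
Variables (E : Type) (a : E -> tree) (T : E -> finType).

Lemma ptime_enum (e : forall x, rel (T x)) : ptime a (fun x => enc_rel (e x)) ->
  ptime a (fun x => enc_seq (@enc_elt (T x)) (enum (T x))).
Proof.
move=> e_ptime; have := ptime_iota (ptime_size_seq e_ptime).
by apply: ptime_ext => x; rewrite -map_index_enum enc_seq_map.
Qed.

Lemma ptime_lookup (f : forall x, T x -> tree) (v : forall x, T x) :
  ptime a (fun x => enc_seq (@f x) (enum (T x))) -> ptime a (fun x => enc_elt (v x)) ->
  ptime a (fun x => f x (v x)).
Proof.
move=> f_ptime v_ptime.
have map_ptime : ptime a (fun x => enc_seq id [seq f x u | u <- enum (T x)]).
  by apply: ptime_ext f_ptime => x; rewrite enc_seq_map.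
by have := ptime_nth map_ptime v_ptime; apply: ptime_ext => x; rewrite nth_enum_index.
Qed.

Lemma ptime_rel (e : forall x, rel (T x)) (u v : forall x, T x) :
  ptime a (fun x => enc_rel (e x)) -> ptime a (fun x => enc_elt (u x)) ->
  ptime a (fun x => enc_elt (v x)) -> ptime a (fun x => enc_bool (e x (u x) (v x))).
Proof.
move=> e_ptime u_ptime; apply: (ptime_lookup (f := fun x t => enc_bool (e x (u x) t))).
exact: (ptime_lookup (f := fun x t => enc_seq (fun t' => enc_bool (e x t t')) (enum (T x)))).
Qed.

Lemma ptime_in_set (S : forall x, {set T x}) (v : forall x, T x) :
  ptime a (fun x => enc_subset (S x)) -> ptime a (fun x => enc_elt (v x)) ->
  ptime a (fun x => enc_bool (v x \in S x)).
Proof. exact: (ptime_lookup (f := fun x t => enc_bool (t \in S x))). Qed.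

Lemma ptime_weight (w : forall x, T x -> nat) (v : forall x, T x) :
  ptime a (fun x => enc_weighting (@w x)) -> ptime a (fun x => enc_elt (v x)) ->
  ptime a (fun x => enc_nat (w x (v x))).
Proof. exact: (ptime_lookup (f := fun x t => enc_nat (w x t))). Qed.

Lemma ptime_eq_elt (u v : forall x, T x) :
  ptime a (fun x => enc_elt (u x)) -> ptime a (fun x => enc_elt (v x)) ->
  ptime a (fun x => enc_bool (u x == v x)).
Proof.
move=> u_ptime v_ptime; have := ptime_eq_unary u_ptime v_ptime.
apply: ptime_ext => x; congr enc_bool; apply/eqP/eqP => [|-> //].
by move=> /(congr1 (nth (u x) (enum (T x)))); rewrite !nth_index // mem_enum.
Qed.

End FinTypes.

#[export] Hint Extern 1 (ptime _ (fun _ => enc_bool (in_mem _ _))) =>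
  apply: ptime_in_set; ptime_auto : ptime.
#[export] Hint Extern 2 (ptime _ (fun _ => enc_bool (eq_op _ _))) =>
  apply: ptime_eq_elt; ptime_auto : ptime.
#[export] Hint Extern 4 (ptime _ (fun _ => enc_bool _)) =>
  match goal with H : ptime _ (fun _ => enc_rel _) |- _ => apply: (ptime_rel H); ptime_auto end
  : ptime.
#[export] Hint Extern 1 (ptime _ (fun _ => enc_seq _ (enum _))) =>
  match goal with
  | H : ptime ?a (fun _ => enc_seq (@enc_elt _) (enum _)) |- ptime ?a _ => refine H
  | H : ptime ?a (fun _ => enc_rel _) |- ptime ?a _ => refine (ptime_enum H)
  end : ptime.

Section Quantifiers.
Variables (E : Type) (a : E -> tree) (T : E -> finType).
Hypothesis enum_ptime : ptime a (fun x => enc_seq (@enc_elt (T x)) (enum (T x))).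

Lemma ptime_exists (p : forall x, T x -> bool) :
  ptime (env a (fun x => @enc_elt (T x))) (fun s => enc_bool (p _ (tagged s))) ->
  ptime a (fun x => enc_bool [exists v, p x v]).
Proof.
move=> p_ptime; have := ptime_has enum_ptime p_ptime; apply: ptime_ext => x; congr enc_bool.
by apply/hasP/existsP => [[v _ ?]|[v ?]]; exists v; rewrite ?mem_enum.
Qed.

Lemma ptime_forall (p : forall x, T x -> bool) :
  ptime (env a (fun x => @enc_elt (T x))) (fun s => enc_bool (p _ (tagged s))) ->
  ptime a (fun x => enc_bool [forall v, p x v]).
Proof.
move=> p_ptime; have := ptime_all enum_ptime p_ptime; apply: ptime_ext => x; congr enc_bool.
by apply/allP/forallP => p_v v; [apply: p_v; rewrite mem_enum | move=> _; apply: p_v].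
Qed.

Lemma ptime_finset (p : forall x, T x -> bool) :
  ptime (env a (fun x => @enc_elt (T x))) (fun s => enc_bool (p _ (tagged s))) ->
  ptime a (fun x => enc_subset [set v | p x v]).
Proof.
move=> p_ptime; have := ptime_enc_seq (g := fun x v => enc_bool (p x v)) enum_ptime p_ptime.
by apply: ptime_ext => x; apply: eq_in_enc_seq => v _; rewrite inE.
Qed.

Lemma ptime_card (S : forall x, {set T x}) : ptime a (fun x => enc_subset (S x)) ->
  ptime a (fun x => enc_unary #|S x|).
Proof.
move=> S_ptime.
have mem_ptime : ptime (env a (fun x => @enc_elt (T x)))
    (fun s => enc_bool (tagged s \in S (tag s))).
  exact: (ptime_in_set (S := fun s => S (tag s)) (ptime_lift _ S_ptime) (ptime_var _ _)).
have := ptime_size_seq (ptime_filter (p := fun x v => v \in S x) enum_ptime mem_ptime).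
by apply: ptime_ext => x; rewrite cardE [in RHS]/enum_mem -enumT.
Qed.

End Quantifiers.

#[export] Hint Extern 1 (ptime _ (fun _ => enc_bool (negb (FiniteQuant.quant0b _)))) =>
  apply: ptime_exists; [ptime_auto | ptime_under; ptime_auto] : ptime.
#[export] Hint Extern 1 (ptime _ (fun _ => enc_bool (FiniteQuant.quant0b _))) =>
  apply: ptime_forall; [ptime_auto | ptime_under; ptime_auto] : ptime.
#[export] Hint Extern 1 (ptime _ (fun _ => enc_unary (card _))) =>
  apply: ptime_card; ptime_auto : ptime.
#[export] Hint Extern 3 (ptime _ (fun _ => enc_subset _)) =>
  apply: ptime_finset; [ptime_auto | ptime_under; ptime_auto] : ptime.

Section Sets.
Variables (E : Type) (a : E -> tree) (T : E -> finType).
Implicit Types (S U : forall x, {set T x}).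
Hypothesis enum_ptime : ptime a (fun x => enc_seq (@enc_elt (T x)) (enum (T x))).

Lemma ptime_in_seq (s : forall x, seq (T x)) (v : forall x, T x) :
  ptime a (fun x => enc_seq (@enc_elt (T x)) (s x)) -> ptime a (fun x => enc_elt (v x)) ->
  ptime a (fun x => enc_bool (v x \in s x)).
Proof.
move=> s_ptime v_ptime.
apply: (ptime_ext (g := fun x => enc_bool (has (fun u => v x == u) (s x)))); last by ptime_auto.
move=> x; congr enc_bool; apply/hasP/idP => [[u us /eqP->]|vs] //.
by exists (v x).
Qed.

Lemma ptime_subset S U : ptime a (fun x => enc_subset (S x)) ->
  ptime a (fun x => enc_subset (U x)) -> ptime a (fun x => enc_bool (S x \subset U x)).
Proof.
move=> S_ptime U_ptime.
apply: (ptime_ext (g := fun x => enc_bool [forall v, (v \in S x) ==> (v \in U x)]));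
  last by ptime_auto.
by move=> x; congr enc_bool; apply/forall_inP/subsetP => sub_SU v vS; apply: sub_SU.
Qed.

Lemma ptime_eq_set S U : ptime a (fun x => enc_subset (S x)) ->
  ptime a (fun x => enc_subset (U x)) -> ptime a (fun x => enc_bool (S x == U x)).
Proof.
move=> S_ptime U_ptime.
have := ptime_andb (ptime_subset S_ptime U_ptime) (ptime_subset U_ptime S_ptime).
by apply: ptime_ext => x; rewrite eqEsubset.
Qed.

Lemma ptime_if_set (p : E -> bool) S U :
  ptime a (fun x => enc_bool (p x)) -> ptime a (fun x => enc_subset (S x)) ->
  ptime a (fun x => enc_subset (U x)) -> ptime a (fun x => enc_subset (if p x then S x else U x)).
Proof. exact: (ptime_if (enc := fun x => @enc_subset (T x))). Qed.

Lemma ptime_set0 : ptime a (fun x => enc_subset (set0 : {set T x})).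
Proof.
apply: (ptime_ext (g := fun x => enc_subset [set v : T x | false])); last by ptime_auto.
by move=> x; congr enc_subset; apply/setP => v; rewrite !inE.
Qed.

Lemma ptime_set1 (v : forall x, T x) : ptime a (fun x => enc_elt (v x)) ->
  ptime a (fun x => enc_subset [set v x]).
Proof.
move=> v_ptime; apply: (ptime_ext (g := fun x => enc_subset [set u | u == v x]));
  last by ptime_auto.
by move=> x; congr enc_subset; apply/setP => u; rewrite !inE.
Qed.

Lemma ptime_setU S U : ptime a (fun x => enc_subset (S x)) ->
  ptime a (fun x => enc_subset (U x)) -> ptime a (fun x => enc_subset (S x :|: U x)).
Proof.
move=> S_ptime U_ptime.
apply: (ptime_ext (g := fun x => enc_subset [set u | (u \in S x) || (u \in U x)]));
  last by ptime_auto.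
by move=> x; congr enc_subset; apply/setP => u; rewrite !inE.
Qed.

Lemma ptime_setI S U : ptime a (fun x => enc_subset (S x)) ->
  ptime a (fun x => enc_subset (U x)) -> ptime a (fun x => enc_subset (S x :&: U x)).
Proof.
move=> S_ptime U_ptime.
apply: (ptime_ext (g := fun x => enc_subset [set u | (u \in S x) && (u \in U x)]));
  last by ptime_auto.
by move=> x; congr enc_subset; apply/setP => u; rewrite !inE.
Qed.

Lemma ptime_setC S : ptime a (fun x => enc_subset (S x)) -> ptime a (fun x => enc_subset (~: S x)).
Proof.
move=> S_ptime; apply: (ptime_ext (g := fun x => enc_subset [set u | u \notin S x]));
  last by ptime_auto.
by move=> x; congr enc_subset; apply/setP => u; rewrite !inE.
Qed.

Lemma ptime_setD S U : ptime a (fun x => enc_subset (S x)) ->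
  ptime a (fun x => enc_subset (U x)) -> ptime a (fun x => enc_subset (S x :\: U x)).
Proof.
move=> S_ptime U_ptime; have := ptime_setI S_ptime (ptime_setC U_ptime).
by apply: ptime_ext => x; rewrite setDE.
Qed.

Lemma poly_bounded_subset :
  exists2 K, poly_bounded a K & forall x (S : {set T x}), tree_size (enc_subset S) <= K x.
Proof.
exists (fun x => (tree_size (enc_seq (@enc_elt (T x)) (enum (T x))) * 4).+1).
  by have size_enum := ptime_size enum_ptime; poly_bound.
move=> x S; apply: leq_trans (tree_size_subset S) _; rewrite ltnS leq_mul2r /=.
by rewrite tree_size_seq; lia.
Qed.

Lemma ptime_fixset (F : forall x, {set T x} -> {set T x}) :
  ptime (env a (fun x => @enc_subset (T x))) (fun s => enc_subset (F _ (tagged s))) ->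
  ptime a (fun x => enc_subset (fixset (F x))).
Proof.
move=> F_ptime; have [K K_poly subset_le] := poly_bounded_subset.
have := ptime_iter (f := F) (ptime_size_seq enum_ptime) ptime_set0 F_ptime K_poly
  (fun x i _ => subset_le x _).
by apply: ptime_ext => x; rewrite -cardT.
Qed.

Lemma ptime_nth_set (l : forall x, seq {set T x}) (i : E -> nat) :
  ptime a (fun x => enc_seq (@enc_subset (T x)) (l x)) -> ptime a (fun x => enc_unary (i x)) ->
  ptime a (fun x => enc_subset (nth set0 (l x) (i x))).
Proof.
move=> l_ptime i_ptime.
have map_ptime : ptime a (fun x => enc_seq id [seq enc_subset A | A <- l x]).
  by apply: ptime_ext l_ptime => x; rewrite enc_seq_map.
have lt_ptime : ptime a (fun x => enc_bool (i x < size (l x))).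
  apply: ptime_leq_unary (ptime_size_seq l_ptime).
  exact: (ptime_node (ptime_const a Leaf) i_ptime).
have := ptime_if (enc := fun=> id) lt_ptime (ptime_nth map_ptime i_ptime) ptime_set0.
by apply: ptime_ext => x; case: ltnP => bound_i; [rewrite (nth_map set0) | rewrite nth_default].
Qed.

End Sets.

#[export] Hint Extern 2 (ptime _ (fun _ => enc_bool (in_mem _ _))) =>
  apply: ptime_in_seq; ptime_auto : ptime.
#[export] Hint Extern 2 (ptime _ (fun _ => enc_bool (eq_op _ _))) =>
  apply: ptime_eq_set; ptime_auto : ptime.
#[export] Hint Extern 1 (ptime _ (fun _ => enc_bool (subset _ _))) =>
  apply: ptime_subset; ptime_auto : ptime.
#[export] Hint Extern 1 (ptime _ (fun _ => enc_subset (if _ then _ else _))) =>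
  apply: ptime_if_set; ptime_auto : ptime.
#[export] Hint Extern 1 (ptime _ (fun _ => enc_subset set0)) =>
  apply: ptime_set0; ptime_auto : ptime.
#[export] Hint Extern 1 (ptime _ (fun _ => enc_subset (set1 _))) =>
  apply: ptime_set1; ptime_auto : ptime.
#[export] Hint Extern 1 (ptime _ (fun _ => enc_subset (setU _ _))) =>
  apply: ptime_setU; ptime_auto : ptime.
#[export] Hint Extern 1 (ptime _ (fun _ => enc_subset (setI _ _))) =>
  apply: ptime_setI; ptime_auto : ptime.
#[export] Hint Extern 1 (ptime _ (fun _ => enc_subset (setC _))) =>
  apply: ptime_setC; ptime_auto : ptime.
#[export] Hint Extern 1 (ptime _ (fun _ => enc_subset (setD _ _))) =>
  apply: ptime_setD; ptime_auto : ptime.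
#[export] Hint Extern 1 (ptime _ (fun _ => enc_subset (fixset _))) =>
  apply: ptime_fixset; [ptime_auto | ptime_under; ptime_auto] : ptime.
#[export] Hint Extern 1 (ptime _ (fun _ => enc_subset (nth set0 _ _))) =>
  apply: ptime_nth_set; ptime_auto : ptime.

(** * Binary arithmetic and weights *)

Fixpoint bits_val (s : seq bool) : nat := if s is b :: s' then b + (bits_val s').*2 else 0.

Lemma bits_val_cat s t : bits_val (s ++ t) = bits_val s + 2 ^ size s * bits_val t.
Proof. by elim: s => [|b s IH] /=; rewrite ?mul1n // IH expnS; lia. Qed.

Lemma bits_val_nseq0 n : bits_val (nseq n false) = 0.
Proof. by elim: n => //= n ->. Qed.

Lemma bitsS m : 0 < m -> bits m = odd m :: bits m./2.
Proof.
move=> m0; rewrite /bits up_log2S // /mkseq /= divn1; congr (_ :: _).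
rewrite (iotaDl 1 0) -map_comp; apply: eq_map => i /=.
by rewrite add1n expnS divnMA divn2.
Qed.

Lemma bitsK m : bits_val (bits m) = m.
Proof.
elim/ltn_ind: m => -[|m] IH //; rewrite bitsS //= IH; last by lia.
by rewrite -[RHS]odd_double_half.
Qed.

Lemma size_bits m : size (bits m) = up_log 2 m.+1. Proof. exact: size_mkseq. Qed.

Lemma size_bitsD m n : size (bits (m + n)) <= size (bits m) + size (bits n).
Proof.
rewrite !size_bits; apply: up_log_min => //; rewrite expnD.
have := @up_logP 2 m.+1 isT; have := @up_logP 2 n.+1 isT; nia.
Qed.

Lemma tree_size_bits (s : seq bool) : tree_size (enc_seq enc_bool s) <= (size s * 4).+1.
Proof. by apply: (leq_tree_size_seq (enc := fun=> Leaf) (h := fun=> 3)) => // -[]. Qed.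

Definition strip_step (acc : seq bool) (b : bool) := if b || ~~ nilp acc then b :: acc else [::].
Definition strip_zeros : seq bool -> seq bool := foldr (fun b acc => strip_step acc b) [::].

Lemma foldl_strip_step s : foldl strip_step [::] s = strip_zeros (rev s).
Proof. by rewrite -{1}[s]revK foldl_rev. Qed.

Lemma size_strip_zeros s : size (strip_zeros s) <= size s.
Proof. by elim: s => //= b s IH; rewrite /strip_step; case: ifP. Qed.

Lemma bits_bits_val s : bits (bits_val s) = strip_zeros s.
Proof.
elim: s => //= b s IH; rewrite /strip_step; have [val0|pos] := posnP (bits_val s).
  by rewrite -IH val0; case: b.
rewrite bitsS; last by lia.
rewrite -IH (bitsS pos) orbT; congr (_ :: _); first by rewrite oddD odd_double addbF oddb.
by rewrite halfD odd_double half_double andbF; case: (b); rewrite bitsS.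
Qed.

(* The state of an addition: the digits of the second summand still to be read, the carry, and the
   digits of the sum in reverse. *)
Definition add_step (st : seq bool * bool * seq bool) (b : bool) :=
  (behead st.1.1, (if b == head false st.1.1 then b else st.1.2),
   (if b == head false st.1.1 then st.1.2 else ~~ st.1.2) :: st.2).

Lemma foldl_add_step s st : let st' := foldl add_step st s in
  [/\ size st'.2 = size st.2 + size s, st'.1.1 = drop (size s) st.1.1 &
    bits_val (rev st'.2) + 2 ^ size st'.2 * (st'.1.2 + bits_val st'.1.1) =
    bits_val (rev st.2) + 2 ^ size st.2 * (bits_val s + bits_val st.1.1 + st.1.2)].
Proof.
elim: s st => [|b s IH] st /=; first by rewrite addn0 drop0; split=> //; lia.
case: (IH (add_step st b)) => -> -> ->; case: st => [[y carry] out]; rewrite /add_step /=.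
split; [lia | by case: y => // d y; rewrite /= ?drop0 | ].
rewrite rev_cons -cats1 bits_val_cat size_rev expnS /=.
by case: y => [|d y] /=; case: b; case: carry; try (case: d); rewrite /=; nia.
Qed.

Definition pad (s s' : seq bool) := s ++ nseq (size s') false.
Definition add_state s s' := foldl add_step (s', false, [::]) (pad s s').
Definition add_bits s s' := strip_zeros (rev ((add_state s s').1.2 :: (add_state s s').2)).

Lemma bits_val_pad s s' : bits_val (pad s s') = bits_val s.
Proof. by rewrite bits_val_cat bits_val_nseq0 muln0 addn0. Qed.

Lemma leq_size_pad s s' : size s' <= size (pad s s').
Proof. by rewrite size_cat size_nseq leq_addl. Qed.

Lemma add_bitsE m n : add_bits (bits m) (bits n) = bits (m + n).
Proof.
rewrite /add_bits -bits_bits_val; set x := bits m; set y := bits n.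
have [/= _ read val_st] := foldl_add_step (pad x y) (y, false, [::]).
rewrite -/(add_state x y) in read val_st; set st := add_state _ _ in read val_st *.
rewrite drop_oversize ?leq_size_pad // in read.
congr bits; rewrite rev_cons -cats1 bits_val_cat size_rev /=.
by move: val_st; rewrite read bits_val_pad !bitsK /=; lia.
Qed.

Definition compare_step (st : seq bool * bool) (b : bool) :=
  (behead st.1, if b == head false st.1 then st.2 else head false st.1).

Lemma foldl_compare_step s y f : size y <= size s ->
  (foldl compare_step (y, f) s).2 =
    if f then bits_val s <= bits_val y else bits_val s < bits_val y.
Proof.
elim: s y f => [|b s IH] [|d y] f //=; first by case: f.
- by move=> _; rewrite /compare_step /= IH //=; case: b => /=; case: f; lia.
- by rewrite ltnS => le_ys; rewrite /compare_step /= IH //; case: b; case: d; case: f => /=; lia.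
Qed.

Lemma tree_size_compare s y f :
  tree_size (enc_pair (enc_seq enc_bool) enc_bool (foldl compare_step (y, f) s)) <= size y * 4 + 5.
Proof.
elim: s y f => [|b s IH] y f /=.
  by have := tree_size_bits y; rewrite /enc_pair; case: f => /=; lia.
by apply: leq_trans (IH _ _) _; rewrite /= size_behead leq_add2r leq_mul2r /= leq_pred.
Qed.

#[export] Hint Extern 1 (ptime _ (fun _ => enc_seq ?enc (if _ then _ else _))) =>
  refine (ptime_if (enc := fun _ => enc_seq enc) _ _ _); ptime_auto : ptime.
#[export] Hint Extern 1 (ptime _ (fun _ => enc_nat (if _ then _ else _))) =>
  refine (ptime_if (enc := fun _ => enc_nat) _ _ _); ptime_auto : ptime.
#[export] Hint Extern 1 (ptime ?a (fun _ => enc_nat _)) =>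
  match goal with H : ptime a (fun _ => enc_weighting _) |- _ =>
    apply: (ptime_weight H); ptime_auto end : ptime.

Section BitLists.
Variables (E : Type) (a : E -> tree).
Implicit Types s : E -> seq bool.
Notation enc_bits := (enc_seq enc_bool).

Lemma ptime_head_bool s :
  ptime a (fun x => enc_bits (s x)) -> ptime a (fun x => enc_bool (head false (s x))).
Proof. by move=> /ptime_hd; apply: ptime_ext => x; case: (s x). Qed.

Lemma ptime_pad s s' : ptime a (fun x => enc_bits (s x)) -> ptime a (fun x => enc_bits (s' x)) ->
  ptime a (fun x => enc_bits (pad (s x) (s' x))).
Proof.
move=> s_ptime s'_ptime.
apply: (ptime_ext (g := fun x => enc_bits (s x ++ [seq false | b <- s' x]))).
  by move=> x; rewrite /pad; congr (enc_bits (_ ++ _)); elim: (s' x) => //= b t ->.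
apply: ptime_cat s_ptime _.
exact: (ptime_map (encC := fun=> enc_bool) (f := fun=> fun=> false) s'_ptime (ptime_const _ _)).
Qed.

Lemma poly_bounded_size_bits s :
  ptime a (fun x => enc_bits (s x)) -> poly_bounded a (fun x => size (s x)).
Proof. by move=> /ptime_size; apply: poly_bounded_le => x; rewrite tree_size_seq; lia. Qed.

End BitLists.

#[export] Hint Extern 1 (ptime _ (fun _ => enc_bool (head _ _))) =>
  apply: ptime_head_bool; ptime_auto : ptime.

Section Addition.
Variables (E : Type) (a : E -> tree).
Implicit Types s : E -> seq bool.
Notation enc_bits := (enc_seq enc_bool).
Notation enc_add_state := (enc_pair (enc_pair enc_bits enc_bool) enc_bits).
Notation enc_compare_state := (enc_pair enc_bits enc_bool).

Lemma ptime_strip_zeros_rev s : ptime a (fun x => enc_bits (s x)) ->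
  ptime a (fun x => enc_bits (strip_zeros (rev (s x)))).
Proof.
move=> s_ptime; have size_s := poly_bounded_size_bits s_ptime.
apply: (ptime_ext (g := fun x => enc_bits (foldl strip_step [::] (s x)))).
  by move=> x; rewrite foldl_strip_step.
apply: (ptime_foldl (encA := fun=> enc_bits) (step := fun=> strip_step) (z := fun=> [::])
  (acc_bound := fun x => (size (s x) * 4).+1)) s_ptime _ _ _ _; first by ptime_auto.
- by ptime_under2; rewrite /strip_step; ptime_auto.
- by poly_bound.
move=> x i; rewrite foldl_strip_step; apply: leq_trans (tree_size_bits _) _.
rewrite ltnS leq_mul2r /=; apply: leq_trans (size_strip_zeros _) _.
by rewrite size_rev size_take_min geq_minr.
Qed.

Lemma ptime_add_state s s' :
  ptime a (fun x => enc_bits (s x)) -> ptime a (fun x => enc_bits (s' x)) ->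
  ptime a (fun x => enc_add_state (add_state (s x) (s' x))).
Proof.
move=> s_ptime s'_ptime; have pad_ptime := ptime_pad s_ptime s'_ptime.
have size_pad := poly_bounded_size_bits pad_ptime.
have size_s' := poly_bounded_size_bits s'_ptime.
apply: (ptime_foldl (encA := fun=> enc_add_state) (step := fun=> add_step)
  (z := fun x => (s' x, false, [::]))
  (acc_bound := fun x => (size (s' x) + size (pad (s x) (s' x))) * 4 + 7)) pad_ptime _ _ _ _.
- by ptime_auto.
- by ptime_under2; rewrite /add_step; ptime_auto.
- by poly_bound.
move=> x i; set t := take i _.
have [/= size_out read _] := foldl_add_step t (s' x, false, [::]).
set st := foldl _ _ _ in size_out read *.
have size_t : size t <= size (pad (s x) (s' x)) by rewrite size_take_min geq_minr.
have := tree_size_bits st.1.1; have := tree_size_bits st.2; rewrite size_out read size_drop.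
by rewrite /enc_pair /=; case: (st.1.2) => /=; lia.
Qed.

Lemma ptime_addn (m n : E -> nat) : ptime a (fun x => enc_nat (m x)) ->
  ptime a (fun x => enc_nat (n x)) -> ptime a (fun x => enc_nat (m x + n x)).
Proof.
rewrite /enc_nat => m_ptime n_ptime.
apply: (ptime_ext (g := fun x => enc_bits (add_bits (bits (m x)) (bits (n x))))).
  by move=> x; rewrite add_bitsE.
have state_ptime := ptime_add_state m_ptime n_ptime; ptime_split state_ptime.
by apply: ptime_strip_zeros_rev; ptime_auto.
Qed.

Lemma ptime_leq (m n : E -> nat) : ptime a (fun x => enc_nat (m x)) ->
  ptime a (fun x => enc_nat (n x)) -> ptime a (fun x => enc_bool (m x <= n x)).
Proof.
rewrite /enc_nat => m_ptime n_ptime; have size_n := poly_bounded_size_bits n_ptime.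
have state_ptime : ptime a (fun x => enc_compare_state
    (foldl compare_step (bits (n x), true) (pad (bits (m x)) (bits (n x))))).
  apply: (ptime_foldl (encA := fun=> enc_compare_state) (step := fun=> compare_step)
    (z := fun x => (bits (n x), true)) (acc_bound := fun x => size (bits (n x)) * 4 + 5)
    (ptime_pad m_ptime n_ptime)).
  - by ptime_auto.
  - by ptime_under2; rewrite /compare_step; ptime_auto.
  - by poly_bound.
  by move=> x i; apply: tree_size_compare.
have := ptime_snd state_ptime; apply: ptime_ext => x.
by rewrite foldl_compare_step ?leq_size_pad // bits_val_pad !bitsK.
Qed.

End Addition.

#[export] Hint Extern 1 (ptime _ (fun _ => enc_nat (addn _ _))) =>
  apply: ptime_addn; ptime_auto : ptime.
#[export] Hint Extern 2 (ptime _ (fun _ => enc_bool (leq _ _))) =>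
  apply: ptime_leq; ptime_auto : ptime.

Section Weights.
Variables (T : finType) (w : T -> nat).
Implicit Types S U : {set T}.

Definition weight S := \sum_(v in S) w v.

Lemma weight0 : weight set0 = 0. Proof. exact: big_set0. Qed.

Lemma weightID S U : weight S = weight (S :&: U) + weight (S :\: U).
Proof. by rewrite /weight (big_setID U). Qed.

Lemma weightS S U : S \subset U -> weight S <= weight U.
Proof. by move=> sSU; rewrite (weightID U S) (setIidPr sSU) leq_addr. Qed.

Lemma weight_disjointU S U : [disjoint S & U] -> weight (S :|: U) = weight S + weight U.
Proof. by move=> dSU; rewrite /weight (eq_bigl [predU S & U]) ?bigU // => v; rewrite !inE. Qed.

Lemma weight_bigcup_le (K : finType) (P : {set K}) (F : K -> {set T}) :
  weight (\bigcup_(i in P) F i) <= \sum_(i in P) weight (F i).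
Proof.
rewrite /weight (exchange_big_dep xpredT) //= big_mkcond; apply: leq_sum => v _.
case: ifP => // /bigcupP[i iP vF]; rewrite (bigD1 i) ?iP //=.
exact: leq_addr.
Qed.

Lemma weight_bigcup_disjoint (K : finType) (P : {set K}) (F : K -> {set T}) U :
  {in P &, forall i j, i != j -> [disjoint F i & F j]} ->
  (forall i, i \in P -> F i \subset U) -> \sum_(i in P) weight (F i) <= weight U.
Proof.
move=> disjF sFU; rewrite /weight (exchange_big_dep xpredT) //= [leqRHS]big_mkcond.
apply: leq_sum => v _; have [/exists_inP[i iP vF]|noF] := boolP [exists i in P, v \in F i].
  rewrite (subsetP (sFU i iP)) // (big_pred1 i) // => j /=; apply/andP/eqP => [[jP vFj]|->//].
  apply: contraTeq vF => neq_ji.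
  by rewrite (disjointFr (disjF j i jP iP neq_ji) vFj).
by rewrite big_pred0 // => i; apply: contraNF noF => iP; apply/existsP; exists i.
Qed.

Lemma weight_cover_le (P : {set {set T}}) (f : {set T} -> {set T}) S U : trivIset P ->
  (forall B, B \in P -> [/\ f B \subset B, f B \subset U & weight (S :&: B) <= weight (f B)]) ->
  weight (S :&: cover P) <= weight U.
Proof.
move=> trivP fP; rewrite /cover big_distrr /=.
apply: leq_trans (weight_bigcup_le _ _) _; apply: (@leq_trans (\sum_(B in P) weight (f B))).
  by apply: leq_sum => B /fP[].
apply: weight_bigcup_disjoint => [A B AP BP neqAB|B /fP[] //].
have [sfA _ _] := fP _ AP; have [sfB _ _] := fP _ BP.
by apply: disjointWl sfA _; apply: disjointWr sfB _; apply: (trivIsetP trivP).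
Qed.

Definition heaviest (l : seq {set T}) :=
  foldl (fun S S' => if weight S <= weight S' then S' else S) set0 l.

Lemma heaviest_ind (P : {set T} -> Prop) l :
  P set0 -> (forall S, S \in l -> P S) -> P (heaviest l).
Proof.
rewrite /heaviest; elim: l set0 => //= S l IH S0 P0 Pl; apply: IH => [|S' S'l].
  by case: ifP => // _; apply: Pl; rewrite mem_head.
by apply: Pl; rewrite inE S'l orbT.
Qed.

Lemma heaviest_max l S : S \in l -> weight S <= weight (heaviest l).
Proof.
rewrite /heaviest; set better := fun _ => _.
suff better_max S0 : weight S0 <= weight (foldl better S0 l)
    /\ (S \in l -> weight S <= weight (foldl better S0 l)) by case: (better_max set0).
elim: l S0 => //= S1 l IH S0; have [ge_acc ge_l] := IH (better S0 S1).
split.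
  by apply: leq_trans ge_acc; rewrite /better; case: (leqP (weight S0) (weight S1)).
rewrite inE => /orP[/eqP->|/ge_l //]; apply: leq_trans ge_acc.
by rewrite /better; case: (leqP (weight S0) (weight S1)) => // /ltnW.
Qed.

End Weights.

Section WeightPrograms.
Variables (E : Type) (a : E -> tree) (T : E -> finType) (w : forall x, T x -> nat).
Hypotheses (enum_ptime : ptime a (fun x => enc_seq (@enc_elt (T x)) (enum (T x))))
  (w_ptime : ptime a (fun x => enc_weighting (@w x))).

Lemma size_bits_partial_weight x (p : pred (T x)) (s : seq (T x)) :
  size (bits (\sum_(v <- s | p v) w v)) <= tree_size (enc_seq (fun v => enc_nat (w v)) s).
Proof.
elim: s => [|v s IH]; first by rewrite big_nil.
rewrite big_cons /=; case: ifP => _; last by apply: leq_trans IH _; lia.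
apply: leq_trans (size_bitsD _ _) _.
by rewrite /enc_nat in IH *; have := tree_size_seq enc_bool (bits (w v)); lia.
Qed.

Lemma ptime_weight_set (S : forall x, {set T x}) : ptime a (fun x => enc_subset (S x)) ->
  ptime a (fun x => enc_nat (weight (@w x) (S x))).
Proof.
move=> S_ptime; pose step x acc (v : T x) := if v \in S x then acc + w v else acc.
have foldl_step x s acc : foldl (@step x) acc s = acc + \sum_(v <- s | v \in S x) w v.
  elim: s acc => [|v s IH] acc; rewrite ?big_nil ?addn0 // big_cons /= IH /step.
  by case: ifP => // _; rewrite addnA.
apply: (ptime_ext (g := fun x => enc_nat (foldl (@step x) 0 (enum (T x))))).
  by move=> x; rewrite foldl_step add0n big_enum_cond.
apply: (ptime_foldl (encA := fun=> enc_nat) (step := step) (z := fun=> 0) enum_ptime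
  (acc_bound := fun x => (tree_size (enc_weighting (@w x)) * 4).+1)).
- exact: ptime_const.
- by ptime_under2; rewrite /step; ptime_auto.
- by have size_w := ptime_size w_ptime; poly_bound.
move=> x i; rewrite foldl_step add0n; apply: leq_trans (tree_size_bits _) _.
rewrite ltnS leq_mul2r /=; apply: leq_trans (size_bits_partial_weight _ _) _.
exact: tree_size_seq_take.
Qed.

End WeightPrograms.

#[export] Hint Extern 1 (ptime _ (fun _ => enc_nat (weight _ _))) =>
  apply: ptime_weight_set; ptime_auto : ptime.

Lemma ptime_heaviest (E : Type) (a : E -> tree) (T : E -> finType) (w : forall x, T x -> nat)
    (l : forall x, seq {set T x}) :
  ptime a (fun x => enc_seq (@enc_elt (T x)) (enum (T x))) ->
  ptime a (fun x => enc_weighting (@w x)) ->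
  ptime a (fun x => enc_seq (@enc_subset (T x)) (l x)) ->
  ptime a (fun x => enc_subset (heaviest (@w x) (l x))).
Proof.
move=> enum_ptime w_ptime l_ptime; have [K K_poly subset_le] := poly_bounded_subset enum_ptime.
apply: (ptime_foldl (encA := fun x => @enc_subset (T x)) l_ptime _ _ K_poly) => [||x i].
- exact: ptime_set0.
- by clear K K_poly subset_le l_ptime; ptime_under2; ptime_auto.
- exact: subset_le.
Qed.

#[export] Hint Extern 1 (ptime _ (fun _ => enc_subset (heaviest _ _))) =>
  apply: ptime_heaviest; ptime_auto : ptime.

(** * Connected sets and induced five-vertex paths *)

Lemma leq_card_in_nat (T : finType) (P : {set T}) (f : T -> nat) m :
  {in P, forall x, f x < m} -> {in P &, injective f} -> #|P| <= m.
Proof.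
move=> lt_f inj_f; rewrite cardE -(size_map f) -(size_iota 0 m).
apply: uniq_leq_size.
  by rewrite map_inj_in_uniq ?enum_uniq // => x y; rewrite !mem_enum; apply: inj_f.
by move=> _ /mapP[x + ->]; rewrite mem_enum mem_iota => /lt_f.
Qed.

Lemma pair_code_inj k a b a' b' :
  b < k -> b' < k -> a * k + b = a' * k + b' -> a = a' /\ b = b'.
Proof.
move=> lt_bk lt_b'k eq_code; have k_gt0 : 0 < k by lia.
have eq_a : a = a'.
  by have := congr1 (divn^~ k) eq_code; rewrite !divnMDl // !divn_small // !addn0.
by split=> //; move: eq_code; rewrite eq_a => /addnI.
Qed.

Lemma leq_cardsU (T : finType) (A B : {set T}) : #|A :|: B| <= #|A| + #|B|.
Proof. exact: leq_of_leqif (leq_card_setU A B). Qed.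

Lemma leq_card_bigcup (T I : finType) (A : {set I}) (F : I -> {set T}) m :
  (forall i, i \in A -> #|F i| <= m) -> #|\bigcup_(i in A) F i| <= #|A| * m.
Proof.
move=> card_F; apply: (@leq_trans (\sum_(i in A) #|F i|)).
  elim/big_ind2: _ => [|U m1 U' m2 le1 le2|//]; first by rewrite cards0.
  exact: leq_trans (leq_cardsU _ _) (leq_add le1 le2).
by apply: leq_trans (leq_sum _ card_F) _; rewrite sum_nat_const.
Qed.

Lemma hitting_set (T : finType) (A B : {set T}) (R : rel T) :
  (forall b, b \in B -> exists2 p, p \in A & R p b) ->
  exists (P : {set T}) (private : T -> T),
    [/\ P \subset A, forall b, b \in B -> exists2 p, p \in P & R p b &
      forall p, p \in P -> [/\ private p \in B, R p (private p) &
        forall p', p' \in P -> p' != p -> ~~ R p' (private p)]].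
Proof.
move=> A_hits; pose hits (P : {set T}) := (P \subset A) && [forall b in B, exists p in P, R p b].
have hitsA : hits A.
  rewrite /hits subxx; apply/forall_inP => b /A_hits[p pA Rpb].
  by apply/exists_inP; exists p.
case: (arg_minnP (fun P : {set T} => #|P|) hitsA) => P /andP[sPA /forall_inP hitP] minP.
have private p : exists b, p \in P -> [/\ b \in B, R p b &
    forall p', p' \in P -> p' != p -> ~~ R p' b].
  case pP: (p \in P); last by exists p.
  have : ~~ hits (P :\ p).
    by apply: contraL (isT : true) => /minP; rewrite (cardsD1 p P) pP; lia.
  rewrite /hits (subset_trans (subsetDl _ _) sPA) /= negb_forall_in => /exists_inP[b bB].
  rewrite negb_exists_in => /forall_inP unhit; exists b => _.
  have only_p p' : p' \in P -> p' != p -> ~~ R p' b.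
    by move=> p'P neq_p'p; apply: unhit; rewrite !inE neq_p'p.
  split=> //; have /exists_inP[q qP Rqb] := hitP b bB.
  by case: (eqVneq q p) => [<- //|/(only_p q qP)]; rewrite Rqb.
have [f f_private] := fin_all_exists private.
exists P, f; split=> // b bB.
by have /exists_inP[q qP Rqb] := hitP b bB; exists q.
Qed.

Lemma fixset_sub (T : finType) (F : {set T} -> {set T}) (S : {set T}) :
  {homo F : A B / A \subset B} -> F S \subset S -> fixset F \subset S.
Proof.
move=> F_mono sFS; rewrite /fixset; elim: #|T| => [|n IH] /=; first exact: sub0set.
exact: subset_trans (F_mono _ _ IH) sFS.
Qed.

Section Graph.
Variables (T : finType) (e : rel T).
Hypothesis e_sym : symmetric e.
Implicit Types (A B C D F H K P S W X : {set T}).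

Definition nbhd D := [set v | (v \in D) || [exists d in D, e v d]].

Definition touch A B := [exists x in A, x \in nbhd B].

Definition connected S := forall A, A \subset S -> A != set0 -> A != S ->
  exists x y, [/\ x \in A, y \in S, y \notin A & e x y].

Definition component_step W u S := [set y in W | (y == u) || [exists x in S, e x y]].
Definition component W u := fixset (component_step W u).

Definition induced_p5 a b c d f := [&& e a b, e b c, e c d, e d f, ~~ e a c, ~~ e a d,
  ~~ e a f, ~~ e b d, ~~ e b f & ~~ e c f].

Definition has_p5 X := [exists a in X, exists b in X, exists c in X, exists d in X,
  exists f in X, induced_p5 a b c d f].

Lemma has_p5P X : reflect (exists a b c d f, [&& a \in X, b \in X, c \in X, d \in X & f \in X] /\
  induced_p5 a b c d f) (has_p5 X).
Proof.
apply: (iffP exists_inP) => [[a aX /exists_inP[b bX /exists_inP[c cX /exists_inP[d dX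
  /exists_inP[f fX path]]]]]|[a [b [c [d [f [/and5P[aX bX cX dX fX] path]]]]]]].
  by exists a, b, c, d, f; rewrite aX bX cX dX fX.
exists a => //; apply/exists_inP; exists b => //; apply/exists_inP; exists c => //.
by apply/exists_inP; exists d => //; apply/exists_inP; exists f.
Qed.

Lemma has_p5S X X' : X \subset X' -> has_p5 X -> has_p5 X'.
Proof.
move=> /subsetP sX /has_p5P[a [b [c [d [f [/and5P[? ? ? ? ?] path]]]]]].
by apply/has_p5P; exists a, b, c, d, f; rewrite !sX.
Qed.

Lemma nbhdP D v : reflect (v \in D \/ exists2 d, d \in D & e v d) (v \in nbhd D).
Proof. by rewrite inE; apply: (iffP orP) => -[|/exists_inP]; by [left | right]. Qed.

Lemma sub_nbhd D : D \subset nbhd D.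
Proof. by apply/subsetP => v vD; rewrite inE vD. Qed.

Lemma nbhdS D D' : D \subset D' -> nbhd D \subset nbhd D'.
Proof.
move=> /subsetP sD; apply/subsetP => v /nbhdP[/sD vD|[d /sD dD vd]]; first by rewrite inE vD.
by apply/nbhdP; right; exists d.
Qed.

Lemma nbhdU D P v : v \in nbhd D -> v \in nbhd (D :|: P).
Proof. exact: (subsetP (nbhdS (subsetUl _ _))). Qed.

Lemma adj_nbhd D d v : d \in D -> e v d -> v \in nbhd D.
Proof. by move=> dD vd; apply/nbhdP; right; exists d. Qed.

Lemma notin_nbhd D v : v \notin nbhd D -> v \notin D /\ {in D, forall d, ~~ e v d}.
Proof.
by rewrite inE negb_or negb_exists_in => /andP[vD /forall_inP].
Qed.

Lemma touchPn A B : reflect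
  (forall x y, x \in A -> y \in B -> (x != y) && ~~ e x y) (~~ touch A B).
Proof.
rewrite negb_exists_in; apply: (iffP forall_inP) => [far x y xA yB|far x xA].
  have [xB ->] := notin_nbhd (far x xA); rewrite // andbT.
  by apply: contraNneq xB => ->.
apply/nbhdP => -[xB|[d dB xd]]; first by have := far x x xA xB; rewrite eqxx.
by have := far x d xA dB; rewrite xd andbF.
Qed.

Lemma touchPn_adj A B x y : ~~ touch A B -> x \in A -> y \in B -> ~~ e x y.
Proof. by move=> /touchPn far xA yB; case/andP: (far x y xA yB). Qed.

Lemma touchC A B : touch A B = touch B A.
Proof.
apply: negb_inj; apply/touchPn/touchPn => far x y xA yB.
  by rewrite eq_sym e_sym far.
by rewrite eq_sym e_sym far.
Qed.

Lemma touchS A B A' B' : A \subset A' -> B \subset B' -> touch A B -> touch A' B'.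
Proof.
move=> sA sB; apply: contraLR => /touchPn far; apply/touchPn => x y xA yB.
by apply: far; [apply: (subsetP sA) | apply: (subsetP sB)].
Qed.

Lemma untouched_disjoint A B : ~~ touch A B -> [disjoint A & B].
Proof.
move=> /touchPn far; apply/pred0P => x /=; apply/negP => /andP[xA xB].
by have := far x x xA xB; rewrite eqxx.
Qed.

Lemma component_step_mono W u : {homo component_step W u : A B / A \subset B}.
Proof.
move=> A B /subsetP sAB; apply/subsetP => y; rewrite !inE => /andP[-> /orP[->//|]].
case/exists_inP=> x /sAB xB xy; apply/orP; right.
by apply/exists_inP; exists x.
Qed.

Lemma mem_component W u y :
  (y \in component W u) = (y \in W) && ((y == u) || [exists x in component W u, e x y]).
Proof. by rewrite {1}/component -fixsetK ?inE //; apply: component_step_mono. Qed.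

Lemma component_sub W u : component W u \subset W.
Proof. by apply/subsetP => y; rewrite mem_component => /andP[]. Qed.

Lemma component_self W u : u \in W -> u \in component W u.
Proof. by move=> uW; rewrite mem_component uW eqxx. Qed.

Lemma component_closed W u x y : x \in component W u -> y \in W -> e x y -> y \in component W u.
Proof.
move=> xC yW xy; rewrite mem_component yW /=; apply/orP; right.
by apply/exists_inP; exists x.
Qed.

Lemma component_min W u S : (u \in W -> u \in S) ->
  (forall x y, x \in S -> y \in W -> e x y -> y \in S) -> component W u \subset S.
Proof.
move=> uS closedS; apply: fixset_sub (@component_step_mono W u) _; apply/subsetP => y.
rewrite inE => /andP[yW /orP[/eqP eq_yu|/exists_inP[x xS xy]]]; last exact: closedS xS yW xy.
by rewrite eq_yu uS // -eq_yu.
Qed.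

Lemma component_root W u j : j \in component W u -> u \in W.
Proof.
move=> jC; apply: contraT => /negP uW.
have /subsetP/(_ j jC) : component W u \subset set0; last by rewrite inE.
by apply: component_min => [/uW|x y] //; rewrite inE.
Qed.

Lemma closed_eq_component W u S : u \in S -> S \subset component W u ->
  (forall x y, x \in S -> y \in component W u -> e x y -> y \in S) -> S = component W u.
Proof.
move=> uS sS closedS; apply/eqP; rewrite eqEsubset sS; apply: component_min => // x y xS yW xy.
by apply: (closedS x) => //; apply: component_closed xy => //; apply: (subsetP sS).
Qed.

Lemma connected_component W u : connected (component W u).
Proof.
move=> A sA A0 neqA; set C := component W u in sA neqA *.
have [/exists_inP[x xA /exists_inP[y yC /andP[yA xy]]]|no_exit] :=
  boolP [exists x in A, exists y in C, (y \notin A) && e x y]; first by exists x, y.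
have closedA x y : x \in A -> y \in C -> e x y -> y \in A.
  move=> xA yC xy; apply: contraNT no_exit => yA; apply/exists_inP; exists x => //.
  by apply/exists_inP; exists y; rewrite ?yA.
have [uA|uA] := boolP (u \in A); first by case/eqP: neqA; apply: closed_eq_component.
have [z zA] := set0Pn _ A0; have zC := subsetP sA _ zA.
have uC : u \in C := component_self (component_root zC).
have CA : C :\: A = C.
  apply: closed_eq_component; rewrite ?inE ?uA ?uC ?subsetDl // => x y; rewrite !inE.
  move=> /andP[xA xC] yC xy; rewrite yC andbT; apply: contra xA => yA.
  by apply: closedA yA xC _; rewrite e_sym.
by move: zC; rewrite -CA inE zA.
Qed.

Lemma connected_sub_closed C D : connected C -> C :&: D != set0 ->
  (forall x y, x \in C -> x \in D -> y \in C -> e x y -> y \in D) -> C \subset D.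
Proof.
move=> connC CD closedD; apply/setIidPl/eqP; apply: contraT => neqCD.
have [x [y [xCD yC yD xy]]] := connC _ (subsetIl C D) CD neqCD.
move: xCD yD; rewrite !inE yC /= => /andP[xC xD] /negP[].
exact: closedD xC xD yC xy.
Qed.

Lemma component_eq W u D : connected D -> u \in D -> D \subset W ->
  (forall x y, x \in D -> y \in W -> e x y -> y \in D) -> component W u = D.
Proof.
move=> connD uD sD closedD; apply/eqP; rewrite eqEsubset component_min //=.
apply: connected_sub_closed => // [|x y xD xC yD xy].
  by apply/set0Pn; exists u; rewrite inE uD component_self // (subsetP sD).
by apply: component_closed xC _ xy; apply: (subsetP sD).
Qed.

Lemma component_mem W u v : v \in component W u -> component W v = component W u.
Proof.
move=> vC; apply: component_eq => //;
  [exact: connected_component | exact: component_sub | exact: component_closed].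
Qed.

Lemma connected_sub_component W C u :
  connected C -> C \subset W -> u \in C -> C \subset component W u.
Proof.
move=> connC sC uC; apply: connected_sub_closed => // [|x y _ xC yC xy].
  by apply/set0Pn; exists u; rewrite inE uC component_self // (subsetP sC).
by apply: component_closed xC _ xy; apply: (subsetP sC).
Qed.

Lemma untouched_components W u v :
  component W u != component W v -> ~~ touch (component W u) (component W v).
Proof.
move=> neqC; apply/touchPn => x y xC yC; apply/andP; split; apply: contra neqC.
  by move=> /eqP eq_xy; rewrite -(component_mem xC) eq_xy (component_mem yC).
move=> xy; have yW := subsetP (component_sub W v) _ yC.
by rewrite -(component_mem yC) (component_mem (component_closed xC yW xy)).
Qed.

Lemma connected_set1 v : connected [set v].
Proof.
move=> A sA A0 neqA; case/negP: neqA; rewrite eqEsubset sA sub1set.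
by have [z zA] := set0Pn _ A0; rewrite -(set1P (subsetP sA _ zA)).
Qed.

Lemma connected_by_component S u : u \in S -> S \subset component S u -> connected S.
Proof.
move=> uS sS; have -> : S = component S u by apply/eqP; rewrite eqEsubset sS component_sub.
exact: connected_component.
Qed.

Lemma connected_extend D S : connected D -> D != set0 -> D \subset S -> S \subset nbhd D ->
  connected S.
Proof.
move=> connD /set0Pn[u uD] sDS sS; apply: (@connected_by_component S u); first exact: (subsetP sDS).
have sD := connected_sub_component connD sDS uD; apply/subsetP => x xS.
case/nbhdP: (subsetP sS _ xS) => [/(subsetP sD) //|[d /(subsetP sD) dC xd]].
by apply: component_closed dC xS _; rewrite e_sym.
Qed.

Lemma connectedU_nbhd D P :
  connected D -> D != set0 -> P \subset nbhd D -> connected (D :|: P).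
Proof.
move=> connD D0 sP; apply: connected_extend connD D0 (subsetUl _ _) _.
by rewrite subUset sub_nbhd.
Qed.

Lemma connectedU_touch A B : connected A -> connected B -> touch A B -> connected (A :|: B).
Proof.
move=> connA connB /exists_inP[x xA xB].
have xU : x \in A :|: B by rewrite inE xA.
apply: (connected_by_component xU); rewrite subUset.
rewrite (connected_sub_component connA (subsetUl A B) xA) /=.
case/nbhdP: xB => [xB|[d dB xd]]; first exact: connected_sub_component connB (subsetUr A B) xB.
have dU : d \in A :|: B by rewrite inE dB orbT.
rewrite -(component_mem (component_closed (component_self xU) dU xd)).
exact: connected_sub_component connB (subsetUr A B) dB.
Qed.

Lemma connected_mixed_edge S s x y : connected S -> x \in S -> y \in S -> e s x -> ~~ e s y ->
  exists x' y', [/\ x' \in S, y' \in S, e x' y', e s x' & ~~ e s y'].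
Proof.
move=> connS xS yS sx sy.
have [|||x' [y' [+ y'S + xy]]] := connS [set z in S | e s z].
- by apply/subsetP => z; rewrite inE => /andP[].
- by apply/set0Pn; exists x; rewrite inE xS.
- by apply: contra sy => /eqP eqS; move: yS; rewrite -eqS inE => /andP[].
by rewrite !inE y'S => /andP[x'S sx'] sy'; exists x', y'.
Qed.

Lemma has_p5_distance3 D x b q : connected D -> (exists2 d, d \in D & e x d) -> e b x ->
  {in D, forall d, ~~ e b d} -> q \in D -> ~~ e x q ->
  {in D, forall d, e x d -> ~~ e d q} -> has_p5 (D :|: [set x; b]).
Proof.
move=> connD [dx dxD xdx] bx bD qD xq far_q.
pose near := [set d in D | e x d || [exists a in D, e x a && e a d]].
have [|||p [q' [pN q'D q'N pq']]] := connD near.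
- by apply/subsetP => d; rewrite inE => /andP[].
- by apply/set0Pn; exists dx; rewrite inE dxD xdx.
- apply: contraTneq (qD) => eqD; rewrite -eqD inE qD (negPf xq) /=.
  by apply/exists_inP => -[a aD /andP[/(far_q a aD)/negP]].
move: q'N; rewrite inE q'D negb_or negb_exists_in => /andP[xq' /forall_inP far_q'].
have pD : p \in D by move: pN; rewrite inE => /andP[].
have xp : ~~ e x p by apply: contraL pq' => xp; have := far_q' p pD; rewrite xp.
move: pN; rewrite inE pD (negPf xp) /= => /exists_inP[a aD /andP[xa ap]].
have aq' : ~~ e a q' by have := far_q' a aD; rewrite xa.
apply/has_p5P; exists b, x, a, p, q'; rewrite !inE aD pD q'D !eqxx !orbT; split=> //.
by rewrite /induced_p5 bx xa ap pq' !bD // xp xq' aq'.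
Qed.

Lemma has_p5_two_pendants D x y b b' : connected D ->
  (exists2 d, d \in D & e x d) -> (exists2 d, d \in D & e y d) -> ~~ e x y ->
  e b x -> e b' y -> {in D, forall d, ~~ e b d} -> {in D, forall d, ~~ e b' d} ->
  ~~ e b y -> ~~ e b' x -> ~~ e b b' -> has_p5 (D :|: [set x; y; b; b']).
Proof.
move=> connD xD [dy dyD ydy] xy bx b'y bD b'D by_ b'x bb'.
have [/exists_inP[d dD /andP[xd yd]]|no_common] := boolP [exists d in D, e x d && e y d].
  apply/has_p5P; exists b, x, d, y, b'; rewrite !inE dD !eqxx !orbT; split=> //.
  by rewrite /induced_p5 bx xd (e_sym d y) yd (e_sym y b') b'y (bD d) // by_ bb' xy
    (e_sym x b') b'x (e_sym d b') (b'D d).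
have {}no_common d : d \in D -> e x d -> ~~ e y d.
  by move=> dD xd; apply: contra no_common => yd; apply/exists_inP; exists d; rewrite ?xd.
have xdy : ~~ e x dy by apply/negP => /(no_common _ dyD); rewrite ydy.
have [/exists_inP[a aD /andP[xa ady]]|far_dy] := boolP [exists a in D, e x a && e a dy].
  apply/has_p5P; exists b, x, a, dy, y; rewrite !inE aD dyD !eqxx !orbT; split=> //.
  by rewrite /induced_p5 bx xa ady (e_sym dy) ydy (bD a) // (bD dy) //
    by_ xdy xy (e_sym a) no_common.
apply: has_p5S (has_p5_distance3 connD xD bx bD dyD xdy _) => [|d dD xd].
  by rewrite setUS // subUset !sub1set !inE !eqxx !orbT.
by apply: contra far_dy => ddy; apply/exists_inP; exists d; rewrite ?xd.
Qed.

Definition proper_colouring (col : T -> nat) k H := {in H, forall x, col x < k} /\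
  {in H &, forall x y, e x y -> col x != col y}.

Lemma proper_colouringS col k H C :
  C \subset H -> proper_colouring col k H -> proper_colouring col k C.
Proof.
move=> /subsetP sC [lt_col proper]; split=> [x /sC|x y /sC xH /sC yH]; first exact: lt_col.
exact: proper.
Qed.

Lemma proper_colouring_nonadj col k H x y : proper_colouring col k H -> x \in H -> y \in H ->
  col x = col y -> ~~ e x y.
Proof.
by move=> [_ proper] xH yH eq_col; apply/negP => /(proper _ _ xH yH); rewrite eq_col eqxx.
Qed.

Definition adjacent_to D P := {in P, forall p, exists2 d, d \in D & e p d}.

Definition hits_second_nbhd C D P := forall w x, w \in C -> w \notin nbhd D ->
  x \in C -> x \in nbhd D -> e w x -> exists2 p, p \in P & e p w.

Lemma adjacent_to_nbhd D P : adjacent_to D P -> P \subset nbhd D.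
Proof. by move=> adjP; apply/subsetP => p /adjP adj_p; apply/nbhdP; right. Qed.

(* Two hitting vertices with equal colours whose private vertices have equal colours too would be
   the ends of a path closed up through D. *)
Lemma exists_second_nbhd_hitting_set col k C D : proper_colouring col k C -> ~~ has_p5 C ->
  connected D -> D \subset C ->
  exists P, [/\ P \subset C, #|P| <= k * k, adjacent_to D P & hits_second_nbhd C D P].
Proof.
move=> proper no_p5 connD sD; have [lt_col _] := proper.
pose A := [set p in C | (p \notin D) && (p \in nbhd D)].
pose B := [set w in C | (w \notin nbhd D) && [exists x in A, e x w]].
have [|P [private [sPA hitP privateP]]] := @hitting_set T A B e.
  by move=> b; rewrite !inE => /and3P[_ _ /exists_inP[x]]; exists x.
have memA p : p \in A -> p \in C /\ exists2 d, d \in D & e p d.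
  by rewrite inE => /and3P[pC pD /nbhdP[pD'|//]]; rewrite pD' in pD.
have memP p : p \in P -> p \in C /\ exists2 d, d \in D & e p d.
  by move=> /(subsetP sPA); apply: memA.
have private_mem p : p \in P ->
    [/\ private p \in C, e p (private p) & {in D, forall d, ~~ e (private p) d}].
  by case/privateP; rewrite inE => /and3P[pC /notin_nbhd[_ far] _].
exists P; split.
- by apply/subsetP => p /memP[].
- apply: (leq_card_in_nat (f := fun p => col p * k + col (private p))) => [p pP|p p' pP p'P].
    have [/lt_col lt_p _] := memP _ pP; have [/lt_col lt_q _ _] := private_mem _ pP.
    by nia.
  have [qC pq far_q] := private_mem _ pP; have [q'C p'q' far_q'] := private_mem _ p'P.
  have [pC p_adj] := memP _ pP; have [p'C p'_adj] := memP _ p'P.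
  move=> /pair_code_inj[|| eq_col eq_col']; try exact: lt_col.
  apply: contraNeq no_p5 => neq_pp'.
  apply: has_p5S (has_p5_two_pendants connD p_adj p'_adj _ _ _ far_q far_q' _ _ _).
  + by rewrite !subUset sD !sub1set pC p'C qC q'C.
  + exact: proper_colouring_nonadj proper _ _ eq_col.
  + by rewrite e_sym.
  + by rewrite e_sym.
  + by have [_ _ /(_ p' p'P)] := privateP _ pP; rewrite eq_sym e_sym; apply.
  + by have [_ _ /(_ p pP neq_pp')] := privateP _ p'P; rewrite e_sym.
  + exact: proper_colouring_nonadj proper _ _ eq_col'.
- by move=> p /memP[].
move=> w x wC wD xC xD wx; have xA : x \in A.
  by rewrite inE xC xD andbT /=; apply: contra wD => xD'; apply: adj_nbhd wx.
by apply: hitP; rewrite inE wC wD; apply/exists_inP; exists x; rewrite // e_sym.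
Qed.

Lemma two_round_domination C v P1 P2 : connected C -> v \in C -> ~~ has_p5 C ->
  P1 \subset C -> adjacent_to [set v] P1 -> hits_second_nbhd C [set v] P1 ->
  P2 \subset C -> adjacent_to (v |: P1) P2 -> hits_second_nbhd C (v |: P1) P2 ->
  C \subset nbhd (v |: P1 :|: P2).
Proof.
move=> connC vC no_p5 sP1 adjP1 hitP1 sP2 adjP2 hitP2; set D1 := v |: P1 in adjP2 hitP2 *.
have vD1 : v \in D1 by rewrite setU11.
have P1D1 p : p \in P1 -> p \in D1 by move=> pP1; rewrite !inE pP1 orbT.
apply: connected_sub_closed => // [|x w xC xD2 wC xw].
  by apply/set0Pn; exists v; rewrite inE vC nbhdU // (subsetP (sub_nbhd D1)).
apply: contraNT no_p5 => wD2.
have wD1 : w \notin nbhd D1 by apply: contra wD2; apply: nbhdU.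
have xD1 : x \notin nbhd D1.
  apply: contra wD2 => xD1; have [|p pP2 pw] := hitP2 w x wC wD1 xC xD1; first by rewrite e_sym.
  by apply: (@adj_nbhd _ p); rewrite ?inE ?pP2 ?orbT // e_sym.
have [xD1' far_x] := notin_nbhd xD1; have [_ far_w] := notin_nbhd wD2.
have [y yP2 xy] : exists2 y, y \in P2 & e x y.
  case/nbhdP: xD2 => [/setUP[xD|xP2]|[y /setUP[/far_x/negPf->|yP2]]] //; last by exists y.
  - by rewrite xD in xD1'.
  by have [d /far_x/negPf->] := adjP2 _ xP2.
have yC := subsetP sP2 _ yP2.
have yv : ~~ e y v.
  apply: contra (xD1) => yv; have xv : x \notin nbhd [set v] by apply: contra xD1; apply: nbhdU.
  have [|p pP1 px] := hitP1 x y xC xv yC _ xy; first by apply: adj_nbhd yv; rewrite inE.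
  by apply: (@adj_nbhd _ p); [exact: P1D1 | rewrite e_sym].
have [p /setU1P[->|pP1] yp] := adjP2 _ yP2; first by rewrite yp in yv.
have [d /set1P-> pv] := adjP1 _ pP1.
apply/has_p5P; exists v, p, y, x, w; rewrite vC (subsetP sP1 _ pP1) yC xC wC; split=> //.
have far_w' z : z \in D1 :|: P2 -> ~~ e z w by rewrite e_sym; apply: far_w.
rewrite /induced_p5 (e_sym v p) pv (e_sym p y) yp (e_sym y x) xy xw (e_sym v y) yv.
rewrite (e_sym v x) far_x // (e_sym p x) far_x ?P1D1 //.
have [-> -> ->] // : [/\ ~~ e v w, ~~ e p w & ~~ e y w].
by split; apply: far_w'; rewrite in_setU ?vD1 ?(P1D1 p) ?yP2 ?orbT.
Qed.

Lemma connected_dominating_set col k C v :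
  connected C -> v \in C -> proper_colouring col k C -> ~~ has_p5 C ->
  exists D, [/\ D \subset C, connected D, v \in D, C \subset nbhd D & #|D| <= 1 + 2 * (k * k)].
Proof.
move=> connC vC proper no_p5; have sv : [set v] \subset C by rewrite sub1set.
have [P1 [sP1 card_P1 adjP1 hitP1]] :=
  exists_second_nbhd_hitting_set proper no_p5 (@connected_set1 v) sv.
have sD1 : v |: P1 \subset C by rewrite subUset sv.
have vD1 : v \in v |: P1 by rewrite setU11.
have connD1 : connected (v |: P1).
  apply: connectedU_nbhd (@connected_set1 v) _ (adjacent_to_nbhd adjP1).
  by apply/set0Pn; exists v; rewrite inE.
have [P2 [sP2 card_P2 adjP2 hitP2]] := exists_second_nbhd_hitting_set proper no_p5 connD1 sD1.
exists (v |: P1 :|: P2); split; first by rewrite subUset sD1.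
- by apply: connectedU_nbhd connD1 _ (adjacent_to_nbhd adjP2); apply/set0Pn; exists v.
- by rewrite inE vD1.
- exact: two_round_domination.
by have := leq_cardsU (v |: P1) P2; have := leq_cardsU [set v] P1; rewrite cards1; lia.
Qed.

Section Isolation.
Variables (col : T -> nat) (k : nat) (F C : {set T}).
Hypotheses (e_irr : irreflexive e) (proper : proper_colouring col k C) (sCF : C \subset F).

Definition incomplete_to D x := [exists d in D, ~~ e x d].

Lemma maximal_clique_incomplete D0 : D0 \subset C -> exists K,
  [/\ K \subset C, #|K| <= k, {in K & D0, forall x d, e x d} &
    {in C, forall x, incomplete_to (D0 :|: K) x}].
Proof.
move=> sD0; have [lt_col proper_adj] := proper.
pose clique (K : {set T}) := [&& K \subset C, [forall x in K, forall d in D0, e x d] &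
  [forall x in K, forall y in K, (x != y) ==> e x y]].
have clique0 : clique set0.
  by rewrite /clique sub0set /=; apply/andP; split; apply/forall_inP => x; rewrite inE.
case: (arg_maxnP (fun K : {set T} => #|K|) clique0) => K /and3P[sK adjD0 adjK] maxK.
have {}adjD0 : {in K & D0, forall x d, e x d}.
  by move=> x d xK; apply/forall_inP: d; apply: (forall_inP adjD0).
have {}adjK : {in K &, forall x y, x != y -> e x y}.
  by move=> x y xK yK; apply/implyP; apply: (forall_inP (forall_inP adjK x xK)).
exists K; split=> // [|x xC].
  apply: (leq_card_in_nat (f := col)) => [x /(subsetP sK)/lt_col //|x y xK yK eq_col].
  apply: contraTeq isT => /(adjK _ _ xK yK);
    rewrite (negPf (proper_colouring_nonadj proper _ _ eq_col)) //;
    exact: (subsetP sK).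
apply: contraT; rewrite negb_exists_in => /forall_inP x_complete.
have {}x_complete d : d \in D0 :|: K -> e x d by move=> /x_complete; rewrite negbK.
have xK : x \notin K.
  by apply/negP => xK; have := x_complete x; rewrite inE xK orbT e_irr => /(_ isT).
suff /maxK : clique (x |: K) by rewrite /= cardsU1 xK add1n ltnn.
apply/and3P; split; first by rewrite subUset sub1set xC.
- apply/forall_inP => y /setU1P[->|yK]; apply/forall_inP => d dD0; last exact: adjD0.
  by apply: x_complete; rewrite inE dD0.
apply/forall_inP => y /setU1P[->|yK]; apply/forall_inP => z /setU1P[->|zK]; rewrite ?eqxx //.
- by rewrite x_complete ?implybT // inE zK orbT.
- by rewrite e_sym x_complete ?implybT // inE yK orbT.
by apply/implyP; apply: adjK.
Qed.

Hypothesis F_p5_free : ~~ has_p5 F.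

Variable D : {set T}.
Hypotheses (connD : connected D) (sDC : D \subset C) (domD : C \subset nbhd D)
  (incomplete : {in C, forall x, incomplete_to D x}).

Let memF x : x \in C -> x \in F. Proof. exact: (subsetP sCF). Qed.

Lemma adjacent_of_outside x b : x \in C -> b \notin nbhd D -> e x b -> exists2 d, d \in D & e x d.
Proof.
move=> xC /notin_nbhd[_ far_b] xb; case/nbhdP: (subsetP domD _ xC) => // /far_b.
by rewrite e_sym xb.
Qed.

Lemma outside_not_mixed x b b' : x \in C -> b \in F -> b \notin nbhd D -> b' \in F ->
  b' \notin nbhd D -> e b b' -> e x b -> e x b'.
Proof.
move=> xC bF bD b'F b'D bb' xb; apply: contraNT F_p5_free => xb'.
have [_ far_b] := notin_nbhd bD; have [_ far_b'] := notin_nbhd b'D.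
have /exists_inP[d1 d1D xd1] := incomplete xC.
have [d0 d0D xd0] := adjacent_of_outside xC bD xb.
have [d [d' [dD d'D dd' xd xd']]] := connected_mixed_edge connD d0D d1D xd0 xd1.
have dF := memF (subsetP sDC _ dD); have d'F := memF (subsetP sDC _ d'D).
apply/has_p5P; exists b', b, x, d, d'; rewrite b'F bF dF d'F memF //; split=> //.
rewrite /induced_p5 (e_sym b' b) bb' (e_sym b x) xb xd dd' (e_sym b' x) xb' !far_b //.
by rewrite !far_b' // xd'.
Qed.

Lemma outside_hitting_set : exists P, [/\ P \subset C, #|P| <= k &
  forall x y, x \in C -> y \in F -> y \notin nbhd D -> e x y -> exists2 p, p \in P & e p y].
Proof.
pose B := [set b in F | (b \notin nbhd D) && [exists x in C, e x b]].
have [|P [private [sPC hitP privateP]]] := @hitting_set T C B e.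
  by move=> b; rewrite inE => /and3P[_ _ /exists_inP[x]]; exists x.
exists P; split=> // [|x y xC yF yD xy]; last first.
  by apply: hitP; rewrite inE yF yD; apply/exists_inP; exists x.
apply: (leq_card_in_nat (f := col)) => [x /(subsetP sPC)/(proj1 proper)//|p p' pP p'P eq_col].
apply: contraNeq F_p5_free => neq_pp'.
have [+ pq only_p] := privateP _ pP; rewrite inE => /and3P[qF qD _].
have [+ p'q' only_p'] := privateP _ p'P; rewrite inE => /and3P[q'F q'D _].
have [_ far_q] := notin_nbhd qD; have [_ far_q'] := notin_nbhd q'D.
have pC := subsetP sPC _ pP; have p'C := subsetP sPC _ p'P.
apply: has_p5S (has_p5_two_pendants connD (adjacent_of_outside pC qD pq)
  (adjacent_of_outside p'C q'D p'q') _ _ _ far_q far_q' _ _ _).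
- by rewrite subUset (subset_trans sDC sCF) !subUset !sub1set (memF pC) (memF p'C) qF.
- exact: proper_colouring_nonadj proper _ _ eq_col.
- by rewrite e_sym.
- by rewrite e_sym.
- by rewrite e_sym; apply: only_p => //; rewrite eq_sym.
- by rewrite e_sym; apply: only_p'.
apply: contra (only_p' p pP neq_pp') => qq'.
exact: outside_not_mixed pC qF qD q'F q'D qq' pq.
Qed.

End Isolation.

Definition isolation_bound k := 1 + 2 * (k * k) + k + k.

Lemma isolating_dominating_set col k F C v : irreflexive e ->
  connected C -> v \in C -> C \subset F -> proper_colouring col k C -> ~~ has_p5 F ->
  exists D, [/\ D \subset C, connected D /\ v \in D, C \subset nbhd D, #|D| <= isolation_bound k &
    forall x y, x \in C -> y \in F -> y \notin nbhd D -> ~~ e x y].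
Proof.
move=> e_irr connC vC sCF proper no_p5.
have [D0 [sD0 connD0 vD0 domD0 card_D0]] :=
  connected_dominating_set connC vC proper (contra (has_p5S sCF) no_p5).
have [K [sK card_K adjK incomplete]] := maximal_clique_incomplete e_irr proper sD0.
set D1 := D0 :|: K in incomplete.
have sD1 : D1 \subset C by rewrite subUset sD0.
have vD1 : v \in D1 by rewrite inE vD0.
have connD1 : connected D1.
  apply: connectedU_nbhd connD0 _ _; first by apply/set0Pn; exists v.
  by apply/subsetP => x xK; apply: (adj_nbhd vD0); apply: adjK.
have domD1 : C \subset nbhd D1 by apply: subset_trans domD0 (nbhdS (subsetUl _ _)).
have [P [sP card_P hitP]] := outside_hitting_set proper sCF no_p5 connD1 sD1 domD1 incomplete.
exists (D1 :|: P); split; first by rewrite subUset sD1.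
- split; last by rewrite inE vD1.
  apply: connectedU_nbhd connD1 _ (subset_trans sP domD1).
  by apply/set0Pn; exists v.
- exact: subset_trans domD1 (nbhdS (subsetUl _ _)).
- by have := leq_cardsU D1 P; have := leq_cardsU D0 K; rewrite /isolation_bound -/D1; lia.
move=> x y xC yF yD; apply: contra (yD) => xy.
have [|p pP py] := hitP x y xC yF _ xy; first exact: contra (@nbhdU D1 P y) yD.
by apply: (@adj_nbhd _ p); [rewrite inE pP orbT | rewrite e_sym].
Qed.

End Graph.

Definition take_set (T : finType) n (S : {set T}) : {set T} := [set x in take n (enum S)].

Lemma take_set_sub (T : finType) n (S : {set T}) : take_set n S \subset S.
Proof. by apply/subsetP => x; rewrite inE => /mem_take; rewrite mem_enum. Qed.

Lemma card_take_set (T : finType) n (S : {set T}) : #|take_set n S| = minn n #|S|.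
Proof.
have /card_uniqP : uniq (take n (enum S)) by apply: take_uniq; apply: enum_uniq.
by rewrite cardsE => ->; rewrite size_take_min -cardE.
Qed.

Lemma take_set_all (T : finType) n (S : {set T}) : #|S| <= n -> take_set n S = S.
Proof.
by move=> le_Sn; apply/eqP; rewrite eqEcard take_set_sub card_take_set (minn_idPr le_Sn) leqnn.
Qed.

(** * Decoupling the vertices outside a dominating set *)

Section Decoupling.
Variables (T : finType) (e : rel T) (r : nat).
Hypothesis e_sym : symmetric e.
Implicit Types (A D H J K X Y : {set T}) (L : seq {set T}).

Notation nbhd := (nbhd e).

Definition far_from J := [set y | [forall j in J, ~~ e j y]].

Definition P5rK1_free := forall J, #|J| = r -> {in J &, forall i j, ~~ e i j} ->
  ~~ has_p5 e (far_from J).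

Lemma far_fromP J y : reflect {in J, forall j, ~~ e j y} (y \in far_from J).
Proof. by rewrite inE; apply: forall_inP. Qed.

Definition trace D v := [set d in D | e v d].

(* A is the list of a colour, D0 the dominating set, D its enlargement and K the vertices of that
   colour in D; between pruned vertices of that colour edges only join vertices with equal trace. *)
Definition admissible A D0 K D := [set v in A :\: D | [forall x in K, ~~ e v x] &&
  [forall d in D0, if e v d then [exists x in K, e d x] else r <= #|[set x in K | ~~ e d x]|]].

Definition pruned A D0 K D := [set z in admissible A D0 K D |
  [forall v in admissible A D0 K D, e z v ==> (trace D0 z \subset trace D0 v)]].

Lemma pruned_sub A D0 K D : pruned A D0 K D \subset A :\: D.
Proof. by apply/subsetP => v; rewrite inE => /andP[+ _]; rewrite inE => /andP[]. Qed.

Lemma pruned_far A D0 K D v : v \in pruned A D0 K D -> {in K, forall x, ~~ e v x}.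
Proof. by rewrite inE => /andP[+ _]; rewrite inE => /and3P[_ /forall_inP]. Qed.

Lemma pruned_adj_trace A D0 K D :
  {in pruned A D0 K D &, forall x y, e x y -> trace D0 x = trace D0 y}.
Proof.
move=> x y /setIdP[xC /forall_inP sub_x] /setIdP[yC /forall_inP sub_y] xy.
by apply/eqP; rewrite eqEsubset (implyP (sub_x y yC)) // (implyP (sub_y x xC)) // e_sym.
Qed.

Definition list_colouring L (col : T -> nat) H := {in H, forall x, x \in nth set0 L (col x)} /\
  {in H &, forall x y, e x y -> col x != col y}.

Definition colour_class (col : T -> nat) H c := [set x in H | col x == c].

Lemma list_colouring_proper L col H :
  list_colouring L col H -> proper_colouring e col (size L) H.
Proof.
move=> [in_list proper]; split=> // x /in_list; apply: contraTT; rewrite -leqNgt => le_L.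
by rewrite nth_default // inE.
Qed.

Lemma mem_colour_class col H c x : (x \in colour_class col H c) = (x \in H) && (col x == c).
Proof. by rewrite inE. Qed.

Lemma colour_classS col D H c : D \subset H -> colour_class col D c \subset colour_class col H c.
Proof. by move=> /subsetP sDH; apply/subsetP => x; rewrite !inE => /andP[/sDH-> ->]. Qed.

Section Enlargement.
Variables (col : T -> nat) (k : nat) (H D0 : {set T}).
Hypotheses (free : P5rK1_free) (proper : proper_colouring e col k H) (sD0H : D0 \subset H).

Let lt_col : {in H, forall x, col x < k}. Proof. by case: proper. Qed.

Definition nbr_sample d c := take_set 1 [set x in colour_class col H c | e d x].
Definition nonnbr_sample d c := take_set r [set x in colour_class col H c | ~~ e d x].

Definition sampled :=
  D0 :|: \bigcup_(d in D0) \bigcup_(c in [set: 'I_k]) (nbr_sample d c :|: nonnbr_sample d c).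

Lemma colour_class_nonadj c x y :
  x \in colour_class col H c -> y \in colour_class col H c -> ~~ e x y.
Proof.
rewrite !inE => /andP[xH /eqP eq_x] /andP[yH /eqP eq_y].
by apply: proper_colouring_nonadj proper xH yH _; rewrite eq_x.
Qed.

Lemma nbr_sampleP d c x : x \in nbr_sample d c -> x \in colour_class col H c /\ e d x.
Proof. by move=> /(subsetP (take_set_sub _ _)); rewrite inE => /andP[]. Qed.

Lemma nonnbr_sampleP d c x : x \in nonnbr_sample d c -> x \in colour_class col H c /\ ~~ e d x.
Proof. by move=> /(subsetP (take_set_sub _ _)); rewrite inE => /andP[]. Qed.

Lemma sampled_sub : sampled \subset H.
Proof.
rewrite subUset sD0H; apply/bigcupsP => d _; apply/bigcupsP => c _; apply/subsetP => x.
by case/setUP=> [/nbr_sampleP[]|/nonnbr_sampleP[]]; rewrite inE => /andP[].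
Qed.

Lemma mem_sampled d c x : d \in D0 -> x \in nbr_sample d c :|: nonnbr_sample d c -> x \in sampled.
Proof.
move=> dD0 x_sample; have lt_c : c < k.
  suff : x \in colour_class col H c by rewrite inE => /andP[/lt_col + /eqP <-].
  by case/setUP: x_sample => [/nbr_sampleP[]|/nonnbr_sampleP[]].
rewrite inE; apply/orP; right; apply/bigcupP; exists d => //.
by apply/bigcupP; exists (Ordinal lt_c); rewrite ?in_setT.
Qed.

Lemma sample_class D d c x : sampled \subset D -> d \in D0 ->
  x \in nbr_sample d c :|: nonnbr_sample d c -> x \in colour_class col D c.
Proof.
move=> sD dD0 x_sample; have xD := subsetP sD _ (mem_sampled dD0 x_sample).
suff : x \in colour_class col H c by rewrite !inE xD => /andP[].
by case/setUP: x_sample => [/nbr_sampleP[]|/nonnbr_sampleP[]].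
Qed.

Lemma sees_sampled D d c : sampled \subset D -> D \subset H -> d \in D0 ->
  [exists x in colour_class col D c, e d x] = [exists x in colour_class col H c, e d x].
Proof.
move=> sD sDH dD0; apply/exists_inP/exists_inP =>
  [[x /(subsetP (colour_classS _ _ sDH)) xH dx]|[h hH dh]].
  by exists x.
have : 0 < #|nbr_sample d c|.
  by rewrite card_take_set leq_min; apply/card_gt0P; exists h; rewrite inE hH.
case/card_gt0P=> x x_sample; have [_ dx] := nbr_sampleP x_sample.
by exists x => //; apply: (sample_class sD dD0); rewrite inE x_sample.
Qed.

Lemma misses_sampled D d c : sampled \subset D -> D \subset H -> d \in D0 ->
  (r <= #|[set x in colour_class col D c | ~~ e d x]|) =
  (r <= #|[set x in colour_class col H c | ~~ e d x]|).
Proof.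
move=> sD sDH dD0; apply/idP/idP => [le_r|le_r]; apply: leq_trans (subset_leq_card _).
- exact: le_r.
- apply/subsetP => x; rewrite [x \in _]inE => /andP[/(subsetP (colour_classS _ _ sDH)) xH dx].
  by rewrite inE xH.
- by rewrite -[leqLHS](minn_idPl le_r) -card_take_set.
apply/subsetP => x x_sample; have [_ dx] := nonnbr_sampleP x_sample.
by rewrite inE dx andbT; apply: (sample_class sD dD0); rewrite inE x_sample orbT.
Qed.

Lemma unsampled_misses d h : d \in D0 -> h \in H -> h \notin sampled -> ~~ e d h ->
  r <= #|[set x in colour_class col H (col h) | ~~ e d x]|.
Proof.
move=> dD0 hH h_sampled dh; apply: contraR h_sampled; rewrite -ltnNge => lt_r.
apply: (mem_sampled dD0 (c := col h)); rewrite inE /nonnbr_sample take_set_all; last exact: ltnW.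
by rewrite !inE hH eqxx dh orbT.
Qed.

Lemma admissible_sampled A D c : sampled \subset D -> D \subset H ->
  admissible A D0 (colour_class col D c) D
    \subset admissible A D0 (colour_class col sampled c) sampled.
Proof.
move=> sD sDH; apply/subsetP => v; rewrite ![v \in admissible _ _ _ _]inE.
case/and3P=> [/setDP[vA vD] /forall_inP far_v /forall_inP types].
rewrite inE vA (contra (subsetP sD v) vD) /=; apply/andP; split; apply/forall_inP.
  by move=> x /(subsetP (colour_classS _ _ sD)); apply: far_v.
move=> d dD0; have := types d dD0.
by rewrite !(sees_sampled _ _ _ dD0) ?(misses_sampled _ _ _ dD0) ?sampled_sub.
Qed.

Lemma admissible_class A D h : sampled \subset D -> D \subset H -> h \in H -> h \notin D ->
  h \in A -> h \in admissible A D0 (colour_class col D (col h)) D.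
Proof.
move=> sD sDH hH hD hA; rewrite !inE hA hD /=; apply/andP; split; apply/forall_inP.
  move=> x /(subsetP (colour_classS _ _ sDH)); apply: colour_class_nonadj.
  by rewrite inE hH eqxx.
move=> d dD0; rewrite (sees_sampled _ sD) // (misses_sampled _ sD) //.
case: ifP => hd.
  by apply/exists_inP; exists h; rewrite ?inE ?hH ?eqxx // e_sym.
by apply: unsampled_misses; rewrite ?(contra (subsetP sD h)) // e_sym hd.
Qed.

Section Crossing.
Variables (A : {set T}) (c : nat) (d : T).
Hypothesis dD0 : d \in D0.

Notation class := (colour_class col H c).
Notation candidates := (admissible A D0 (colour_class col sampled c) sampled).

Lemma admissible_far x v : v \in candidates -> x \in sampled -> x \in class -> ~~ e v x.
Proof.
rewrite inE !mem_colour_class => /and3P[_ /forall_inP far_v _] x_sampled /andP[_ x_col].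
by apply: far_v; rewrite mem_colour_class x_sampled.
Qed.

Lemma card_nonnbr_sample v : v \in candidates -> ~~ e v d -> #|nonnbr_sample d c| = r.
Proof.
move=> + vd; rewrite inE => /and3P[_ _ /forall_inP/(_ d dD0)].
by rewrite (negPf vd) misses_sampled ?sampled_sub // card_take_set => /minn_idPl.
Qed.

Lemma nonnbr_sample_far_from y : [|| y == d, y \in class | (y \in candidates) && ~~ e y d] ->
  y \in far_from (nonnbr_sample d c).
Proof.
move=> y_in; apply/far_fromP => j j_sample; have [jc dj] := nonnbr_sampleP j_sample.
have j_sampled : j \in sampled by apply: (mem_sampled dD0 (c := c)); rewrite inE j_sample orbT.
case/or3P: y_in => [/eqP->|yc|/andP[y_cand _]]; first by rewrite e_sym.
  exact: colour_class_nonadj jc yc.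
by rewrite e_sym; apply: admissible_far.
Qed.

Lemma no_two_crossings p p' v v' : p \in class -> p' \in class -> e d p -> e d p' ->
  v \in candidates -> v' \in candidates -> ~~ e v d -> ~~ e v' d ->
  e p v -> e p' v' -> ~~ e p v' -> e p' v.
Proof.
move=> pc p'c dp dp' vC v'C vd v'd pv p'v' pv'; apply: contraT => p'v.
have sampled_indep : {in nonnbr_sample d c &, forall i j, ~~ e i j}.
  by move=> i j /nonnbr_sampleP[ic _] /nonnbr_sampleP[jc _]; apply: colour_class_nonadj ic jc.
have [vF v'F dF] : [/\ v \in far_from (nonnbr_sample d c), v' \in far_from (nonnbr_sample d c)
    & d \in far_from (nonnbr_sample d c)].
  by split; apply: nonnbr_sample_far_from; rewrite ?vC ?vd ?v'C ?v'd ?eqxx ?orbT.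
have classF x : x \in class -> x \in far_from (nonnbr_sample d c).
  by move=> xc; apply: nonnbr_sample_far_from; rewrite xc orbT.
have /negP[] := free (card_nonnbr_sample vC vd) sampled_indep; apply/has_p5P.
have [vv'|vv'] := boolP (e v v'); last first.
  exists v, p, d, p', v'; rewrite vF v'F dF !classF //; split=> //.
  rewrite /induced_p5 (e_sym v p) pv (e_sym p d) dp dp' p'v' vd (e_sym v p') p'v vv' pv'.
  by rewrite (e_sym d v') v'd (colour_class_nonadj pc p'c).
have /exists_inP[x x_sampled dx] : [exists x in colour_class col sampled c, e d x].
  by rewrite sees_sampled ?sampled_sub //; apply/exists_inP; exists p.
have xc : x \in class := subsetP (colour_classS _ _ sampled_sub) _ x_sampled.
have {}x_sampled : x \in sampled by move: x_sampled; rewrite inE => /andP[].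
exists v', v, p, d, x; rewrite vF v'F dF !classF //; split=> //.
rewrite /induced_p5 (e_sym v' v) vv' (e_sym v p) pv (e_sym p d) dp dx (e_sym v' p) pv'.
by rewrite v'd vd (admissible_far v'C) // (admissible_far vC) // (colour_class_nonadj pc xc).
Qed.

End Crossing.

Lemma crossing_hitting_set A c X Y : exists P : {set T}, [/\ P \subset colour_class col H c,
  #|P| <= 1 &
  X \subset Y \/ forall h v, h \in colour_class col H c -> trace D0 h = X ->
    v \in admissible A D0 (colour_class col sampled c) sampled -> trace D0 v = Y -> e h v ->
    exists2 p, p \in P & e p v].
Proof.
have [sXY|/subsetPn[d dX dY]] := boolP (X \subset Y).
  by exists set0; rewrite sub0set cards0; split=> //; left.
set cand := admissible _ _ _ _.
pose Q := [set q in colour_class col H c | trace D0 q == X].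
pose B := [set v in cand | (trace D0 v == Y) && [exists q in Q, e q v]].
have [|P [private [sPQ hitP privateP]]] := @hitting_set T Q B e.
  by move=> b; rewrite inE => /and3P[_ _ /exists_inP].
have memQ q : q \in Q -> q \in colour_class col H c /\ e d q /\ d \in D0.
  rewrite inE => /andP[qc /eqP tr_q]; split=> //.
  by move: dX; rewrite -tr_q inE e_sym => /andP[].
have memB v : v \in B -> v \in cand /\ (d \in D0 -> ~~ e v d).
  rewrite inE => /and3P[vC /eqP tr_v _]; split=> // dD0.
  by move: dY; rewrite -tr_v inE dD0.
exists P; split.
- by apply: subset_trans sPQ _; apply/subsetP => q /memQ[].
- apply: (leq_card_in_nat (f := fun=> 0)) => // p p' pP p'P _.
  have [/memB[vC vd] pv only_p] := privateP _ pP.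
  have [/memB[v'C v'd] p'v' only_p'] := privateP _ p'P.
  have [pc [dp dD0]] := memQ _ (subsetP sPQ _ pP).
  have [p'c [dp' _]] := memQ _ (subsetP sPQ _ p'P).
  apply/eqP; apply: contraT => neq_pp'.
  have := no_two_crossings dD0 pc p'c dp dp' vC v'C (vd dD0) (v'd dD0) pv p'v'
    (only_p' p pP neq_pp').
  by rewrite (negPf (only_p p' p'P _)) // eq_sym.
right=> h v hc tr_h vC tr_v hv; apply: hitP; rewrite inE vC tr_v eqxx.
by apply/exists_inP; exists h => //; rewrite inE hc tr_h eqxx.
Qed.

End Enlargement.

Definition enlargement_bound k n := n + n * (k * (1 + r)) + 2 ^ n * (2 ^ n * k).

Lemma leq_enlargement_bound k m n : m <= n -> enlargement_bound k m <= enlargement_bound k n.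
Proof.
move=> le_mn; have le_exp : 2 ^ m <= 2 ^ n by rewrite leq_exp2l.
by rewrite !leq_add // ?leq_mul.
Qed.

Lemma card_sampled col k H D0 : #|sampled col k H D0| <= #|D0| + #|D0| * (k * (1 + r)).
Proof.
apply: leq_trans (leq_cardsU _ _) _; rewrite leq_add2l; apply: leq_card_bigcup => d _.
apply: leq_trans (leq_card_bigcup (m := 1 + r) _) _ => [c _|]; last by rewrite cardsT card_ord.
apply: leq_trans (leq_cardsU _ _) _.
by rewrite !card_take_set leq_add // geq_minl.
Qed.

Lemma decoupling_enlargement L col H D0 : P5rK1_free -> list_colouring L col H -> D0 \subset H ->
  exists D, [/\ D0 \subset D, D \subset H, #|D| <= enlargement_bound (size L) #|D0| &
    forall h, h \in H -> h \notin D ->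
      h \in pruned (nth set0 L (col h)) D0 (colour_class col D (col h)) D].
Proof.
move=> free lists sD0H; have proper := list_colouring_proper lists; set k := size L in proper *.
have [in_list _] := lists; have [lt_col _] := proper.
set S := sampled col k H D0; have sSH : S \subset H := sampled_sub col k sD0H.
have [Q hitQ] := fin_all_exists (fun t : {set T} * {set T} * 'I_k =>
  crossing_hitting_set free proper sD0H (nth set0 L t.2) t.2 t.1.1 t.1.2).
pose D1 := \bigcup_(X in powerset D0) \bigcup_(Y in powerset D0)
  \bigcup_(c in [set: 'I_k]) Q (X, Y, c).
have sD1H : D1 \subset H.
  apply/bigcupsP => X _; apply/bigcupsP => Y _; apply/bigcupsP => c _.
  have [sQ _ _] := hitQ (X, Y, c); apply: subset_trans sQ _.
  by apply/subsetP => x; rewrite mem_colour_class => /andP[].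
have sSD : S \subset S :|: D1 := subsetUl _ _.
have sDH : S :|: D1 \subset H by rewrite subUset sSH.
exists (S :|: D1); split=> //; first exact: subset_trans (subsetUl _ _) sSD.
  apply: leq_trans (leq_cardsU _ _) (leq_add (card_sampled _ _ _ _) _).
  rewrite -card_powerset; apply: leq_card_bigcup => X _; apply: leq_card_bigcup => Y _.
  apply: leq_trans (leq_card_bigcup (m := 1) _) _ => [c _|]; last by rewrite cardsT card_ord muln1.
  by have [] := hitQ (X, Y, c).
move=> h hH hD; set K := colour_class col _ _; set A := nth set0 L _.
rewrite inE (admissible_class proper) ?in_list //=; apply/forall_inP => v vC; apply/implyP => hv.
have lt_c := lt_col h hH; pose c := Ordinal lt_c.
have vS := subsetP (admissible_sampled proper sD0H _ _ sSD sDH) _ vC.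
have [sQ _ [//|hitPair]] := hitQ (trace D0 h, trace D0 v, c).
have hc : h \in colour_class col H c by rewrite mem_colour_class hH eqxx.
have [p pQ pv] := hitPair h v hc erefl vS erefl hv.
have pD1 : p \in D1.
  have sub_trace w : trace D0 w \in powerset D0.
    by rewrite powersetE; apply/subsetP => x; rewrite inE => /andP[].
  apply/bigcupP; exists (trace D0 h) => //; apply/bigcupP; exists (trace D0 v) => //.
  by apply/bigcupP; exists c.
have /negP[] : ~~ e p v; last exact: pv.
move: vC; rewrite !inE => /and3P[_ /forall_inP far_v _]; rewrite e_sym; apply: far_v.
by move: (subsetP sQ _ pQ); rewrite !inE pD1 orbT => /andP[].
Qed.

End Decoupling.

(** * Splitting a piece of a P5-free graph *)

Section Splitting.
Variables (T : finType) (e : rel T).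
Hypotheses (e_sym : symmetric e) (p5_free : ~~ has_p5 e setT).
Implicit Types (A B S X D C W P M Om V : {set T}) (ds : seq T).

Notation connected := (connected e).
Notation component := (component e).
Notation touch := (touch e).
Notation nbhd := (nbhd e).

Lemma not_mixed_twice A B s x y x' y' : connected A -> connected B -> ~~ touch A B ->
  x \in A -> y \in A -> e s x -> ~~ e s y -> x' \in B -> e s x' -> y' \in B -> e s y'.
Proof.
move=> connA connB farAB xA yA sx sy xB sx' yB; apply: contraT => sy'; case/negP: p5_free.
have [a [a' [aA a'A aa' sa sa']]] := connected_mixed_edge connA xA yA sx sy.
have [b [b' [bB b'B bb' sb sb']]] := connected_mixed_edge connB xB yB sx' sy'.
have farAB' u v : u \in A -> v \in B -> ~~ e u v := touchPn_adj farAB.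
apply/has_p5P; exists a', a, s, b, b'; rewrite !in_setT; split=> //.
rewrite /induced_p5 (e_sym a' a) aa' (e_sym a s) sa sb bb' (e_sym a' s) sa' sb'.
by rewrite (farAB' a' b) // (farAB' a' b') // (farAB' a b) // (farAB' a b').
Qed.

Definition vicinity c M := [set v | [|| v \in M, v == c | (v \in nbhd M) && e c v]].

Definition near x ds := nbhd [set v in x :: ds].

Definition barrier V x ds := [set y | (1 < count (e y) ds) ||
  [&& y \in V, y \in near x ds & [exists z in V, (z \notin near x ds) && e y z]]].

Lemma nearP x ds y :
  reflect (y = x \/ e y x \/ exists2 d, d \in ds & (y == d) || e y d) (y \in near x ds).
Proof.
apply: (iffP (nbhdP _ _ _)) => [[|[d]]|].
- by rewrite inE in_cons => /orP[/eqP|yds]; [left | right; right; exists y; rewrite ?eqxx].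
- rewrite inE in_cons => /orP[/eqP-> yx|dds yd]; [by right; left | right; right].
  by exists d; rewrite // yd orbT.
case=> [->|[yx|[d dds /orP[/eqP->|yd]]]].
- by left; rewrite inE mem_head.
- by right; exists x; rewrite // inE mem_head.
- by left; rewrite inE in_cons dds orbT.
by right; exists d; rewrite // inE in_cons dds orbT.
Qed.

Variable I : {set T}.
Hypotheses (indepI : {in I &, forall i j, ~~ e i j})
  (maxI : forall v, v \notin I -> exists2 i, i \in I & e v i).

Definition attached B c' := [/\ c' \in I, c' \notin nbhd B &
  forall s, s \notin B -> s \in nbhd B -> ~~ e c' s -> {in B, forall x, e s x}].

Variables (c : T) (M : {set T}).
Hypotheses (cI : c \in I) (connM : connected M) (attM : attached M c) (M_gt1 : 1 < #|M|)
  (meetM : M :&: I != set0).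

Let V := vicinity c M.

Lemma attached_far : c \notin M /\ {in M, forall m, ~~ e c m}.
Proof. by have [_ + _] := attM => /notin_nbhd. Qed.

Lemma c_vicinity : c \in V. Proof. by rewrite inE eqxx orbT. Qed.

Lemma sub_vicinity : M \subset V. Proof. by apply/subsetP => m mM; rewrite inE mM. Qed.

Let sMV x : x \in M -> x \in V. Proof. exact: (subsetP sub_vicinity). Qed.

Lemma attachmentP s : s \in V -> s \notin M -> s != c -> e c s /\ exists2 m, m \in M & e s m.
Proof.
rewrite inE => /or3P[sM|eq_sc|/andP[/nbhdP[sM|sm] cs]] sM' sc.
- by rewrite sM in sM'.
- by rewrite eq_sc in sc.
- by rewrite sM in sM'.
by split.
Qed.

Definition good B := [&& B \subset M, B != M, B :&: I != set0 &
  [exists c' in I, [&& c' \in V, c' \notin nbhd B &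
    [forall s in V, [&& s \in nbhd B, s \notin B & ~~ e c' s] ==> [forall x in B, e s x]]]]].

Lemma goodP B : good B -> [/\ B \subset M, B != M, B :&: I != set0 &
  exists2 c', c' \in V & attached B c'].
Proof.
case/and4P=> sBM neqBM meetB /exists_inP[c' c'I /and3P[c'V c'B /forall_inP complete]].
split=> //; exists c' => //; split=> // s sB s_nbr c's x xB.
have [sV|sV] := boolP (s \in V).
  by have := complete s sV; rewrite s_nbr sB c's => /forall_inP; apply.
have s_nbrM : s \in nbhd M by apply: (subsetP (nbhdS e sBM)).
have [_ _] := attM; apply=> //; last exact: (subsetP sBM).
  by apply: contra sV => sM; rewrite inE sM.
by apply: contra sV => cs; rewrite inE s_nbrM cs !orbT.
Qed.

Lemma goodI B c' : B \subset M -> B != M -> B :&: I != set0 -> c' \in V -> c' \in I ->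
  c' \notin nbhd B ->
  (forall s, s \in V -> s \in nbhd B -> s \notin B -> ~~ e c' s -> {in B, forall x, e s x}) ->
  good B.
Proof.
move=> sBM neqBM meetB c'V c'I c'B complete; apply/and4P; split=> //; apply/exists_inP.
exists c' => //; rewrite c'V c'B; apply/forall_inP => s sV; apply/implyP => /and3P[s_nbr sB c's].
by apply/forall_inP; apply: complete.
Qed.

Definition splitting x ds (Bs : seq {set T}) := [/\ size ds <= 3, size Bs <= 3,
  forall B, B \in Bs -> connected B /\ good B,
  {in Bs &, forall B B', B != B' -> ~~ touch B B'} &
  forall v, v \in I -> v \in M -> (exists2 B, B \in Bs & v \in B) \/
    (good (component (M :\: barrier V x ds) v) /\
     {in Bs, forall B, ~~ touch (component (M :\: barrier V x ds) v) B})].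

Definition separator Om := [&& Om \subset V, [disjoint Om & I], c \notin Om,
  V :\: M :\ c \subset Om &
  [forall u in M :\: Om, good (component (V :\: Om) u)]].

Lemma separator_compl : separator (V :\: I).
Proof.
apply/and5P; split; first exact: subsetDl.
- by apply/pred0P => z /=; rewrite inE; case: (z \in I); rewrite ?andbF.
- by rewrite inE cI.
- apply/subsetP => s /setD1P[sc /setDP[sV sM]]; rewrite inE sV andbT.
  have [cs _] := attachmentP sV sM sc; apply: contraL cs; exact: indepI.
apply/forall_inP => u /setDP[uM]; rewrite inE (sMV uM) andbT negbK => uI.
have -> : component (V :\: (V :\: I)) u = [set u].
  apply: component_eq; [exact: connected_set1 | by rewrite inE | |].
    by rewrite sub1set !in_setD uI (sMV uM).
  move=> x y /set1P->; rewrite !in_setD => /andP[+ yV]; rewrite yV andbT negbK => yI uy.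
  by rewrite (negPf (indepI uI yI)) in uy.
have [cM far_c] := attached_far; apply: (goodI (c' := c)) => //; rewrite ?c_vicinity //.
- by rewrite sub1set.
- by apply: contraTneq M_gt1 => <-; rewrite cards1.
- by apply/set0Pn; exists u; rewrite !inE eqxx.
- apply/nbhdP => -[/set1P eq_cu|[d /set1P-> cu]]; first by rewrite eq_cu uM in cM.
  by rewrite (negPf (far_c u uM)) in cu.
by move=> s sV /nbhdP[->//|[d /set1P-> su]] _ _ x /set1P->.
Qed.

Section MinimalSeparator.
Variable Om : {set T}.
Hypotheses (sepOm : separator Om) (minOm : forall Om', separator Om' -> #|Om| <= #|Om'|).

Lemma separator_sub : Om \subset V. Proof. by case/and5P: sepOm. Qed.

Let sOV x : x \in Om -> x \in V. Proof. exact: (subsetP separator_sub). Qed.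

Lemma separator_notin_indep x : x \in I -> x \notin Om.
Proof. by case/and5P: sepOm => _ disjOI _ _ _ xI; rewrite (disjointFl disjOI). Qed.

Lemma c_notin_separator : c \notin Om. Proof. by case/and5P: sepOm. Qed.

Lemma attachment_in_separator s : s \in V -> s \notin M -> s != c -> s \in Om.
Proof.
case/and5P: sepOm => _ _ _ /subsetP sub_attach _ sV sM sc; apply: sub_attach.
by rewrite in_setD1 sc in_setD sM.
Qed.

Definition block u := component (V :\: Om) u.
Definition blocks := [set block u | u in V :\: Om].
Definition seen q := [set D in blocks | [exists x in D, e q x]].

Lemma mem_block u : u \in V -> u \notin Om -> u \in block u.
Proof. by move=> uV uO; apply: component_self; rewrite inE uO. Qed.

Lemma mem_blocks u : u \in V -> u \notin Om -> block u \in blocks.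
Proof. by move=> uV uO; apply: imset_f; rewrite inE uO. Qed.

Lemma blocksP D : D \in blocks -> exists u, [/\ u \in V, u \notin Om & D = block u].
Proof. by case/imsetP=> u /setDP[uV uO] ->; exists u. Qed.

Lemma good_block u : u \in M -> u \notin Om -> good (block u).
Proof. by case/and5P: sepOm => _ _ _ _ /forall_inP good_u uM uO; apply: good_u; rewrite inE uO. Qed.

Lemma block_c : block c = [set c].
Proof.
apply: component_eq; [exact: connected_set1 | by rewrite inE | |].
  by rewrite sub1set inE c_notin_separator c_vicinity.
move=> x y /set1P-> /setDP[yV yO] cy; rewrite inE; apply: contraNT yO => yc.
have [cM far_c] := attached_far.
by apply: attachment_in_separator => //; apply: contraL cy => /far_c.
Qed.

Lemma blocks_good D : D \in blocks -> D != [set c] -> good D.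
Proof.
case/blocksP=> u [uV uO ->] neq_c; apply: good_block => //; apply: contraNT uO => uM.
by apply: attachment_in_separator => //; apply: contraNneq neq_c => ->; rewrite block_c.
Qed.

Lemma connected_block D : D \in blocks -> connected D.
Proof. by case/blocksP=> u [_ _ ->]; apply: connected_component. Qed.

Lemma block_sub D x : D \in blocks -> x \in D -> x \in V /\ x \notin Om.
Proof. by case/blocksP=> u [_ _ ->] /(subsetP (component_sub e _ _)) /setDP. Qed.

Lemma block_eq D x : D \in blocks -> x \in D -> D = block x.
Proof. by case/blocksP=> u [_ _ ->] xD; rewrite /block (component_mem e_sym xD). Qed.

Lemma block_boundary D x y :
  D \in blocks -> x \in D -> y \in V -> e x y -> y \notin D -> y \in Om.
Proof.
case/blocksP=> u [_ _ ->] xD yV xy; apply: contraNT => yO.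
by apply: component_closed xD _ xy; rewrite inE yO.
Qed.

Lemma untouched_blocks D D' : D \in blocks -> D' \in blocks -> D != D' -> ~~ touch D D'.
Proof. by case/blocksP=> u [_ _ ->] /blocksP[v [_ _ ->]]; apply: untouched_components. Qed.

Lemma blocks_nonadj D D' x y :
  D \in blocks -> D' \in blocks -> D != D' -> x \in D -> y \in D' -> ~~ e x y.
Proof. by move=> Db D'b neqDD'; apply: touchPn_adj (untouched_blocks Db D'b neqDD'). Qed.

Lemma block_meets_indep D : D \in blocks -> exists2 i, i \in D & i \in I.
Proof.
move=> Db; have [->|/(blocks_good Db)/goodP[_ _ /set0Pn[i /setIP[iD iI]] _]] := eqVneq D [set c].
  by exists c; rewrite ?inE.
by exists i.
Qed.

Lemma seenP q D : reflect (D \in blocks /\ exists2 x, x \in D & e q x) (D \in seen q).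
Proof. by rewrite inE; apply: (iffP andP) => -[Db /exists_inP]. Qed.

Lemma seen_block q x : x \in V -> x \notin Om -> e q x -> block x \in seen q.
Proof.
move=> xV xO qx; apply/seenP; split; first exact: mem_blocks.
by exists x => //; apply: mem_block.
Qed.

Lemma seen_nonempty q : q \in Om -> exists D, D \in seen q.
Proof.
move=> qO; have qV := sOV qO; have [qM|qM] := boolP (q \in M); last first.
  have [|cq _] := attachmentP qV qM; first by apply: contraTneq qO => ->; apply: c_notin_separator.
  by exists (block c); rewrite seen_block ?c_vicinity ?c_notin_separator // e_sym.
have [|i iI qi] := maxI (v := q); first by apply: contraL qO; apply: separator_notin_indep.
have iM : i \in M.
  apply: contraT => iM; have i_nbr : i \in nbhd M by apply: (adj_nbhd qM); rewrite e_sym.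
  have [j] := set0Pn _ meetM; rewrite inE => /andP[jM jI].
  have [_ _ /(_ i iM i_nbr (indepI cI iI) j jM)] := attM.
  by rewrite (negPf (indepI iI jI)).
by exists (block i); rewrite seen_block ?sMV // separator_notin_indep.
Qed.

(* Dropping D from the separator would give a smaller one. *)
Lemma separator_irredundant D z : connected D -> good D -> z \in D -> z \in Om ->
  ~ (forall x y, x \in D -> y \in V -> e x y -> y \notin D -> y \in Om).
Proof.
move=> connD goodD zD zO boundaryD; have [sDM _ _ _] := goodP goodD.
suff /minOm : separator (Om :\: D).
  rewrite leqNgt => /negP; apply; apply: proper_card; rewrite properE subsetDl.
  by apply/subsetPn; exists z; rewrite // inE zD.
apply/and5P; split.
- exact: subset_trans (subsetDl _ _) separator_sub.
- by case/and5P: sepOm => _ disjOI _ _ _; apply: disjointWl (subsetDl _ _) disjOI.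
- by rewrite inE (negPf c_notin_separator) andbF.
- apply/subsetP => s /setD1P[sc /setDP[sV sM]]; rewrite inE attachment_in_separator // andbT.
  by apply: contra sM; apply: (subsetP sDM).
apply/forall_inP => u /setDP[uM]; rewrite inE negb_and negbK => uDO.
have uV := sMV uM; have [uD|uD] := boolP (u \in D).
  suff -> : component (V :\: (Om :\: D)) u = D by [].
  apply: component_eq => // [|x y xD /setDP[yV]].
    by apply/subsetP => x xD; rewrite !in_setD xD (sMV (subsetP sDM _ xD)).
  by rewrite inE negb_and negbK => /orP[//|yO] xy; apply: contraNT yO; apply: boundaryD xy.
rewrite (negPf uD) /= in uDO.
suff -> : component (V :\: (Om :\: D)) u = block u by apply: good_block.
have block_u := mem_blocks uV uDO; have uB := mem_block uV uDO.
have disjDB x : x \in block u -> x \notin D.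
  move=> xB; apply: contra uD => xD; suff /subsetP/(_ u uB) : block u \subset D by [].
  apply: connected_sub_closed => // [||p q pB pD qB pq]; first exact: connected_block.
    by apply/set0Pn; exists x; rewrite inE xB.
  have [qV qO] := block_sub block_u qB.
  by apply: contraNT qO; apply: boundaryD pq.
apply: component_eq => //; first exact: connected_block.
  by apply/subsetP => x /(block_sub block_u)[xV xO]; rewrite !in_setD (negPf xO) andbF.
move=> x y xB /setDP[yV]; rewrite inE negb_and negbK => yDO xy.
have [xV xO] := block_sub block_u xB.
have [yD|yD] := boolP (y \in D); last first.
  by rewrite (negPf yD) /= in yDO; apply: component_closed xB _ xy; rewrite inE yDO.
by case/negP: xO; apply: (boundaryD y x) (disjDB _ xB); rewrite // e_sym.
Qed.

Section NoCommonBlock.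
Variables x y : T.
Hypotheses (xO : x \in Om) (yO : y \in Om) (neq_xy : x != y) (xy : ~~ e x y)
  (no_common : forall D, D \in seen x -> D \notin seen y).

Let xV : x \in V := sOV xO.
Let yV : y \in V := sOV yO.

Definition reach := y |: \bigcup_(D in seen y) D.

Lemma reachP z : z \in reach -> z = y \/ exists2 D, D \in seen y & z \in D.
Proof. by case/setU1P=> [->|/bigcupP[D Dy zD]]; [left | right; exists D]. Qed.

Lemma mem_reach : y \in reach. Proof. exact: setU11. Qed.

Lemma seen_sub_reach D : D \in seen y -> D \subset reach.
Proof. by move=> Dy; apply: subset_trans (bigcup_sup _ Dy) (subsetUr _ _). Qed.

Lemma reach_sub z : z \in reach -> z \in V.
Proof. by case/reachP=> [->//|[D /seenP[Db _] zD]]; case: (block_sub Db zD). Qed.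

Lemma connected_reach : connected reach.
Proof.
apply: (connected_by_component e_sym mem_reach); apply/subsetP => z.
case/reachP=> [->|[D Dy zD]]; first exact: component_self mem_reach.
have sDR := seen_sub_reach Dy; have /seenP[Db [d dD yd]] := Dy.
have d_comp : d \in component reach y.
  exact: component_closed (component_self e mem_reach) (subsetP sDR _ dD) yd.
rewrite -(component_mem e_sym d_comp).
exact: subsetP (connected_sub_component (connected_block Db) sDR dD) _ zD.
Qed.

Lemma reach_boundary z : z \in V -> z \notin reach -> z \in nbhd reach -> z \in Om.
Proof.
move=> zV zR /nbhdP[zR'|[w wR zw]]; first by rewrite zR' in zR.
case/reachP: wR zw => [->|[D Dy wD]] zw.
  apply: contraNT zR => zO; apply: (subsetP (seen_sub_reach (D := block z) _)).
    by apply: seen_block; rewrite // e_sym.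
  exact: mem_block.
have /seenP[Db _] := Dy; apply: (block_boundary Db wD zV); first by rewrite e_sym.
by apply: contra zR; apply: (subsetP (seen_sub_reach Dy)).
Qed.

Lemma x_notin_nbhd_reach : x \notin nbhd reach.
Proof.
apply/nbhdP => -[/reachP[eq_xy|[D /seenP[Db _] xD]]|[w /reachP[->|[D Dy wD]] xw]].
- by move: neq_xy; rewrite eq_xy eqxx.
- by have [_] := block_sub Db xD; rewrite xO.
- by move: xy; rewrite xw.
have /seenP[Db _] := Dy; suff /no_common : D \in seen x by rewrite Dy.
by apply/seenP; split=> //; exists w.
Qed.

Definition far_side := component (V :\: nbhd reach) x.

Lemma connected_far_side : connected far_side.
Proof. exact: connected_component. Qed.

Lemma mem_far_side : x \in far_side.
Proof. by apply: component_self; rewrite inE x_notin_nbhd_reach. Qed.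

Lemma far_side_sub z : z \in far_side -> z \in V /\ z \notin nbhd reach.
Proof. by move=> /(subsetP (component_sub e _ _)) /setDP. Qed.

Lemma untouched_far_side : ~~ touch reach far_side.
Proof.
rewrite touchC //; apply/exists_inP => -[z /far_side_sub[_ zR]].
by rewrite (negPf zR).
Qed.

Lemma far_side_boundary z u : z \in far_side -> u \in V -> e z u -> u \notin far_side ->
  u \in nbhd reach /\ u \in Om.
Proof.
move=> zF uV zu uF; have uR : u \in nbhd reach.
  by apply: contraNT uF => uR; apply: component_closed zF _ zu; rewrite inE uR.
split=> //; apply: reach_boundary => //; apply: contraTN zu => uR'.
by rewrite e_sym; apply: touchPn_adj untouched_far_side uR' zF.
Qed.

Lemma far_side_sub_M : c \notin far_side -> far_side \subset M.
Proof.
move=> cF; apply/subsetP => z zF; have [zV _] := far_side_sub zF.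
apply: contraNT c_notin_separator => zM.
have [|cz _] := attachmentP zV zM; first by apply: contraNneq cF => <-.
by have [|_] := far_side_boundary zF c_vicinity _ cF; first by rewrite e_sym.
Qed.

Lemma far_side_neq_M : far_side != M.
Proof.
have yR := subsetP (sub_nbhd e reach) _ mem_reach.
apply/eqP => eqFM; have [yM|yM] := boolP (y \in M).
  by rewrite -eqFM in yM; have [_ /negP] := far_side_sub yM.
have [|_ [m mM ym]] := attachmentP yV yM.
  by apply: contraTneq yO => ->; apply: c_notin_separator.
rewrite -eqFM in mM; have [_ /negP[]] := far_side_sub mM.
by apply: (adj_nbhd mem_reach); rewrite e_sym.
Qed.

Lemma far_side_meets_indep : far_side :&: I != set0.
Proof.
have [D Dx] := seen_nonempty xO; have /seenP[Db [d dD xd]] := Dx.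
have sD : D \subset V :\: nbhd reach.
  apply/subsetP => z zD; have [zV zO] := block_sub Db zD; rewrite inE zV andbT.
  apply: contra zO => zR; apply: reach_boundary => //.
  apply/negP => /reachP[eq_zy|[D' D'y zD']].
    by have [_] := block_sub Db zD; rewrite eq_zy yO.
  have /seenP[D'b _] := D'y; have := no_common Dx.
  by rewrite (block_eq Db zD) -(block_eq D'b zD') D'y.
have dF : d \in far_side by apply: component_closed mem_far_side (subsetP sD _ dD) xd.
have [j jD jI] := block_meets_indep Db; apply/set0Pn; exists j; rewrite inE jI andbT.
rewrite /far_side -(component_mem e_sym dF).
exact: subsetP (connected_sub_component (connected_block Db) sD dD) _ jD.
Qed.

Lemma far_side_good : c \notin far_side -> good far_side.
Proof.
move=> cF; have [D Dy] := seen_nonempty yO; have /seenP[Db _] := Dy.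
have [i iD iI] := block_meets_indep Db; have iR := subsetP (seen_sub_reach Dy) _ iD.
apply: (goodI (c' := i)) => //; [exact: far_side_sub_M | exact: far_side_neq_M
  | exact: far_side_meets_indep | exact: reach_sub | |].
  apply: contra untouched_far_side => iF; apply/exists_inP.
  by exists i.
move=> s sV /nbhdP[->//|[z zF sz]] sF is_ z' z'F.
have [|/nbhdP[sR|[w wR sw]] sO] := far_side_boundary zF sV _ sF; first by rewrite e_sym.
  by rewrite (negPf (touchPn_adj untouched_far_side sR zF)) in sz.
have si : ~~ e s i by rewrite e_sym.
exact: not_mixed_twice connected_reach connected_far_side untouched_far_side
  wR iR sw si zF sz z'F.
Qed.

Definition far_frontier := [set z in V | (z \notin far_side) && (z \in nbhd far_side)].
Definition near_side := component (V :\: far_frontier) y.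

Lemma connected_near_side : connected near_side.
Proof. exact: connected_component. Qed.

Lemma far_frontier_sub z : z \in far_frontier -> z \in Om.
Proof.
rewrite inE => /and3P[zV zF /nbhdP[zF'|[u uF zu]]]; first by rewrite zF' in zF.
by have [|_ //] := far_side_boundary uF zV _ zF; rewrite e_sym.
Qed.

Lemma far_side_step z u : z \in far_side -> u \in V -> e z u ->
  u \in far_side \/ u \in far_frontier.
Proof.
move=> zF uV zu; have [|uF] := boolP (u \in far_side); [by left | right].
by rewrite inE uV uF (adj_nbhd zF) // e_sym.
Qed.

Lemma reach_sub_near_side : reach \subset near_side.
Proof.
apply: connected_sub_component connected_reach _ mem_reach => //; apply/subsetP => z zR.
rewrite inE reach_sub // andbT inE !negb_and negbK; apply/or3P; apply: Or33.
by apply: contra untouched_far_side => zF; apply/exists_inP; exists z.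
Qed.

Lemma near_side_sub z : z \in near_side -> z \in V /\ z \notin far_frontier.
Proof. by move=> /(subsetP (component_sub e _ _)) /setDP. Qed.

Lemma near_side_notin_far_side z : z \in near_side -> z \notin far_side.
Proof.
move=> zN; apply: contra untouched_far_side => zF; apply/exists_inP; exists y;
  first exact: mem_reach.
apply: (subsetP (sub_nbhd e _)).
suff /subsetP/(_ y (subsetP reach_sub_near_side _ mem_reach)) : near_side \subset far_side by [].
apply: connected_sub_closed connected_near_side _ _ => [|p q pN pF qN pq].
  by apply/set0Pn; exists z; rewrite inE zN.
have [qV qFr] := near_side_sub qN; case: (far_side_step pF qV pq) => // qFr'.
by rewrite qFr' in qFr.
Qed.

Lemma untouched_near_side : ~~ touch near_side far_side.
Proof.
apply/touchPn => p q pN qF; have [pV pFr] := near_side_sub pN; apply/andP; split.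
  by apply: contraTneq qF => <-; apply: near_side_notin_far_side.
apply/negP => pq; rewrite e_sym in pq.
by case: (far_side_step qF pV pq) => [|/(negP pFr)//]; apply/negP/near_side_notin_far_side.
Qed.

Lemma near_side_boundary z u : z \in near_side -> u \in V -> e z u -> u \notin near_side ->
  u \in far_frontier.
Proof.
move=> zN uV zu; apply: contraNT => uFr; apply: component_closed zN _ zu.
by rewrite inE uFr.
Qed.

Lemma near_side_sub_M : c \in far_side -> near_side \subset M.
Proof.
move=> cF; apply/subsetP => z zN; have [zV _] := near_side_sub zN; apply: contraT => zM.
have [|cz _] := attachmentP zV zM.
  by apply: contraTneq cF => <-; apply: near_side_notin_far_side.
by rewrite e_sym (negPf (touchPn_adj untouched_near_side zN cF)) in cz.
Qed.

Lemma near_side_neq_M : near_side != M.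
Proof.
apply/eqP => eqNM; have [xM|xM] := boolP (x \in M).
  by rewrite -eqNM in xM; have := near_side_notin_far_side xM; rewrite mem_far_side.
have [|_ [m mM xm]] := attachmentP xV xM.
  by apply: contraTneq xO => ->; apply: c_notin_separator.
rewrite -eqNM in mM; rewrite e_sym in xm.
by rewrite (negPf (touchPn_adj untouched_near_side mM mem_far_side)) in xm.
Qed.

Lemma near_side_good : c \in far_side -> good near_side.
Proof.
move=> cF; apply: (goodI (c' := c)); rewrite ?c_vicinity ?near_side_sub_M ?near_side_neq_M //.
- have [D Dy] := seen_nonempty yO; have /seenP[Db _] := Dy.
  have [i iD iI] := block_meets_indep Db; apply/set0Pn; exists i; rewrite inE iI andbT.
  exact: (subsetP reach_sub_near_side) _ (subsetP (seen_sub_reach Dy) _ iD).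
- apply: contra untouched_near_side => cN; rewrite touchC //; apply/exists_inP.
  by exists c.
move=> s sV /nbhdP[->//|[z zN sz]] sN cs z' z'N.
have s_fr : s \in far_frontier by apply: (near_side_boundary zN sV); rewrite // e_sym.
have [u uF su] : exists2 u, u \in far_side & e s u.
  move: s_fr; rewrite inE => /and3P[_ sF /nbhdP[sF'|//]].
  by rewrite sF' in sF.
have far_near : ~~ touch far_side near_side by rewrite touchC // untouched_near_side.
have sc : ~~ e s c by rewrite e_sym.
exact: not_mixed_twice connected_far_side connected_near_side far_near
  uF cF su sc zN sz z'N.
Qed.

Lemma no_common_block_absurd : False.
Proof.
have [cF|cF] := boolP (c \in far_side); last first.
  apply: (separator_irredundant connected_far_side (far_side_good cF) mem_far_side xO).
  by move=> z u zF uV zu /(far_side_boundary zF uV zu)[].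
have yN := subsetP reach_sub_near_side _ mem_reach.
apply: (separator_irredundant connected_near_side (near_side_good cF) yN yO).
by move=> z u zN uV zu uN; apply: far_frontier_sub (near_side_boundary zN uV zu uN).
Qed.

End NoCommonBlock.

Lemma common_seen_block x y : x \in Om -> y \in Om -> x != y -> ~~ e x y ->
  exists2 D, D \in seen x & D \in seen y.
Proof.
move=> xO yO neq_xy xy; apply/exists_inP; apply: contraT; rewrite negb_exists_in.
move=> /forall_inP no_common; case: (no_common_block_absurd xO yO neq_xy xy) => D Dx.
exact: no_common.
Qed.

Lemma seen_nested x y D : x \in Om -> y \in Om -> ~~ e x y -> D \in seen x -> D \in seen y ->
  (seen x \subset seen y) || (seen y \subset seen x).
Proof.
move=> xO yO xy /seenP[Db xD] /seenP[_ yD]; apply: contraT; rewrite negb_or.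
case/andP=> /subsetPn[D1 D1x D1y] /subsetPn[D2 D2y D2x].
have /seenP[D1b [b bD1 xb]] := D1x; have /seenP[D2b [b' b'D2 yb']] := D2y.
have neq1 : D1 != D by apply: contraNneq D1y => ->; apply/seenP.
have neq2 : D2 != D by apply: contraNneq D2x => ->; apply/seenP.
have neq12 : D1 != D2 by apply: contraNneq D1y => ->.
case/negP: p5_free; apply: has_p5S (subsetT _)
  (has_p5_two_pendants e_sym (connected_block Db) xD yD xy _ _ _ _ _ _ _).
- by rewrite e_sym; apply: xb.
- by rewrite e_sym; apply: yb'.
- by move=> d; apply: blocks_nonadj D1b Db neq1 bD1.
- by move=> d; apply: blocks_nonadj D2b Db neq2 b'D2.
- by apply: contra D1y => by_; apply/seenP; split=> //; exists b; rewrite // e_sym.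
- by apply: contra D2x => b'x; apply/seenP; split=> //; exists b'; rewrite // e_sym.
exact: blocks_nonadj D1b D2b neq12 bD1 b'D2.
Qed.

Lemma mixed_block_unique q D D' d : D \in seen q -> D' \in seen q -> D != D' -> d \in D ->
  ~~ e q d -> {in D', forall d', e q d'}.
Proof.
move=> /seenP[Db [x xD qx]] /seenP[D'b [x' x'D qx']] neqDD' dD qd d' d'D.
exact: not_mixed_twice (connected_block Db) (connected_block D'b) (untouched_blocks Db D'b neqDD')
  xD dD qx qd x'D qx' d'D.
Qed.

Lemma adjacent_to_one_of_two q D D' d d' : D \in seen q -> D' \in seen q -> D != D' ->
  d \in D -> d' \in D' -> e q d || e q d'.
Proof.
move=> Dq D'q neqDD' dD d'D; apply: contraT; rewrite negb_or => /andP[qd qd'].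
by rewrite (mixed_block_unique Dq D'q neqDD' dD qd d'D) in qd'.
Qed.

(* A recoverable block is a component of M minus the barrier. *)
Definition recoverable x ds D := {in D, forall y, y \notin barrier V x ds} /\
  (forall y z, z \in D -> y \in Om -> e y z -> y \in barrier V x ds).

Definition in_other_blocks ds D :=
  {in ds, forall d, exists2 D', D' \in blocks & (D' != D) && (d \in D')}.

Lemma other_blocks_nonadj ds D : D \in blocks -> in_other_blocks ds D ->
  {in D & ds, forall y d, ~~ e y d}.
Proof.
move=> Db others y d yD /others[D' D'b /andP[neqD'D dD']].
by rewrite e_sym; apply: blocks_nonadj D'b Db neqD'D dD' yD.
Qed.

Lemma unseen_block_far x ds D : x \in Om -> D \in blocks -> D \notin seen x ->
  in_other_blocks ds D -> {in D, forall y, y \notin near x ds}.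
Proof.
move=> xO Db Dx others y yD; have [yV yO] := block_sub Db yD.
apply/nearP => -[eq_yx|[yx|[d dds /orP[/eqP eq_yd|yd]]]].
- by rewrite eq_yx xO in yO.
- by case/negP: Dx; apply/seenP; split=> //; exists y; rewrite // e_sym.
- have [D' D'b /andP[neqD'D dD']] := others d dds.
  by rewrite (block_eq Db yD) (block_eq D'b dD') eq_yd eqxx in neqD'D.
by rewrite (negPf (other_blocks_nonadj Db others yD dds)) in yd.
Qed.

Lemma far_block_recoverable x ds D : Om \subset near x ds -> D \in blocks ->
  {in D, forall y, y \notin near x ds} -> recoverable x ds D.
Proof.
move=> near_Om Db farD; split=> [y yD|y z zD yO yz].
  rewrite inE (negPf (farD y yD)) andbF orbF -leqNgt; apply: leq_trans (leqnSn 0).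
  rewrite leqNgt -has_count; apply: contra (farD y yD) => /hasP[d dds yd].
  by apply/nearP; right; right; exists d; rewrite // yd orbT.
rewrite inE (sOV yO) (subsetP near_Om) //=; apply/orP; right; apply/exists_inP.
by have [zV _] := block_sub Db zD; exists z; rewrite // farD.
Qed.

Lemma unseen_block_recoverable x ds D : x \in Om -> Om \subset near x ds -> D \in blocks ->
  D \notin seen x -> in_other_blocks ds D -> recoverable x ds D.
Proof.
by move=> xO near_Om Db Dx others; apply: far_block_recoverable => //; apply: unseen_block_far.
Qed.

Section LeastSeen.
Variable x : T.
Hypotheses (xO : x \in Om) (least : forall y, y \in Om -> #|seen x| <= #|seen y|).

Lemma least_seen_eq y : y \in Om -> seen y \subset seen x -> seen y = seen x.
Proof. by move=> yO sub_yx; apply/eqP; rewrite eqEcard sub_yx least. Qed.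

Lemma least_seen_sub y : y \in Om -> y != x -> ~~ e x y -> seen x \subset seen y.
Proof.
move=> yO neq_yx xy; rewrite eq_sym in neq_yx.
have [D Dx Dy] := common_seen_block xO yO neq_yx xy.
by case/orP: (seen_nested xO yO xy Dx Dy) => // /(least_seen_eq yO) ->.
Qed.

Lemma separator_near ds : (forall y, y \in Om -> seen x \subset seen y ->
    exists2 d, d \in ds & e y d) -> Om \subset near x ds.
Proof.
move=> adj_ds; apply/subsetP => y yO; apply/nearP; have [->|neq_yx] := eqVneq y x; first by left.
have [xy|xy] := boolP (e x y); first by right; left; rewrite e_sym.
have [d dds yd] := adj_ds y yO (least_seen_sub yO neq_yx xy).
by right; right; exists d; rewrite // yd orbT.
Qed.

Lemma two_blocks_near ds D1 D2 d1 d2 : D1 \in seen x -> D2 \in seen x -> D1 != D2 ->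
  d1 \in D1 -> d2 \in D2 -> d1 \in ds -> d2 \in ds -> Om \subset near x ds.
Proof.
move=> D1x D2x neq12 d1D d2D d1ds d2ds; apply: separator_near => y yO /subsetP sub_xy.
case/orP: (adjacent_to_one_of_two (sub_xy _ D1x) (sub_xy _ D2x) neq12 d1D d2D) => yd.
  by exists d1.
by exists d2.
Qed.

Definition described ds (Bs : seq {set T}) := [/\ size ds <= 3, size Bs <= 3,
  {subset Bs <= blocks} & forall D, D \in blocks -> D \notin Bs -> recoverable x ds D].

Lemma single_block_described D1 : D1 \in seen x -> (forall D, D \in seen x -> D = D1) ->
  exists ds Bs, described ds Bs.
Proof.
move=> D1x only_D1; have /seenP[D1b _] := D1x.
have [eqD1c|neqD1c] := eqVneq D1 [set c].
  exists [:: c], [:: D1]; split=> // [B|D Db]; first by rewrite inE => /eqP->.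
  rewrite inE => neqDD1; apply: unseen_block_recoverable => //.
  - apply: separator_near => y yO /subsetP/(_ D1 D1x)/seenP[_ [z]].
    by rewrite eqD1c => /set1P-> yc; exists c; rewrite ?inE.
  - by apply: contra neqDD1 => /only_D1/eqP.
  by move=> d; rewrite inE => /eqP->; exists D1 => //; rewrite eq_sym neqDD1 eqD1c inE eqxx.
have [_ _ _ [c' c'V [c'I c'D complete]]] := goodP (blocks_good D1b neqD1c).
have [d1 d1D _] := block_meets_indep D1b; have c'O := separator_notin_indep c'I.
have c'b := mem_blocks c'V c'O; have c'B := mem_block c'V c'O.
exists [:: d1; c'], [:: D1; block c']; split=> // [B|D Db].
  by rewrite !inE => /orP[] /eqP->.
rewrite !inE negb_or => /andP[neqD1 neqc']; apply: unseen_block_recoverable => //.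
- apply: separator_near => y yO /subsetP/(_ D1 D1x)/seenP[_ [z zD yz]].
  have [c'y|c'y] := boolP (e c' y); first by exists c'; rewrite ?inE ?eqxx ?orbT // e_sym.
  exists d1; rewrite ?inE ?eqxx //; apply: complete => //; last exact: adj_nbhd zD yz.
  by apply/negP => yD; have [_] := block_sub D1b yD; rewrite yO.
- by apply: contra neqD1 => /only_D1/eqP.
move=> d; rewrite !inE => /orP[] /eqP->; first by exists D1 => //; rewrite eq_sym neqD1.
by exists (block c') => //; rewrite eq_sym neqc'.
Qed.

Lemma two_blocks_described D1 D2 : D1 \in seen x -> D2 \in seen x -> D1 != D2 ->
  (forall D, D \in seen x -> D = D1 \/ D = D2) -> exists ds Bs, described ds Bs.
Proof.
move=> D1x D2x neq12 only_two; have /seenP[D1b _] := D1x; have /seenP[D2b _] := D2x.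
have [d1 d1D _] := block_meets_indep D1b; have [d2 d2D _] := block_meets_indep D2b.
exists [:: d1; d2], [:: D1; D2]; split=> // [B|D Db]; first by rewrite !inE => /orP[] /eqP->.
rewrite !inE negb_or => /andP[neqD1 neqD2]; apply: unseen_block_recoverable => //.
- by apply: two_blocks_near D1x D2x neq12 d1D d2D _ _; rewrite !inE eqxx ?orbT.
- by apply/negP => /only_two[] /eqP; apply/negP.
move=> d; rewrite !inE => /orP[] /eqP->; first by exists D1 => //; rewrite eq_sym neqD1.
by exists D2 => //; rewrite eq_sym neqD2.
Qed.

Lemma three_blocks_described D1 D2 D3 : D1 \in seen x -> D2 \in seen x -> D3 \in seen x ->
  uniq [:: D1; D2; D3] ->
  (forall D y, D \in seen x -> D != D1 -> y \in D -> e x y) -> exists ds Bs, described ds Bs.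
Proof.
move=> D1x D2x D3x; rewrite /= !inE negb_or !andbT => /andP[/andP[neq12 neq13] neq23] complete.
have /seenP[D1b _] := D1x; have /seenP[D2b _] := D2x; have /seenP[D3b _] := D3x.
have [d1 d1D _] := block_meets_indep D1b; have [d2 d2D _] := block_meets_indep D2b.
have [d3 d3D _] := block_meets_indep D3b; pose ds := [:: d1; d2; d3].
have near_Om : Om \subset near x ds.
  by apply: two_blocks_near D1x D2x neq12 d1D d2D _ _; rewrite !inE eqxx ?orbT.
exists ds, [:: D1; D2; D3]; split=> // [B|]; first by rewrite !inE => /or3P[] /eqP->.
have others D : D \in blocks -> D \notin [:: D1; D2; D3] -> in_other_blocks ds D.
  move=> Db; rewrite !inE !negb_or => /and3P[neqD1 neqD2 neqD3] d; rewrite !inE => /or3P[] /eqP->.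
  - by exists D1; rewrite // eq_sym neqD1.
  - by exists D2; rewrite // eq_sym neqD2.
  by exists D3; rewrite // eq_sym neqD3.
move=> D Db notin_Bs; have [Dx|Dx] := boolP (D \in seen x); last first.
  by apply: unseen_block_recoverable => //; apply: others.
have neqD1 : D != D1 by apply: contra notin_Bs => /eqP->; apply: mem_head.
have xD y : y \in D -> e x y by apply: complete.
split=> [y yD|y z zD yO yz].
  have [yV _] := block_sub Db yD; rewrite inE negb_or; apply/andP; split.
    rewrite -leqNgt; apply: leq_trans (leqnSn 0); rewrite leqNgt -has_count -all_predC.
    by apply/allP => d; apply: other_blocks_nonadj Db (others D Db notin_Bs) y d yD.
  apply/negP => /and3P[_ _ /exists_inP[z zV /andP[/negP z_far yz]]]; apply: z_far.
  have [zD|zD] := boolP (z \in D); first by apply/nearP; right; left; rewrite e_sym xD.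
  by apply: (subsetP near_Om); apply: block_boundary Db yD zV yz zD.
have [sub_yx|/subsetPn[D' D'y D'x]] := boolP (seen y \subset seen x).
  have eq_seen := least_seen_eq yO sub_yx; rewrite -eq_seen in D1x D2x D3x.
  have := adjacent_to_one_of_two D1x D2x neq12 d1D d2D.
  have := adjacent_to_one_of_two D1x D3x neq13 d1D d3D.
  have := adjacent_to_one_of_two D2x D3x neq23 d2D d3D.
  by rewrite inE /= addn0; case: (e y d1); case: (e y d2); case: (e y d3).
have /seenP[D'b [u uD' yu]] := D'y; have [uV _] := block_sub D'b uD'.
rewrite inE (sOV yO) (subsetP near_Om) //=; apply/orP; right; apply/exists_inP.
exists u; rewrite // yu andbT; apply: (unseen_block_far xO D'b D'x (others D' D'b _) uD').
by apply: contra D'x; rewrite !in_cons in_nil orbF => /or3P[] /eqP->.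
Qed.

Lemma exists_description : exists ds Bs, described ds Bs.
Proof.
have [D1 D1x] := seen_nonempty xO.
have [/exists_inP[D2 D2x neq21]|only_D1] := boolP [exists D in seen x, D != D1]; last first.
  apply: single_block_described D1x _ => D Dx; apply/eqP; apply: contraT => neqDD1.
  by case/negP: only_D1; apply/exists_inP; exists D.
have {D1 D1x D2 D2x neq21} [D1 [D2 [D1x D2x neq12 complete]]] : exists D1 D2,
    [/\ D1 \in seen x, D2 \in seen x, D1 != D2 &
      forall D y, D \in seen x -> D != D1 -> y \in D -> e x y].
  have [/exists_inP[D Dx /exists_inP[z zD xz]]|no_mixed] :=
    boolP [exists D in seen x, [exists z in D, ~~ e x z]]; last first.
    exists D1, D2; rewrite eq_sym; split=> // D y Dx _ yD; apply: contraNT no_mixed => xy.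
    by apply/exists_inP; exists D => //; apply/exists_inP; exists y.
  have complete D' y : D' \in seen x -> D' != D -> y \in D' -> e x y.
    by move=> D'x neq; apply: mixed_block_unique Dx D'x _ zD xz y; rewrite eq_sym.
  have [eqD|neqD] := eqVneq D D1; last by exists D, D1.
  by exists D, D2; split=> //; rewrite eqD eq_sym.
have [/exists_inP[D3 D3x /andP[neq31 neq32]]|no_third] :=
  boolP [exists D in seen x, (D != D1) && (D != D2)].
  apply: (three_blocks_described D1x D2x D3x) => //.
  by rewrite /= !inE negb_or neq12 (eq_sym D1) neq31 (eq_sym D2) neq32.
apply: (two_blocks_described D1x D2x neq12) => D Dx.
have [->|neqD1] := eqVneq D D1; [by left | right].
by apply: contraNeq no_third => neqD2; apply/exists_inP; exists D; rewrite ?neqD1.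
Qed.

End LeastSeen.

Lemma separator_nonempty : exists x, x \in Om.
Proof.
have [i] := set0Pn _ meetM; rewrite inE => /andP[iM iI].
have iO := separator_notin_indep iI; have ib := mem_blocks (sMV iM) iO.
have [sDM neqDM /set0Pn[j /setIP[jD _]] _] := goodP (good_block iM iO).
have [|y [z [yD zM zD yz]]] := connM sDM _ neqDM; first by apply/set0Pn; exists j.
by exists z; apply: block_boundary ib yD (sMV zM) yz zD.
Qed.

Lemma recoverable_component x ds D v : D \in blocks -> D \subset M -> recoverable x ds D ->
  v \in D -> component (M :\: barrier V x ds) v = D.
Proof.
move=> Db sDM [off_barrier on_barrier] vD; apply: component_eq => //; first exact: connected_block.
  by apply/subsetP => y yD; rewrite inE off_barrier // (subsetP sDM).
move=> y z yD /setDP[zM zb] yz; apply: contraNT zb => zD.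
by apply: (on_barrier z y) => //; [apply: block_boundary Db yD (sMV zM) yz zD | rewrite e_sym].
Qed.

Lemma split_minimal : exists x ds Bs, splitting x ds Bs.
Proof.
have [x0 x0O] := separator_nonempty.
case: (arg_minnP (fun x => #|seen x|) (x0O : [pred x in Om] x0)) => x xO least.
have [ds [Bs [size_ds size_Bs sub_Bs recov]]] := exists_description xO least.
exists x, ds, [seq B <- Bs | B != [set c]]; split=> //.
- by apply: leq_trans size_Bs; rewrite size_filter count_size.
- move=> B; rewrite mem_filter => /andP[Bc /sub_Bs Bb].
  by split; [apply: connected_block | apply: blocks_good].
- move=> B B'; rewrite !mem_filter => /andP[_ /sub_Bs Bb] /andP[_ /sub_Bs B'b].
  exact: untouched_blocks.
move=> v vI vM; have vO := separator_notin_indep vI.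
have vb := mem_blocks (sMV vM) vO; have vB := mem_block (sMV vM) vO.
have neq_c : block v != [set c].
  apply: contraTneq vM => eq_c; move: vB; rewrite eq_c => /set1P->.
  by case: attached_far.
have [vBs|vBs] := boolP (block v \in Bs).
  by left; exists (block v); rewrite ?mem_filter ?neq_c.
right; have good_v := blocks_good vb neq_c; have [sBM _ _ _] := goodP good_v.
rewrite (recoverable_component vb sBM (recov _ vb vBs) vB); split=> // B.
rewrite mem_filter => /andP[_ BBs]; apply: untouched_blocks => //; first exact: sub_Bs.
by apply: contraNneq vBs => ->.
Qed.

End MinimalSeparator.

Lemma split_piece : exists x ds Bs, splitting x ds Bs.
Proof.
case: (arg_minnP (fun Om : {set T} => #|Om|) separator_compl) => Om sepOm minOm.
exact: split_minimal sepOm minOm.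
Qed.

End Splitting.

(** * Maximum weight independent sets in P5-free graphs *)

Section HeaviestIndependentSet.
Variables (T : finType) (e : rel T) (w : T -> nat).
Implicit Types (A B C M S W : {set T}).

Notation entry := (T * {set T} * {set T})%type.
Notation part := ({set T} * {set T})%type.
Implicit Types (tab : seq entry) (ps : seq part).

Notation connected := (connected e).
Notation component := (component e).
Notation touch := (touch e).
Notation nbhd := (nbhd e).
Notation weight := (weight w).
Notation heaviest := (heaviest w).

Definition hull_step c x y S := [set z | [|| z == x, z == y |
  [&& z != c, ~~ e c z, [exists u in S, e z u] & [exists u in S, ~~ e z u]]]].
Definition hull c x y := fixset (hull_step c x y).

Definition keys := [seq (t.1.1, hull t.1.1 t.1.2 t.2) |
  t <- [seq (p, y) | p <- [seq (c, x) | c <- enum T, x <- enum T], y <- enum T]].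
Definition initial_table : seq entry := [seq (k, set0) | k <- keys].

Definition table_value tab B := heaviest ([seq p.2 | p : entry <- tab & p.1.2 \subset B] ++
  [seq [set v] | v <- enum T & v \in B]).

Definition parts tab : seq part :=
  [seq ([set v], [set v]) | v <- enum T] ++ [seq (p.1.2, p.2) | p <- tab].

Definition compatible M ps := all (fun p : part => (p.1 \subset M) &&
  all (fun q : part => (p == q) || ~~ touch p.1 q.1) ps) ps.

Definition parts_union ps := [set v | has (fun p : part => v \in p.2) ps].

Definition component_values tab W ps := [set v | [exists u in W,
  ~~ has (fun p : part => touch (component W u) p.1) ps &&
  (v \in table_value tab (component W u))]].

Definition combine tab W ps := parts_union ps :|: component_values tab W ps.

Definition candidates tab c M :=
  [seq combine tab (M :\: barrier e (vicinity e c M) q.1.1 q.1.2) q.2 |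
    q <- [seq (xd, ps) | xd <- [seq (x, ds) | x <- enum T, ds <- short_seqs 3 (enum T)],
                         ps <- short_seqs 3 (parts tab)] & compatible M q.2].

Definition improve_table tab : seq entry :=
  [seq (p.1, heaviest (candidates tab p.1.1 p.1.2)) | p <- tab].

Definition final_table := iter #|T| improve_table initial_table.

Definition nonnbrs c := ~: nbhd [set c].

Definition solution_through tab c := c |: component_values tab (nonnbrs c) [::].

Definition heaviest_independent := heaviest [seq solution_through final_table c | c <- enum T].

Definition independent S := {in S &, forall x y, ~~ e x y}.

Hypotheses (e_sym : symmetric e) (e_irr : irreflexive e).

Lemma independent0 : independent set0. Proof. by move=> x y; rewrite inE. Qed.

Lemma independent1 v : independent [set v].
Proof. by move=> x y /set1P-> /set1P->; rewrite e_irr. Qed.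

Lemma independentU A B : independent A -> independent B -> ~~ touch A B -> independent (A :|: B).
Proof.
move=> indA indB farAB x y /setUP[xA|xB] /setUP[yA|yB]; [exact: indA | | | exact: indB].
  exact: touchPn_adj farAB xA yB.
by rewrite e_sym; apply: touchPn_adj farAB yA xB.
Qed.

Definition sound_table tab := forall p, p \in tab -> p.2 \subset p.1.2 /\ independent p.2.

Lemma table_value_sound tab B : sound_table tab ->
  table_value tab B \subset B /\ independent (table_value tab B).
Proof.
move=> sound; apply: (@heaviest_ind _ w (fun S => S \subset B /\ independent S)).
  by rewrite sub0set; split=> //; apply: independent0.
move=> S; rewrite mem_cat => /orP[] /mapP[p + ->]; rewrite mem_filter => /andP[sB p_tab].
  by have [s2 ind2] := sound _ p_tab; split=> //; apply: subset_trans s2 sB.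
by rewrite sub1set; split=> //; apply: independent1.
Qed.

Lemma table_value_sub tab B : sound_table tab -> table_value tab B \subset B.
Proof. by move=> sound; have [] := table_value_sound B sound. Qed.

Lemma parts_sound tab p : sound_table tab -> p \in parts tab -> p.2 \subset p.1 /\ independent p.2.
Proof.
move=> sound; rewrite mem_cat => /orP[] /mapP[q q_tab ->] /=; last exact: sound.
by split=> //; apply: independent1.
Qed.

Lemma component_valuesP tab W ps v : reflect (exists u, [/\ u \in W,
    {in ps, forall p, ~~ touch (component W u) p.1} & v \in table_value tab (component W u)])
  (v \in component_values tab W ps).
Proof.
rewrite inE; apply: (iffP exists_inP) => [[u uW /andP[/hasPn far_ps vu]]|[u [uW far_ps vu]]].
  by exists u.
by exists u; rewrite // vu andbT; apply/hasPn.
Qed.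

Lemma component_values_sub tab W ps : sound_table tab -> component_values tab W ps \subset W.
Proof.
move=> sound; apply/subsetP => v /component_valuesP[u [_ _ /(subsetP (table_value_sub _ sound))]].
exact: subsetP (component_sub e W u) v.
Qed.

Lemma component_values_independent tab W ps : sound_table tab ->
  independent (component_values tab W ps).
Proof.
move=> sound x y /component_valuesP[u [_ _ xu]] /component_valuesP[u' [_ _ yu']].
have [eqC|neqC] := eqVneq (component W u) (component W u').
  by rewrite eqC in xu; have [_ ind] := table_value_sound (component W u') sound; apply: ind.
by apply: touchPn_adj (untouched_components e_sym neqC) _ _;
  apply: subsetP (table_value_sub _ sound) _ _.
Qed.

Lemma parts_union_sub tab M ps : sound_table tab -> {subset ps <= parts tab} -> compatible M ps ->
  parts_union ps \subset M.
Proof.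
move=> sound sub_ps /allP comp; apply/subsetP => v; rewrite inE => /hasP[p p_ps vp].
have [s21 _] := parts_sound sound (sub_ps _ p_ps); have /andP[sM _] := comp _ p_ps.
exact: subsetP sM _ (subsetP s21 _ vp).
Qed.

Lemma parts_union_independent tab M ps : sound_table tab -> {subset ps <= parts tab} ->
  compatible M ps -> independent (parts_union ps).
Proof.
move=> sound sub_ps /allP comp x y; rewrite !inE => /hasP[p p_ps xp] /hasP[q q_ps yq].
have [s_p ind_p] := parts_sound sound (sub_ps _ p_ps).
have [s_q _] := parts_sound sound (sub_ps _ q_ps).
have /andP[_ /allP/(_ q q_ps)/orP[/eqP eq_pq|far_pq]] := comp _ p_ps.
  by rewrite -eq_pq in yq; apply: ind_p.
exact: touchPn_adj far_pq (subsetP s_p _ xp) (subsetP s_q _ yq).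
Qed.

Lemma untouched_parts_components tab W ps : sound_table tab -> {subset ps <= parts tab} ->
  ~~ touch (parts_union ps) (component_values tab W ps).
Proof.
move=> sound sub_ps; apply/touchPn => x y; rewrite inE => /hasP[p p_ps xp].
case/component_valuesP=> u [_ far_ps yu]; have [s21 _] := parts_sound sound (sub_ps _ p_ps).
have /touchPn far := far_ps _ p_ps; rewrite eq_sym e_sym far ?(subsetP s21) //.
exact: subsetP (table_value_sub _ sound) _ yu.
Qed.

Lemma combine_sound tab M W ps : sound_table tab -> {subset ps <= parts tab} -> compatible M ps ->
  W \subset M -> combine tab W ps \subset M /\ independent (combine tab W ps).
Proof.
move=> sound sub_ps comp sWM; split.
  rewrite subUset (parts_union_sub sound) //=.
  exact: subset_trans (component_values_sub _ _ sound) sWM.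
apply: independentU (parts_union_independent sound sub_ps comp) _ _.
  exact: component_values_independent.
exact: untouched_parts_components.
Qed.

Lemma improve_table_sound tab : sound_table tab -> sound_table (improve_table tab).
Proof.
move=> sound _ /mapP[p p_tab ->] /=.
apply: (@heaviest_ind _ w (fun S => S \subset p.1.2 /\ independent S)).
  by rewrite sub0set; split=> //; apply: independent0.
move=> S /mapP[q + ->]; rewrite mem_filter => /andP[comp /allpairsP[[xd ps] /= [_ + eq_q]]].
rewrite eq_q /= in comp *; rewrite mem_short_seqs => /andP[_ /allP sub_ps].
by apply: combine_sound => //; apply: subsetDl.
Qed.

Lemma iter_table_sound n : sound_table (iter n improve_table initial_table).
Proof.
elim: n => [|n IH] /=; last exact: improve_table_sound.
by move=> _ /mapP[k _ ->] /=; rewrite sub0set; split=> //; apply: independent0.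
Qed.

Lemma untouched_nonnbrs c S : S \subset nonnbrs c -> ~~ touch [set c] S.
Proof.
move=> /subsetP sS; apply/touchPn => _ y /set1P-> /sS; rewrite inE => /notin_nbhd[yc far_y].
by rewrite eq_sym -in_set1 yc e_sym far_y ?set11.
Qed.

Lemma heaviest_independent_sound : independent heaviest_independent.
Proof.
apply: (@heaviest_ind _ w independent); first exact: independent0.
move=> S /mapP[c _ ->]; have sound := @iter_table_sound #|T|.
apply: independentU; [exact: independent1 | exact: component_values_independent |].
exact: untouched_nonnbrs (component_values_sub _ _ sound).
Qed.

Section Hull.
Variables c x y : T.

Lemma hull_step_mono : {homo hull_step c x y : A B / A \subset B}.
Proof.
move=> A B /subsetP sAB; apply/subsetP => z; rewrite !inE => /or3P[->|->|]; rewrite ?orbT //.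
case/and4P=> -> -> /exists_inP[u /sAB uB zu] /exists_inP[v /sAB vB zv].
rewrite /=; apply/or3P; apply: Or33; apply/andP.
by split; apply/exists_inP; [exists u | exists v].
Qed.

Lemma mem_hull z : (z \in hull c x y) = [|| z == x, z == y | [&& z != c, ~~ e c z,
  [exists u in hull c x y, e z u] & [exists u in hull c x y, ~~ e z u]]].
Proof. by rewrite {1}/hull -fixsetK ?inE //; apply: hull_step_mono. Qed.

Lemma hull_closed z u v : z != c -> ~~ e c z -> u \in hull c x y -> e z u ->
  v \in hull c x y -> ~~ e z v -> z \in hull c x y.
Proof.
move=> zc cz uH zu vH zv; rewrite mem_hull zc cz /=; apply/or3P; apply: Or33; apply/andP.
by split; apply/exists_inP; [exists u | exists v].
Qed.

Lemma hull_l : x \in hull c x y. Proof. by rewrite mem_hull eqxx. Qed.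

Lemma hull_r : y \in hull c x y. Proof. by rewrite mem_hull eqxx orbT. Qed.

Lemma hull_min S : x \in S -> y \in S ->
  (forall z u v, z != c -> ~~ e c z -> u \in S -> e z u -> v \in S -> ~~ e z v -> z \in S) ->
  hull c x y \subset S.
Proof.
move=> xS yS closedS; apply: fixset_sub hull_step_mono _; apply/subsetP => z.
rewrite inE => /or3P[/eqP->//|/eqP->//|].
case/and4P=> zc cz /exists_inP[u uS zu] /exists_inP[v vS zv].
exact: closedS zc cz uS zu vS zv.
Qed.

Lemma connected_hull : e x y -> connected (hull c x y).
Proof.
move=> xy; apply: (connected_by_component e_sym hull_l); have xC := component_self e hull_l.
apply: hull_min => // [|z u v zc cz uC zu vC zv]; first exact: component_closed xC hull_r xy.
have sub_hull := subsetP (component_sub e (hull c x y) x).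
apply: (component_closed uC); last by rewrite e_sym.
exact: hull_closed zc cz (sub_hull _ uC) zu (sub_hull _ vC) zv.
Qed.

Lemma hull_sub_closed B : x \in B -> y \in B -> (forall s, s \notin B -> s \in nbhd B ->
  ~~ e c s -> {in B, forall z, e s z}) -> hull c x y \subset B.
Proof.
move=> xB yB complete; apply: hull_min => // z u v zc cz uB zu vB; apply: contraNT => zB.
by apply: complete => //; apply: adj_nbhd uB zu.
Qed.

End Hull.

Section Completeness.
Variable I : {set T}.
Hypotheses (p5_free : ~~ has_p5 e setT) (indI : independent I)
  (maxI : forall v, v \notin I -> exists2 i, i \in I & e v i).

Notation attached := (attached e I).

Definition hull_triple c x y :=
  [&& c \in I, x \in I, e x y, c != x, c != y, ~~ e c x & ~~ e c y].

Lemma hull_attached c x y : hull_triple c x y -> attached (hull c x y) c.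
Proof.
case/and5P=> cI xI xy cx /and3P[cy ncx ncy].
have far_hull u : u \in hull c x y -> ~~ e c u.
  by rewrite mem_hull => /or3P[/eqP->|/eqP->|/and4P[]].
split=> // [|s sH /nbhdP[sH'|[u uH su]] cs v vH].
- apply/nbhdP => -[|[d /far_hull/negP//]].
  by rewrite mem_hull (negPf cx) (negPf cy) eqxx.
- by rewrite sH' in sH.
apply: contraNT sH => sv; apply: (hull_closed _ cs uH su vH sv).
by apply: contraTneq su => ->; apply: far_hull.
Qed.

Lemma attached_nonadj B c z : attached B c -> z \in B -> z != c /\ ~~ e c z.
Proof.
case=> _ /notin_nbhd[cB far_c] _ zB; split; last exact: far_c.
by apply: contraNneq cB => <-.
Qed.

Lemma hull_grows B c x y p q : attached B c -> hull c x y \subset B -> p \notin hull c x y ->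
  {in hull c x y, forall u, e p u} -> q \in B -> e p q -> {in hull c x y, forall u, ~~ e q u} ->
  p |: hull c x y \subset hull c x p.
Proof.
move=> att sHB pH p_complete qB pq far_q; have [qc cq] := attached_nonadj att qB.
have qH : q \in hull c x p.
  by apply: (hull_closed qc cq (hull_r c x p) _ (hull_l c x p));
    [rewrite e_sym | apply/far_q/hull_l].
rewrite subUset sub1set hull_r; apply/subsetP => m mH.
have [mc cm] := attached_nonadj att (subsetP sHB _ mH).
apply: contraT => mH'; case/negP: mH'; apply: (hull_closed mc cm (hull_r c x p) _ qH).
  by rewrite e_sym p_complete.
by rewrite e_sym far_q.
Qed.

(* The neighbour y is chosen to make the hull largest: a vertex of I outside it would lie beyond a
   complete neighbour p, and p would give a larger hull. *)
Lemma hull_covers_independent B c x : connected B -> attached B c -> x \in B -> x \in I ->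
  1 < #|B| -> exists y, [/\ y \in B, e x y, hull c x y \subset B & I :&: B \subset hull c x y].
Proof.
move=> connB att xB xI B_gt1; have [_ _ complete] := att.
have [y0 /andP[y0B xy0]] : exists y, (y \in B) && e x y.
  have [|||p [q [/set1P-> qB _ xq]]] := connB [set x]; first by rewrite sub1set.
  - by apply/set0Pn; exists x; rewrite inE.
  - by apply: contraTneq B_gt1 => <-; rewrite cards1.
  by exists q; rewrite qB.
case: (@arg_maxnP _ y0 [pred y | (y \in B) && e x y] (fun y => #|hull c x y|)) =>
  [|y /= /andP[yB xy] maxy]; first by rewrite /= y0B.
have sHB : hull c x y \subset B by apply: hull_sub_closed.
exists y; split=> //; apply/subsetP => j; rewrite inE => /andP[jI jB]; apply: contraT => jH.
pose nbrs := [set z in B | [exists u in hull c x y, e z u]].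
have nbr_complete z : z \in nbrs -> z \notin hull c x y -> {in hull c x y, forall u, e z u}.
  rewrite inE => /andP[zB /exists_inP[v vH zv]] zH u uH; apply: contraNT zH => zu.
  by have [zc cz] := attached_nonadj att zB; apply: hull_closed zc cz vH zv uH zu.
have [|||p [q [pA qB + pq]]] := connB (hull c x y :|: nbrs).
- by rewrite subUset sHB; apply/subsetP => z; rewrite inE => /andP[].
- by apply/set0Pn; exists x; rewrite inE hull_l.
- apply: contraTneq jB => eqB; rewrite -eqB in_setU (negPf jH) /=.
  by apply: contraL (indI jI xI) => jN; rewrite negbK; apply: nbr_complete (hull_l c x y).
rewrite in_setU negb_or => /andP[qH]; rewrite inE qB negb_exists_in => /forall_inP far_q.
have pH : p \notin hull c x y by apply: contraL pq => pH; rewrite e_sym; apply: far_q.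
have pN : p \in nbrs by move: pA; rewrite in_setU (negPf pH).
have pB : p \in B by move: pN; rewrite inE => /andP[].
have p_complete := nbr_complete _ pN pH.
have := subset_leq_card (hull_grows att sHB pH p_complete qB pq far_q).
rewrite cardsU1 pH add1n ltnNge maxy //.
by rewrite /= pB e_sym p_complete ?hull_l.
Qed.

Definition correct_upto t tab := forall c x y, hull_triple c x y ->
  exists2 S, (c, hull c x y, S) \in tab &
    #|hull c x y| <= t -> weight (I :&: hull c x y) <= weight S.

Lemma exists_part t tab B c : correct_upto t tab -> connected B -> attached B c -> #|B| <= t ->
  B :&: I != set0 ->
  exists p, [/\ p \in parts tab, p.1 \subset B & weight (I :&: B) <= weight p.2].
Proof.
move=> correct connB att le_Bt /set0Pn[x /setIP[xB xI]]; have [le1|B_gt1] := leqP #|B| 1.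
  exists ([set x], [set x]); split; rewrite ?sub1set //=.
    by rewrite mem_cat; apply/orP; left; apply/mapP; exists x; rewrite ?mem_enum.
  apply: weightS; apply: subset_trans (subsetIr _ _) _.
  by have /eqP-> : [set x] == B by rewrite eqEcard sub1set xB cards1.
have [y [yB xy sHB sIH]] := hull_covers_independent connB att xB xI B_gt1.
have [cI _ _] := att; have [xc cx] := attached_nonadj att xB.
have [yc cy] := attached_nonadj att yB.
have [|S S_tab S_heavy] := correct c x y.
  by rewrite /hull_triple cI xI xy cx cy !(eq_sym c) xc yc.
exists (hull c x y, S); split=> //=.
  by rewrite mem_cat; apply/orP; right; apply/mapP; exists (c, hull c x y, S).
apply: leq_trans (S_heavy _); last exact: leq_trans (subset_leq_card sHB) le_Bt.
by apply: weightS; rewrite subsetI subsetIl.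
Qed.

Lemma table_value_ge tab B p : p \in parts tab -> p.1 \subset B ->
  weight p.2 <= weight (table_value tab B).
Proof.
move=> p_parts sB; apply: heaviest_max; move: p_parts; rewrite !mem_cat.
case/orP=> /mapP[q q_in eq_p]; apply/orP; [right | left]; apply/mapP; exists q; try by rewrite eq_p.
  by rewrite mem_filter q_in andbT -sub1set; move: sB; rewrite eq_p.
by rewrite mem_filter q_in andbT; move: sB; rewrite eq_p.
Qed.

Lemma table_value_correct t tab B c : correct_upto t tab -> connected B -> attached B c ->
  #|B| <= t -> weight (I :&: B) <= weight (table_value tab B).
Proof.
move=> correct connB att le_Bt; have [empty|meetB] := eqVneq (B :&: I) set0.
  by rewrite setIC empty weight0.
have [p [p_parts sB p_heavy]] := exists_part correct connB att le_Bt meetB.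
exact: leq_trans p_heavy (table_value_ge p_parts sB).
Qed.

Lemma parts_union_weight (Bs : seq {set T}) (pf : {set T} -> part) :
  {in Bs &, forall B B', B != B' -> ~~ touch B B'} ->
  {in Bs, forall B, (pf B).2 \subset B /\ weight (I :&: B) <= weight (pf B).2} ->
  weight (I :&: cover [set B in Bs]) <= weight (parts_union [seq pf B | B <- Bs]).
Proof.
move=> farBs heavy; apply: (@weight_cover_le _ _ _ (fun B => (pf B).2)) => [|B].
  by apply/trivIsetP => B B'; rewrite !inE => BBs B'Bs neq; apply/untouched_disjoint/farBs.
rewrite inE => BBs; have [sB heavyB] := heavy _ BBs; split=> //.
by apply/subsetP => v vp; rewrite inE has_map; apply/hasP; exists B.
Qed.

Lemma component_values_weight tab W ps (Z : {set T}) : sound_table tab ->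
  (forall v, v \in Z -> [/\ v \in W, {in ps, forall p, ~~ touch (component W v) p.1} &
    weight (I :&: component W v) <= weight (table_value tab (component W v))]) ->
  weight (I :&: cover [set component W v | v in Z]) <= weight (component_values tab W ps).
Proof.
move=> sound heavy; apply: (@weight_cover_le _ _ _ (table_value tab)) => [|B /imsetP[v vZ ->]].
  apply/trivIsetP => B B' /imsetP[v _ ->] /imsetP[v' _ ->] neq.
  exact: untouched_disjoint (untouched_components e_sym neq).
have [vW far_ps heavy_v] := heavy _ vZ; split=> //; first exact: table_value_sub.
by apply/subsetP => z zv; apply/component_valuesP; exists v.
Qed.

Lemma combine_candidate tab c M x ds ps : size ds <= 3 -> size ps <= 3 ->
  {subset ps <= parts tab} -> compatible M ps ->
  combine tab (M :\: barrier e (vicinity e c M) x ds) ps \in candidates tab c M.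
Proof.
move=> size_ds size_ps sub_ps comp; apply/mapP; exists ((x, ds), ps) => //.
rewrite mem_filter comp; apply/allpairsP; exists ((x, ds), ps).
rewrite mem_short_seqs size_ps; split=> //; last exact/allP.
apply/allpairsP; exists (x, ds); rewrite mem_enum mem_short_seqs size_ds; split=> //.
by apply/allP => d _; rewrite inE mem_enum.
Qed.

Lemma compatible_map M (Bs : seq {set T}) (pf : {set T} -> part) :
  {in Bs &, forall B B', B != B' -> ~~ touch B B'} ->
  {in Bs, forall B, (pf B).1 \subset B /\ B \subset M} -> compatible M [seq pf B | B <- Bs].
Proof.
move=> farBs sub_pf; apply/allP => _ /mapP[B BBs ->]; have [sB sBM] := sub_pf _ BBs.
rewrite (subset_trans sB sBM); apply/allP => _ /mapP[B' B'Bs ->].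
have [->|neqBB'] := eqVneq B B'; first by rewrite eqxx.
apply/orP; right; apply: contra (farBs _ _ BBs B'Bs neqBB'); apply: touchS => //.
by case: (sub_pf B').
Qed.

Lemma good_smaller t c M B : attached M c -> #|M| <= t.+1 -> good e I c M B ->
  [/\ B \subset M, B :&: I != set0, #|B| <= t & exists c', attached B c'].
Proof.
move=> att le_Mt /(goodP att)[sB neqB meetB [c' _ attB]]; split=> //; last by exists c'.
by rewrite -ltnS; apply: leq_trans le_Mt; apply: proper_card; rewrite properEneq neqB.
Qed.

Lemma candidates_correct t tab c M : sound_table tab -> correct_upto t tab -> connected M ->
  attached M c -> 1 < #|M| -> #|M| <= t.+1 -> M :&: I != set0 ->
  weight (I :&: M) <= weight (heaviest (candidates tab c M)).
Proof.
move=> sound correct connM att M_gt1 le_Mt meetM; have [cI _ _] := att.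
have [x [ds [Bs [size_ds size_Bs goodBs farBs cover_I]]]] :=
  split_piece e_sym p5_free indI maxI cI connM att M_gt1 meetM.
set W := M :\: barrier e _ x ds in cover_I.
have small B := good_smaller (B := B) att le_Mt.
have part_of B : exists p, B \in Bs ->
    [/\ p \in parts tab, p.1 \subset B & weight (I :&: B) <= weight p.2].
  have [BBs|_] := boolP (B \in Bs); last by exists (set0, set0).
  have [connB /small[_ meetB le_Bt [c' attB]]] := goodBs B BBs.
  by have [p p_ok] := exists_part correct connB attB le_Bt meetB; exists p.
have [pf pfP] := fin_all_exists part_of; pose ps := [seq pf B | B <- Bs].
have sub_ps : {subset ps <= parts tab} by move=> _ /mapP[B /pfP[pB _ _] ->].
have comp : compatible M ps.
  apply: compatible_map => // B BBs; have [_ sB _] := pfP _ BBs.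
  by have [_ /small[]] := goodBs _ BBs.
have size_ps : size ps <= 3 by rewrite size_map.
apply: leq_trans (heaviest_max w (combine_candidate c x size_ds size_ps sub_ps comp)); rewrite -/W.
rewrite weight_disjointU; last exact/untouched_disjoint/(untouched_parts_components W sound).
rewrite (weightID w (I :&: M) (cover [set B in Bs])); apply: leq_add.
  apply: leq_trans (parts_union_weight farBs _) => [|B BBs].
    by apply: weightS; rewrite setIAC subsetIl.
  have [p_parts sB heavyB] := pfP _ BBs; have [s21 _] := parts_sound sound p_parts.
  by split=> //; apply: subset_trans s21 sB.
pose Z := (I :&: M) :\: cover [set B in Bs].
have ZP v : v \in Z ->
    good e I c M (component W v) /\ {in Bs, forall B, ~~ touch (component W v) B}.
  case/setDP=> /setIP[vI vM] v_out; case: (cover_I v vI vM) => // -[B BBs vB].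
  by case/negP: v_out; apply/bigcupP; exists B; rewrite ?inE.
have ZW v : v \in Z -> v \in W.
  by case/ZP=> /small[_ /set0Pn[j /setIP[/component_root]]].
apply: leq_trans (component_values_weight (Z := Z) sound _) => [|v vZ].
  apply: weightS; apply/subsetP => v vZ; rewrite inE; apply/andP; split.
    by case/setDP: vZ => /setIP[].
  by apply/bigcupP; exists (component W v); [apply: imset_f | apply/component_self/ZW].
have [/small[_ meetC le_Ct [c' attC]] farC] := ZP v vZ; split; first exact: ZW.
  move=> _ /mapP[B BBs ->]; have [_ sB _] := pfP _ BBs.
  by apply: contra (farC _ BBs); apply: touchS.
exact: table_value_correct correct (@connected_component _ _ e_sym _ _) attC le_Ct.
Qed.

Lemma improve_table_correct t tab : sound_table tab -> correct_upto t tab ->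
  correct_upto t.+1 (improve_table tab).
Proof.
move=> sound correct c x y triple; have [S S_tab _] := correct c x y triple.
exists (heaviest (candidates tab c (hull c x y))); first by apply/mapP; exists (c, hull c x y, S).
have /and5P[_ xI xy _ _] := triple; have xH := hull_l c x y.
move=> le_t; apply: (candidates_correct sound correct (@connected_hull c x y xy)) => //.
- exact: hull_attached.
- have neq_xy : x != y by apply: contraTneq xy => ->; rewrite e_irr.
  apply: (@leq_trans #|[set x; y]|); first by rewrite cards2 neq_xy.
  by apply: subset_leq_card; rewrite subUset !sub1set xH hull_r.
by apply/set0Pn; exists x; rewrite inE xH.
Qed.

Lemma iter_table_correct n : correct_upto n (iter n improve_table initial_table).
Proof.
elim: n => [|n IH] /=; last exact: improve_table_correct (@iter_table_sound n) IH.
move=> c x y _; exists set0.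
  apply/mapP; exists (c, hull c x y) => //; apply/mapP; exists ((c, x), y) => //.
  apply/allpairsP; exists ((c, x), y); split=> //=; last by rewrite mem_enum.
  by apply/allpairsP; exists (c, x); split=> //=; rewrite mem_enum.
by rewrite leqn0 cards_eq0 => /eqP eq0; have := hull_l c x y; rewrite eq0 inE.
Qed.

Lemma nonnbrs_component_attached c u : c \in I -> attached (component (nonnbrs c) u) c.
Proof.
move=> cI; have far_c : ~~ touch [set c] (component (nonnbrs c) u).
  by apply: untouched_nonnbrs; apply: component_sub.
split=> // [|s sC /nbhdP[sC'|[d dC sd]] cs].
- by apply: contra far_c => c_nbr; apply/exists_inP; exists c; first exact: set11.
- by rewrite sC' in sC.
case/negP: sC; apply: (component_closed dC); last by rewrite e_sym.
rewrite inE; apply/nbhdP => -[/set1P eq_sc|[z /set1P-> sc]]; last by rewrite e_sym sc in cs.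
by have := touchPn_adj far_c (set11 c) dC; rewrite -eq_sc sd.
Qed.

Lemma heaviest_independent_ge_maximal : weight I <= weight heaviest_independent.
Proof.
have [->|/set0Pn[c cI]] := eqVneq I set0; first by rewrite weight0.
have sound : sound_table final_table := @iter_table_sound #|T|.
apply: (@leq_trans (weight (solution_through final_table c))); last first.
  by apply: heaviest_max; apply/mapP; exists c; rewrite ?mem_enum.
rewrite weight_disjointU; last first.
  exact/untouched_disjoint/untouched_nonnbrs/(component_values_sub _ _ sound).
rewrite (weightID w I [set c]); apply: leq_add; first exact: weightS (subsetIr _ _).
have far_I v : v \in I :\ c -> v \in nonnbrs c.
  case/setD1P=> vc vI; rewrite inE; apply/nbhdP => -[/set1P/eqP|[d /set1P->]].
    by rewrite (negPf vc).
  by rewrite (negPf (indI vI cI)).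
apply: leq_trans (component_values_weight (ps := [::]) (Z := I :\ c) sound _) => [|v /far_I vN].
  apply: weightS; apply/subsetP => v vI; rewrite inE; apply/andP; split; first by case/setD1P: vI.
  by apply/bigcupP; exists (component (nonnbrs c) v); [apply: imset_f | apply/component_self/far_I].
split=> //.
apply: table_value_correct (@iter_table_correct #|T|) (@connected_component _ _ e_sym _ _) _ _.
  exact: nonnbrs_component_attached.
exact: max_card.
Qed.

End Completeness.

Lemma independent_extend J : independent J -> exists I : {set T}, [/\ J \subset I, independent I &
  forall v, v \notin I -> exists2 i, i \in I & e v i].
Proof.
move=> indJ; pose ext (S : {set T}) := (J \subset S) && [forall x in S, forall y in S, ~~ e x y].
have extP S : reflect (J \subset S /\ independent S) (ext S).
  apply: (iffP andP) => -[sJ ind]; split=> //.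
    by move=> x y xS; apply/forall_inP: y; apply: (forall_inP ind).
  by apply/forall_inP => x xS; apply/forall_inP => y; apply: ind.
have extJ : ext J by apply/extP.
case: (arg_maxnP (fun S : {set T} => #|S|) extJ) => I /extP[sJ indI] maxI.
exists I; split=> // v vI; apply/exists_inP; apply: contraT.
rewrite negb_exists_in => /forall_inP far_v.
suff /maxI : ext (v |: I) by rewrite /= cardsU1 vI add1n ltnn.
apply/extP; split; first exact: subset_trans sJ (subsetUr _ _).
apply: independentU; [exact: independent1 | exact: indI |].
apply/touchPn => _ y /set1P-> yI; rewrite far_v // andbT.
by apply: contraNneq vI => ->.
Qed.

Theorem heaviest_independent_ge J : ~~ has_p5 e setT -> independent J ->
  weight J <= weight heaviest_independent.
Proof.
move=> p5_free /independent_extend[I [sJI indI maxI]].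
exact: leq_trans (weightS w sJI) (heaviest_independent_ge_maximal p5_free indI maxI).
Qed.

End HeaviestIndependentSet.

(** * The graph of touching pieces *)

Lemma induced_p5_uniq (T : finType) (e : rel T) a b c d f : symmetric e -> irreflexive e ->
  induced_p5 e a b c d f -> uniq [:: a; b; c; d; f].
Proof.
move=> e_sym e_irr /and5P[ab bc cd df /and5P[ac ad af bd /andP[bf cf]]].
have neq x y z : ~~ e x z -> e y z -> x != y by move=> xz; apply: contraTneq => <-.
have neq_adj x y : e x y -> x != y by move=> xy; apply: contraTneq xy => ->; rewrite e_irr.
have neq_cf : c != f by rewrite eq_sym; apply: (neq f c b); rewrite e_sym.
rewrite /= !inE !negb_or (neq_adj a b) // (neq_adj b c) // (neq_adj c d) // (neq_adj d f) //.
rewrite (neq a c d) // (neq a d f) // (neq a f d) ?(e_sym f) // (neq b d f) //.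
by rewrite (neq b f d) ?(e_sym f) // neq_cf.
Qed.

Section TouchGraph.
Variables (T : finType) (e : rel T).
Hypothesis e_sym : symmetric e.
Implicit Types (A B C X : {set T}).

Notation connected := (connected e).
Notation touch := (touch e).

Lemma pendant_edge A B C : connected A -> connected B -> touch A B -> ~~ touch A C -> touch B C ->
  exists b x, [/\ b \in A :|: B, x \in B, e b x, exists2 d, d \in C & e x d &
    {in C, forall d, ~~ e b d}].
Proof.
move=> connA connB touchAB farAC /exists_inP[z zB zC].
have farA a : a \in A -> a \notin nbhd e C.
  by move=> aA; apply: contra farAC => aC; apply/exists_inP; exists a.
have [a aA _] := exists_inP touchAB; pose far := (A :|: B) :\: nbhd e C.
have connU : connected (A :|: B) by apply: connectedU_touch.
have [|||b [x [bO xU xO bx]]] := connU far.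
- exact: subsetDl.
- by apply/set0Pn; exists a; rewrite in_setD farA // inE aA.
- apply: contraTneq zC => eqU; have : z \in far by rewrite eqU inE zB orbT.
  by case/setDP.
have xC : x \in nbhd e C by move: xO; rewrite in_setD xU andbT negbK.
have [bU /notin_nbhd[_ far_b]] := setDP bO.
exists b, x; split=> //; first by case/setUP: xU => // /farA; rewrite xC.
by case/nbhdP: xC => // /far_b; rewrite bx.
Qed.

Lemma has_p5_touching_path B1 B2 B3 B4 B5 :
  [/\ connected B1, connected B2, connected B3, connected B4 & connected B5] ->
  [/\ touch B1 B2, touch B2 B3, touch B3 B4 & touch B4 B5] ->
  [/\ ~~ touch B1 B3, ~~ touch B1 B4 & ~~ touch B1 B5] ->
  [/\ ~~ touch B2 B4, ~~ touch B2 B5 & ~~ touch B3 B5] ->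
  has_p5 e (B1 :|: B2 :|: B3 :|: B4 :|: B5).
Proof.
move=> [conn1 conn2 conn3 conn4 conn5] [t12 t23 t34 t45] [far13 far14 far15] [far24 far25 far35].
rewrite (touchC e_sym) in t34; rewrite (touchC e_sym) in t45; rewrite (touchC e_sym) in far35.
have [b [x [bU xB bx xd far_b]]] := pendant_edge conn1 conn2 t12 far13 t23.
have [b' [y [b'U yB b'y yd far_b']]] := pendant_edge conn5 conn4 t45 far35 t34.
have far_ends u v : u \in B1 :|: B2 -> v \in B5 :|: B4 -> ~~ e u v.
  case/setUP=> uB /setUP[] vB.
  - exact: touchPn_adj far15 uB vB.
  - exact: touchPn_adj far14 uB vB.
  - exact: touchPn_adj far25 uB vB.
  exact: touchPn_adj far24 uB vB.
have xU : x \in B1 :|: B2 by rewrite inE xB orbT.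
have yU : y \in B5 :|: B4 by rewrite inE yB orbT.
apply: has_p5S (has_p5_two_pendants e_sym conn3 xd yd (far_ends _ _ xU yU) bx b'y far_b far_b'
  (far_ends _ _ bU yU) _ (far_ends _ _ bU b'U)); last by rewrite e_sym; apply: far_ends.
have memU z : [|| z \in B1 :|: B2, z \in B3 | z \in B5 :|: B4] ->
    z \in B1 :|: B2 :|: B3 :|: B4 :|: B5.
  by rewrite !inE; case/or3P=> [/orP[]->|->|/orP[]->]; rewrite ?orbT.
rewrite !subUset !sub1set !memU ?xU ?yU ?bU ?b'U ?orbT // !andbT.
by apply/subsetP => z zB; apply: memU; rewrite zB orbT.
Qed.

Variables (w : T -> nat) (cs : seq {set T}).

Definition touch_rel : rel 'I_(size cs) :=
  fun i j => (i != j) && touch (nth set0 cs i) (nth set0 cs j).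
Definition touch_weight (i : 'I_(size cs)) := weight w (nth set0 cs i).
Definition heaviest_union :=
  [set v | [exists i in heaviest_independent touch_rel touch_weight, v \in nth set0 cs i]].

Lemma touch_rel_sym : symmetric touch_rel.
Proof. by move=> i j; rewrite /touch_rel eq_sym touchC. Qed.

Lemma touch_rel_irr : irreflexive touch_rel.
Proof. by move=> i; rewrite /touch_rel eqxx. Qed.

Lemma touch_rel_p5_free X : ~~ has_p5 e X ->
  {in cs, forall B, connected B /\ B \subset X} -> ~~ has_p5 touch_rel setT.
Proof.
move=> no_p5 csP; apply: contra no_p5 => /has_p5P[i1 [i2 [i3 [i4 [i5 [_ path]]]]]].
have := induced_p5_uniq touch_rel_sym touch_rel_irr path.
rewrite /= !inE !negb_or => /and4P[/and4P[_ neq13 neq14 neq15] /and3P[_ neq24 neq25]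
  /andP[_ neq35] _].
have memP (i : 'I_(size cs)) : connected (nth set0 cs i) /\ nth set0 cs i \subset X.
  by apply: csP; apply: mem_nth.
have touching i j : touch_rel i j -> touch (nth set0 cs i) (nth set0 cs j) by case/andP.
have far i j : i != j -> ~~ touch_rel i j -> ~~ touch (nth set0 cs i) (nth set0 cs j).
  by rewrite /touch_rel => ->.
move: path => /and5P[t12 t23 t34 t45 /and5P[n13 n14 n15 n24 /andP[n25 n35]]].
apply: has_p5S (@has_p5_touching_path (nth set0 cs i1) (nth set0 cs i2) (nth set0 cs i3)
  (nth set0 cs i4) (nth set0 cs i5) _ _ _ _).
- by rewrite !subUset !(proj2 (memP _)).
- by split; apply: proj1 (memP _).
- by split; apply: touching.
- by split; apply: far.
by split; apply: far.
Qed.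

Lemma heaviest_union_separated i j : i \in heaviest_independent touch_rel touch_weight ->
  j \in heaviest_independent touch_rel touch_weight -> i != j ->
  ~~ touch (nth set0 cs i) (nth set0 cs j).
Proof.
move=> iM jM neq_ij; have := heaviest_independent_sound touch_rel_sym touch_rel_irr iM jM.
by rewrite /touch_rel neq_ij.
Qed.

Lemma heaviest_union_ge (K : finType) (P : {set K}) (q : K -> {set T}) X : ~~ has_p5 e X ->
  {in cs, forall B, connected B /\ B \subset X} -> {in P, forall a, q a \in cs} ->
  {in P &, forall a b, a != b -> ~~ touch (q a) (q b)} ->
  \sum_(a in P) weight w (q a) <= weight w heaviest_union.
Proof.
move=> no_p5 csP q_cs q_far.
pose J := [set i : 'I_(size cs) | [exists a in P, i == index (q a) cs :> nat]].
have JP i : i \in J -> exists2 a, a \in P & i = index (q a) cs :> nat.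
  by rewrite inE => /exists_inP[a aP /eqP]; exists a.
have nth_J a : a \in P -> nth set0 cs (index (q a) cs) = q a by move=> /q_cs; apply: nth_index.
have indJ : independent touch_rel J.
  move=> i i' /JP[a aP eq_i] /JP[b bP eq_i']; rewrite /touch_rel eq_i eq_i' !nth_J //.
  have [eq_ab|neq_ab] := eqVneq a b; last by rewrite negb_and q_far ?orbT.
  by rewrite negb_and negbK; apply/orP; left; apply/eqP/val_inj; rewrite /= eq_i eq_i' eq_ab.
apply: (@leq_trans (weight touch_weight J)).
  apply: leq_trans (weight_bigcup_le w J (fun i => nth set0 cs i)).
  apply: weight_bigcup_disjoint => [a b aP bP neq_ab|a aP]; first exact/untouched_disjoint/q_far.
  have lt_i : index (q a) cs < size cs by rewrite index_mem q_cs.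
  have iJ : Ordinal lt_i \in J by rewrite inE; apply/exists_inP; exists a.
  by rewrite -(nth_J a aP); apply: (bigcup_sup _ iJ).
have := heaviest_independent_ge touch_weight touch_rel_sym touch_rel_irr
  (touch_rel_p5_free no_p5 csP) indJ.
move=> /leq_trans; apply; apply: weight_bigcup_disjoint => [i j iM jM neq_ij|i iM].
  exact/untouched_disjoint/heaviest_union_separated.
by apply/subsetP => v vi; rewrite inE; apply/exists_inP; exists i.
Qed.

End TouchGraph.

Arguments touch_rel {T} e cs _ _.
Arguments touch_weight {T} w cs _.

(** * The recursive algorithm *)

Section Algorithm.
Variables (T : finType) (e : rel T) (w : T -> nat) (k r N1 N2 : nat).
Implicit Types (A B D H R S X : {set T}) (L cs : seq {set T}) (s : seq (T * nat)).

Notation guess := (seq (T * nat) * seq (T * nat))%type.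
Implicit Types g : guess.

Notation connected := (connected e).
Notation component := (component e).
Notation touch := (touch e).
Notation nbhd := (nbhd e).
Notation list_colouring := (list_colouring e).

Definition support L := [set v | has (fun A : {set T} => v \in A) L].
Definition restrict L R := [seq A :&: R | A : {set T} <- L].

Definition guessed s := [set v | has (fun p => p.1 == v) s].
Definition guessed_class s c := [set v | has (fun p => (p.1 == v) && (p.2 == c)) s].

(* A guess g colours a dominating set, by the pairs in g.1, and its enlargement, by the pairs in
   g.1 and g.2. *)
Definition dominators g := guessed g.1.
Definition precoloured g := guessed (g.1 ++ g.2).

Definition consistent L g :=
  all (fun p => [&& p.1 \in nth set0 L p.2, p.1 \in nbhd (dominators g) &
    all (fun q => (p.2 == q.2) ==> ~~ e p.1 q.1) (g.1 ++ g.2)]) (g.1 ++ g.2).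

Definition allowed L g c :=
  pruned e r (nth set0 L c) (dominators g) (guessed_class (g.1 ++ g.2) c) (precoloured g).

Definition trace_lists L g X :=
  [seq [set u in allowed L g c | trace e (dominators g) u == X] | c <- iota 0 k].

Definition trace_solutions (solver : seq {set T} -> {set T}) L g :=
  [set u | [exists v, (trace e (dominators g) v != set0) &&
    (u \in solver (trace_lists L g (trace e (dominators g) v)))]].

Definition dominated_solution solver L g :=
  if consistent L g then precoloured g :|: trace_solutions solver L g else set0.

Definition interior L D :=
  [set v in support L :&: nbhd D | [forall u in support L :\: nbhd D, ~~ e u v]].

Definition interior_solution solver L g :=
  dominated_solution solver (restrict L (interior L (dominators g))) g.

Definition outside D := ~: nbhd D.

Definition coloured_elements := [seq (v, c) | v <- enum T, c <- iota 0 k].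

Definition guesses : seq guess :=
  [seq (s1, s2) | s1 <- short_seqs N1 coloured_elements, s2 <- short_seqs N2 coloured_elements].

Definition connectedb D := [forall x in D, D \subset component D x].

Definition pieces solver L := [seq interior_solution solver L g | g <- guesses &
  [&& dominators g != set0, connectedb (dominators g) &
    consistent (restrict L (interior L (dominators g))) g]].

Definition split_solution solver L g := interior_solution solver L g :|:
  heaviest_union e w (pieces solver (restrict L (outside (dominators g)))).

(* A solution is either dominated by a bounded set, or splits into boundedly many components with
   a dominating set D and a part outside N[D], where the graph is P5-free; there the components
   are chosen by an independent set of maximum weight in the graph of candidate pieces. The
   parameter j bounds the number of colours with a nonempty list. *)
Fixpoint solve j L := if j is j'.+1 then
  heaviest w ([seq dominated_solution (solve j') L g | g <- guesses] ++
    [seq split_solution (solve j') L g | g <- guesses])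
  else set0.

Hypothesis e_sym : symmetric e.

Definition list_colourable L S := exists col, list_colouring L col S.

Lemma nth_restrict L R c : nth set0 (restrict L R) c = nth set0 L c :&: R.
Proof.
have [lt_c|le_c] := ltnP c (size L); first by rewrite (nth_map set0).
by rewrite !nth_default ?size_map // set0I.
Qed.

Lemma restrict_sub L R c : nth set0 (restrict L R) c \subset nth set0 L c.
Proof. by rewrite nth_restrict subsetIl. Qed.

Lemma mem_support L c v : v \in nth set0 L c -> v \in support L.
Proof.
have [lt_c|le_c] := ltnP c (size L) => vL; last by rewrite nth_default // inE in vL.
by rewrite inE; apply/hasP; exists (nth set0 L c) => //; apply: mem_nth.
Qed.

Lemma support_restrict L R : support (restrict L R) \subset R.
Proof. by apply/subsetP => v; rewrite inE => /hasP[_ /mapP[A _ ->]] /setIP[]. Qed.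

Lemma list_colouring_support L col S : list_colouring L col S -> S \subset support L.
Proof. by move=> [in_list _]; apply/subsetP => x /in_list/mem_support. Qed.

Lemma list_colouring_lists L L' col S : (forall c, nth set0 L c \subset nth set0 L' c) ->
  list_colouring L col S -> list_colouring L' col S.
Proof. by move=> sL [in_list proper]; split=> // x /in_list; apply: subsetP (sL _) _. Qed.

Lemma list_colouring_restrict L R col S :
  list_colouring L col S -> S \subset R -> list_colouring (restrict L R) col S.
Proof.
move=> [in_list proper] /subsetP sR; split=> // x xS.
by rewrite nth_restrict inE in_list ?sR.
Qed.

Lemma list_colouringS L col S S' :
  S' \subset S -> list_colouring L col S -> list_colouring L col S'.
Proof.
move=> /subsetP sS [in_list proper]; split=> [x /sS/in_list //|x y /sS xS /sS].
exact: proper.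
Qed.

Lemma list_colourable0 L : list_colourable L set0.
Proof. by exists (fun=> 0); split=> x; rewrite inE. Qed.

Lemma list_colourable_restrict L R S : list_colourable (restrict L R) S -> list_colourable L S.
Proof. by case=> col lists; exists col; apply: list_colouring_lists (restrict_sub L R) lists. Qed.

Lemma list_colourable_support L S : list_colourable L S -> S \subset support L.
Proof. by case=> col; apply: list_colouring_support. Qed.

Lemma list_colourable_restrict_sub L R S : list_colourable (restrict L R) S -> S \subset R.
Proof. by move=> /list_colourable_support sS; apply: subset_trans sS (support_restrict L R). Qed.

Lemma list_colourableU L A B : list_colourable L A -> list_colourable L B -> ~~ touch A B ->
  list_colourable L (A :|: B).
Proof.
move=> [colA [listA properA]] [colB [listB properB]] farAB.
have far x y : x \in A -> y \in B -> ~~ e x y := touchPn_adj farAB.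
have notinA x : x \in B -> x \notin A.
  by move=> xB; apply: contraTN xB => xA; rewrite (disjointFr (untouched_disjoint farAB)).
exists (fun v => if v \in A then colA v else colB v); split=> [x|x y].
  by rewrite inE; case: ifP => [/listA //|_ /= /listB].
case/setUP=> [xA|xB] /setUP[yA|yB]; rewrite ?xA ?yA ?(negPf (notinA _ xB)) ?(negPf (notinA _ yB)).
- exact: properA.
- by rewrite (negPf (far _ _ xA yB)).
- by rewrite e_sym (negPf (far _ _ yA xB)).
exact: properB.
Qed.

Lemma guessedP s v : reflect (exists c, (v, c) \in s) (v \in guessed s).
Proof.
rewrite inE; apply: (iffP hasP) => [[[u c] us /eqP /= <-]|[c vc]]; first by exists c.
by exists (v, c) => /=.
Qed.

Lemma mem_guessed_class s v c : (v \in guessed_class s c) = ((v, c) \in s).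
Proof.
rewrite inE; apply/hasP/idP => [[[u d] us /andP[/eqP /= <- /eqP <-]] //|vs].
by exists (v, c); rewrite /= ?eqxx.
Qed.

Lemma nth_trace_lists L g X c : nth set0 (trace_lists L g X) c =
  if c < k then [set u in allowed L g c | trace e (dominators g) u == X] else set0.
Proof.
case: ifP => [lt_c|/negbT]; first by rewrite (nth_map 0) ?size_iota // nth_iota.
by rewrite -leqNgt => le_c; rewrite nth_default ?size_map ?size_iota.
Qed.

Lemma mem_trace_lists L g X c u : u \in nth set0 (trace_lists L g X) c ->
  u \in allowed L g c /\ trace e (dominators g) u = X.
Proof. by rewrite nth_trace_lists; case: ifP => _; rewrite ?in_set0 // => /setIdP[? /eqP]. Qed.

Lemma consistent_list L g v c : consistent L g -> (v, c) \in g.1 ++ g.2 ->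
  v \in nth set0 L c /\ v \in nbhd (dominators g).
Proof. by move=> /allP cons /cons /and3P[]. Qed.

Lemma consistent_nonadj L g u v c :
  consistent L g -> (u, c) \in g.1 ++ g.2 -> (v, c) \in g.1 ++ g.2 -> ~~ e u v.
Proof. by move=> /allP cons /cons /and3P[_ _ /allP far] /far; rewrite eqxx. Qed.

Lemma allowed_sub L g c : allowed L g c \subset nth set0 L c :\: precoloured g.
Proof. exact: pruned_sub. Qed.

Lemma dominators_precoloured g : dominators g \subset precoloured g.
Proof. by apply/subsetP => v /guessedP[c vc]; apply/guessedP; exists c; rewrite mem_cat vc. Qed.

Section Soundness.
Variable solver : seq {set T} -> {set T}.
Hypothesis solver_sound : forall L, list_colourable L (solver L).

Lemma solver_trace L g X u :
  u \in solver (trace_lists L g X) -> trace e (dominators g) u = X.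
Proof.
have [col [in_list _]] := solver_sound (trace_lists L g X).
by move=> /in_list/mem_trace_lists[].
Qed.

Lemma trace_solutionsP L g u : u \in trace_solutions solver L g ->
  trace e (dominators g) u != set0 /\
  u \in solver (trace_lists L g (trace e (dominators g) u)).
Proof.
by rewrite inE => /existsP[v /andP[tr_v u_sol]]; rewrite (solver_trace u_sol).
Qed.

Lemma dominated_solution_sub_nbhd L g :
  dominated_solution solver L g \subset nbhd (dominators g).
Proof.
rewrite /dominated_solution; case: ifP => [cons|_]; last exact: sub0set.
rewrite subUset; apply/andP; split; apply/subsetP => u.
  by case/guessedP=> c uc; case: (consistent_list cons uc).
case/trace_solutionsP=> /set0Pn[d]; rewrite inE => /andP[dD ud] _.
by apply/nbhdP; right; exists d.
Qed.

Lemma sub_dominated_solution L g :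
  consistent L g -> dominators g \subset dominated_solution solver L g.
Proof.
move=> cons; rewrite /dominated_solution cons.
exact: subset_trans (dominators_precoloured g) (subsetUl _ _).
Qed.

Lemma dominated_solution_colourable L g : list_colourable L (dominated_solution solver L g).
Proof.
rewrite /dominated_solution; case: ifP => [cons|_]; last exact: list_colourable0.
pose D := precoloured g; pose tr := trace e (dominators g).
have [colD colDP] : exists colD, {in D, forall u, (u, colD u) \in g.1 ++ g.2}.
  suff colP u : exists c, u \in D -> (u, c) \in g.1 ++ g.2.
    by have [f fP] := fin_all_exists colP; exists f => u; apply: fP.
  by have [/guessedP[c uc]|_] := boolP (u \in D); [exists c | exists 0].
have [colX colXP] := fin_all_exists (fun X => solver_sound (trace_lists L g X)).
pose col u := if u \in D then colD u else colX (tr u) u.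
have outD u : u \in D :|: trace_solutions solver L g -> u \notin D ->
    u \in solver (trace_lists L g (tr u)) /\ u \in allowed L g (col u).
  rewrite inE /col => /orP[->//|/trace_solutionsP[_ u_sol] /negPf->]; split=> //.
  by have [in_list _] := colXP (tr u); case: (mem_trace_lists (in_list u u_sol)).
have far u v : u \in D -> v \in allowed L g (col u) -> ~~ e v u.
  rewrite /col => uD v_allowed; apply: (pruned_far v_allowed).
  by rewrite uD mem_guessed_class colDP.
exists col; split=> [x xS|x y xS yS xy]; have [xD|xD] := boolP (x \in D).
- by rewrite /col xD; case: (consistent_list cons (colDP x xD)).
- by have [_ /(subsetP (allowed_sub _ _ _))/setDP[]] := outD x xS xD.
- have [yD|yD] := boolP (y \in D); apply: contraTneq xy => eq_col.
    apply: (consistent_nonadj cons (colDP x xD)).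
    by move: eq_col; rewrite /col xD yD => ->; apply: colDP.
  by rewrite e_sym; apply: far => //; rewrite eq_col; case: (outD y yS yD).
have [yD|yD] := boolP (y \in D); last have [y_sol y_allowed] := outD y yS yD.
  by apply: contraTneq xy => eq_col; apply: far => //; rewrite -eq_col; case: (outD x xS xD).
have [x_sol x_allowed] := outD x xS xD; apply/eqP => eq_col; rewrite -eq_col in y_allowed.
have eq_tr : tr x = tr y := pruned_adj_trace e_sym x_allowed y_allowed xy.
have [_ /(_ x y)] := colXP (tr y); rewrite -eq_tr => /(_ x_sol); rewrite eq_tr => /(_ y_sol xy).
by move: eq_col; rewrite /col (negPf xD) (negPf yD) eq_tr => /eqP ->.
Qed.

Lemma interior_solution_sub L g : interior_solution solver L g \subset interior L (dominators g).
Proof. exact: list_colourable_restrict_sub (dominated_solution_colourable _ _). Qed.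

Lemma pieces_sound L S : S \in pieces solver L ->
  [/\ list_colourable L S, connected S & S \subset support L].
Proof.
case/mapP=> g; rewrite mem_filter => /andP[/and3P[D_neq0 connD cons] _] ->.
have colourable : list_colourable L (interior_solution solver L g).
  exact: list_colourable_restrict (dominated_solution_colourable _ _).
split=> //; last exact: list_colourable_support colourable.
have {}connD : connected (dominators g).
  have [x xD] := set0Pn _ D_neq0; apply: (connected_by_component e_sym xD).
  exact: (forall_inP connD).
apply: connected_extend connD D_neq0 (sub_dominated_solution cons) _ => //.
exact: dominated_solution_sub_nbhd.
Qed.

Lemma heaviest_union_colourable L cs :
  {in cs, forall S, list_colourable L S} -> list_colourable L (heaviest_union e w cs).
Proof.
move=> colourable; set M := heaviest_independent (touch_rel e cs) (touch_weight w cs).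
have [colB colBP] := fin_all_exists
  (fun i : 'I_(size cs) => colourable _ (mem_nth set0 (ltn_ord i))).
have [B BP] : exists B : T -> option 'I_(size cs), {in heaviest_union e w cs, forall v,
    exists i, [/\ B v = Some i, i \in M & v \in nth set0 cs i]}.
  suff BP v : exists o : option 'I_(size cs), v \in heaviest_union e w cs ->
      exists i, [/\ o = Some i, i \in M & v \in nth set0 cs i].
    by have [f fP] := fin_all_exists BP; exists f => v; apply: fP.
  have [|_] := boolP (v \in _); last by exists None.
  by rewrite inE => /exists_inP[i iM vi]; exists (Some i) => _; exists i.
exists (fun v => if B v is Some i then colB i v else 0); split=> [v /BP[i [-> iM vi]]|x y].
  by have [in_list _] := colBP i; apply: in_list.
move=> /BP[i [-> iM xi]] /BP[i' [-> i'M yi']] xy.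
have [eq_i|neq_i] := eqVneq i i'.
  by rewrite -eq_i in yi' *; have [_ proper] := colBP i; apply: proper.
by have := touchPn_adj (heaviest_union_separated e_sym iM i'M neq_i) xi yi'; rewrite xy.
Qed.

Lemma interior_far L D A B : A \subset interior L D -> B \subset support L :\: nbhd D ->
  ~~ touch A B.
Proof.
move=> sA sB; apply/touchPn => x y /(subsetP sA) x_int /(subsetP sB) y_out.
move: x_int; rewrite in_set => /andP[/setIP[_ xD] /forall_inP/(_ y y_out)].
rewrite e_sym => ->; rewrite andbT; case/setDP: y_out => _.
by apply: contraNneq => <-.
Qed.

Lemma split_solution_far L g : ~~ touch (interior_solution solver L g)
  (heaviest_union e w (pieces solver (restrict L (outside (dominators g))))).
Proof.
set U := heaviest_union _ _ _; have colU : list_colourable (restrict L (outside (dominators g))) U.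
  by apply: heaviest_union_colourable => S /pieces_sound[].
apply: interior_far (interior_solution_sub L g) _; rewrite setDE subsetI.
rewrite (list_colourable_restrict_sub colU) andbT.
exact: list_colourable_support (list_colourable_restrict colU).
Qed.

Lemma split_solution_colourable L g : list_colourable L (split_solution solver L g).
Proof.
apply: list_colourableU (split_solution_far L g).
  exact: list_colourable_restrict (dominated_solution_colourable _ _).
apply: (list_colourable_restrict (R := outside (dominators g))).
by apply: heaviest_union_colourable => S /pieces_sound[].
Qed.

End Soundness.

Lemma solve_colourable j L : list_colourable L (solve j L).
Proof.
elim: j L => [|j sound] L /=; first exact: list_colourable0.
apply: heaviest_ind => [|S]; first exact: list_colourable0.
rewrite mem_cat => /orP[] /mapP[g _ ->]; first exact: dominated_solution_colourable.
exact: split_solution_colourable.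
Qed.

End Algorithm.

Section Dominators.
Variables (T : finType) (e : rel T).
Hypothesis e_sym : symmetric e.
Implicit Types (C D H J : {set T}).

Definition components H := [set component e H u | u in H].

Lemma components_eq H C x : C \in components H -> x \in C -> C = component e H x.
Proof. by case/imsetP=> u _ -> xC; rewrite (component_mem e_sym xC). Qed.

Lemma components_sub H C : C \in components H -> C \subset H.
Proof. by case/imsetP=> u _ ->; apply: component_sub. Qed.

Lemma components_connected H C : C \in components H -> connected e C.
Proof. by case/imsetP=> u _ ->; apply: connected_component. Qed.

Lemma components_neq0 H C : C \in components H -> C != set0.
Proof. by case/imsetP=> u uH ->; apply/set0Pn; exists u; apply: component_self. Qed.

Lemma components_untouched H :
  {in components H &, forall C C', C != C' -> ~~ touch e C C'}.
Proof. by move=> _ _ /imsetP[u _ ->] /imsetP[v _ ->]; apply: untouched_components. Qed.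

Lemma sub_cover_components H : H \subset cover (components H).
Proof.
apply/subsetP => x xH; apply/bigcupP; exists (component e H x); first exact: imset_f.
exact: component_self.
Qed.

Lemma p5_dominating_set r col k H : P5rK1_free e r -> proper_colouring e col k H -> has_p5 e H ->
  exists D, [/\ D \subset H, H \subset nbhd e D & #|D| <= 5 + k * r].
Proof.
move=> free proper /has_p5P[a [b [c [d [f [/and5P[aH bH cH dH fH] path]]]]]].
pose K := [set x in [:: a; b; c; d; f]]; pose R := H :\: nbhd e K.
have sKH : K \subset H.
  have /allP inH : all [in H] [:: a; b; c; d; f] by rewrite /= aH bH cH dH fH.
  by apply/subsetP => x; rewrite inE => /inH.
have sRH : R \subset H := subsetDl _ _.
have card_class c0 : #|colour_class col R c0| <= r.
  rewrite leqNgt; apply/negP => lt_c; pose J := take_set r (colour_class col R c0).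
  have JP x : x \in J -> [/\ x \in H, x \notin nbhd e K & col x = c0].
    by move=> /(subsetP (take_set_sub _ _)); rewrite mem_colour_class => /andP[/setDP[? ?] /eqP].
  have K_far z : z \in K -> z \in far_from e J.
    by move=> zK; apply/far_fromP => x /JP[_ /notin_nbhd[_ far_x] _]; apply: far_x.
  have /negP[] : ~~ has_p5 e (far_from e J).
    apply: free; first by rewrite card_take_set; apply/minn_idPl/ltnW.
    move=> x y /JP[xH _ xc] /JP[yH _ yc].
    by apply: proper_colouring_nonadj proper xH yH _; rewrite xc yc.
  apply/has_p5P; exists a, b, c, d, f; split=> //; apply/and5P.
  by split; apply: K_far; rewrite !inE eqxx ?orbT.
exists (K :|: R); split; first by rewrite subUset sKH.
  apply/subsetP => h hH; have [hK|hK] := boolP (h \in nbhd e K).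
    exact: subsetP (nbhdS e (subsetUl K R)) _ hK.
  by apply: (subsetP (sub_nbhd e (K :|: R))); rewrite in_setU in_setD hK hH orbT.
apply: leq_trans (leq_cardsU _ _) (leq_add _ _).
  by rewrite cardsE; apply: card_size.
have [lt_col _] := proper_colouringS sRH proper.
have sR : R \subset \bigcup_(i in [set: 'I_k]) colour_class col R i.
  apply/subsetP => x xR; apply/bigcupP; exists (Ordinal (lt_col x xR)) => //.
  by rewrite mem_colour_class xR eqxx.
apply: leq_trans (subset_leq_card sR) (leq_trans (leq_card_bigcup (m := r) _) _) => [i _|].
  exact: card_class.
by rewrite cardsT card_ord.
Qed.

Lemma components_dominating_set col k H : proper_colouring e col k H -> ~~ has_p5 e H ->
  exists D, [/\ D \subset H, H \subset nbhd e D & #|D| <= #|components H| * (1 + 2 * (k * k))].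
Proof.
move=> proper no_p5.
have domP C : exists D, C \in components H ->
    [/\ D \subset C, C \subset nbhd e D & #|D| <= 1 + 2 * (k * k)].
  have [CH|_] := boolP (C \in components H); last by exists set0.
  have [u uC] := set0Pn _ (components_neq0 CH); have sCH := components_sub CH.
  have [||||D [sDC _ _ domD card_D]] := @connected_dominating_set _ _ e_sym col k C u.
  - exact: components_connected CH.
  - exact: uC.
  - exact: proper_colouringS sCH proper.
  - exact: (contra (has_p5S sCH)).
  by exists D.
have [dom {}domP] := fin_all_exists domP; exists (\bigcup_(C in components H) dom C); split.
- by apply/bigcupsP => C CH; have [sD _ _] := domP C CH; apply: subset_trans sD (components_sub CH).
- apply/subsetP => h /(subsetP (sub_cover_components H))/bigcupP[C CH hC].
  have [_ domC _] := domP C CH.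
  exact: subsetP (nbhdS e (bigcup_sup C CH)) h (subsetP domC h hC).
by apply: leq_card_bigcup => C /domP[].
Qed.

End Dominators.

Definition dominators_bound k r :=
  5 + k * r + r * (1 + 2 * (k * k)) + r.+1 * isolation_bound k.

Section Optimality.
Variables (T : finType) (e : rel T) (w : T -> nat) (k r : nat).
Implicit Types (C D H S X : {set T}) (L : seq {set T}).
Hypotheses (e_sym : symmetric e) (e_irr : irreflexive e) (free : P5rK1_free e r).

Notation N1 := (dominators_bound k r).
Notation N2 := (enlargement_bound r k N1).
Notation guesses := (guesses T k N1 N2).
Notation list_colouring := (list_colouring e).
Notation list_colourable := (list_colourable e).
Notation solve := (solve e w k r N1 N2).

Definition active_colours L := #|[set c : 'I_k | nth set0 L c != set0]|.

Definition optimal_upto j (solver : seq {set T} -> {set T}) :=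
  forall L H, size L = k -> active_colours L <= j -> list_colourable L H ->
    weight w H <= weight w (solver L).

Lemma active_colours_restrict L R : active_colours (restrict L R) <= active_colours L.
Proof.
apply: subset_leq_card; apply/subsetP => c; rewrite !inE => /set0Pn[v vL].
by apply/set0Pn; exists v; apply: (subsetP (restrict_sub L R c)).
Qed.

Lemma interiorP L D x : reflect
  [/\ x \in support L, x \in nbhd e D & {in support L :\: nbhd e D, forall y, ~~ e y x}]
  (x \in interior e L D).
Proof.
rewrite [x \in interior _ _ _]in_set in_setI -andbA.
by apply: (iffP and3P) => -[xL xD /forall_inP].
Qed.

Lemma interior_untouched L D D' : D \subset support L -> ~~ touch e D D' ->
  ~~ touch e (interior e L D) (interior e L D').
Proof.
move=> sDL farDD'; apply: (interior_far e_sym (subxx _)).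
apply/subsetP => y /interiorP[yL yD' y_int]; rewrite in_setD yL andbT.
have far_D' d : d \in D -> d \notin nbhd e D'.
  by move=> dD; apply: contra farDD' => dD'; apply/exists_inP; exists d.
apply/nbhdP => -[/far_D'|[d dD]]; first by rewrite yD'.
by apply/negP; rewrite e_sym; apply: y_int; rewrite in_setD far_D' // (subsetP sDL).
Qed.

Definition right_guess (col : T -> nat) D0 D :=
  ([seq (x, col x) | x <- enum D0], [seq (x, col x) | x <- enum (D :\: D0)]).

Section RightGuess.
Variables (L : seq {set T}) (col : T -> nat) (H D0 D : {set T}).
Hypotheses (size_L : size L = k) (lists : list_colouring L col H).
Hypotheses (sD0D : D0 \subset D) (sDH : D \subset H) (domH : H \subset nbhd e D0).

Notation guess := (right_guess col D0 D).

Lemma mem_colour_pairs D1 x c :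
  ((x, c) \in [seq (y, col y) | y <- enum D1]) = (x \in D1) && (c == col x).
Proof.
apply/mapP/andP => [[y + [-> ->]]|[xD /eqP->]]; first by rewrite mem_enum.
by exists x; rewrite ?mem_enum.
Qed.

Lemma mem_right_guess x c : ((x, c) \in guess.1 ++ guess.2) = (x \in D) && (c == col x).
Proof.
rewrite mem_cat !mem_colour_pairs in_setD -andb_orl; congr (_ && _).
by have [/(subsetP sD0D)->|] := boolP (x \in D0).
Qed.

Lemma dominators_right_guess : dominators guess = D0.
Proof.
apply/setP => x; apply/guessedP/idP => [[c]|xD]; first by rewrite mem_colour_pairs => /andP[].
by exists (col x); rewrite mem_colour_pairs xD eqxx.
Qed.

Lemma precoloured_right_guess : precoloured guess = D.
Proof.
apply/setP => x; apply/guessedP/idP => [[c]|xD]; first by rewrite mem_right_guess => /andP[].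
by exists (col x); rewrite mem_right_guess xD eqxx.
Qed.

Lemma guessed_class_right_guess c : guessed_class (guess.1 ++ guess.2) c = colour_class col D c.
Proof.
by apply/setP => x; rewrite mem_guessed_class mem_right_guess mem_colour_class eq_sym.
Qed.

Lemma right_guess_consistent : consistent e L guess.
Proof.
have [in_list proper] := lists.
apply/allP => -[x c]; rewrite mem_right_guess => /andP[xD /eqP->] /=.
have xH := subsetP sDH x xD; rewrite dominators_right_guess in_list // (subsetP domH) //=.
apply/allP => -[y c']; rewrite mem_right_guess => /andP[yD /eqP->] /=.
by apply/implyP; apply: contraL => /proper->; rewrite // (subsetP sDH).
Qed.

Lemma right_guess_in_guesses :
  #|D0| <= N1 -> #|D| <= N2 -> guess \in guesses.
Proof.
move=> card_D0 card_D; have [lt_col _] := list_colouring_proper lists.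
have coloured D1 : D1 \subset H ->
    all [in coloured_elements T k] [seq (x, col x) | x <- enum D1].
  move=> /subsetP sD1; apply/allP => _ /mapP[x + ->]; rewrite mem_enum => /sD1 xH.
  by apply/allpairsP; exists (x, col x); rewrite mem_enum mem_iota -size_L lt_col.
apply/allpairsP; exists guess; split=> //=; rewrite mem_short_seqs size_map -cardE coloured.
- by rewrite card_D0.
- exact: subset_trans sD0D sDH.
- by rewrite andbT; apply: leq_trans (subset_leq_card (subsetDl _ _)) card_D.
exact: subset_trans (subsetDl _ _) sDH.
Qed.

Lemma allowed_right_guess c :
  allowed e r L guess c = pruned e r (nth set0 L c) D0 (colour_class col D c) D.
Proof.
by rewrite /allowed dominators_right_guess precoloured_right_guess guessed_class_right_guess.
Qed.

Notation lists_of X := (trace_lists e k r L guess X).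

(* Vertices adjacent to a dominator d lose the colour of d. *)
Lemma active_colours_trace_lists d X :
  d \in D0 -> d \in X -> active_colours (lists_of X) < active_colours L.
Proof.
move=> dD0 dX; have dD := subsetP sD0D d dD0; have dH := subsetP sDH d dD.
have [in_list _] := lists; have [lt_col _] := list_colouring_proper lists.
have lt_k : col d < k by rewrite -size_L lt_col.
apply: proper_card; apply/properP; split.
  apply/subsetP => c; rewrite !inE => /set0Pn[u /mem_trace_lists[uL _]].
  by apply/set0Pn; exists u; have /setDP[] := subsetP (allowed_sub e r L guess c) u uL.
exists (Ordinal lt_k); rewrite inE /=; first by apply/set0Pn; exists d; apply: in_list.
rewrite negbK -subset0; apply/subsetP => u /mem_trace_lists[u_allowed tr_u].
rewrite allowed_right_guess in u_allowed.
have /negP[] : ~~ e u d.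
  by apply: (pruned_far u_allowed); rewrite mem_colour_class dD eqxx.
by move: dX; rewrite -tr_u inE => /andP[].
Qed.

Hypothesis in_pruned : forall h, h \in H -> h \notin D ->
  h \in pruned e r (nth set0 L (col h)) D0 (colour_class col D (col h)) D.

Definition trace_class X := [set h in H :\: D | trace e D0 h == X].

Lemma trace_lists_colouring X : list_colouring (lists_of X) col (trace_class X).
Proof.
have [in_list proper] := lists; have [lt_col _] := list_colouring_proper lists.
split=> [h|x y]; last by move=> /setIdP[/setDP[xH _] _] /setIdP[/setDP[yH _] _]; apply: proper.
case/setIdP=> /setDP[hH hD] tr_h; rewrite nth_trace_lists -size_L lt_col // inE.
by rewrite allowed_right_guess in_pruned // dominators_right_guess.
Qed.

Lemma trace_neq0 h : h \in H :\: D -> trace e D0 h != set0.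
Proof.
case/setDP=> hH hD; case/nbhdP: (subsetP domH h hH) => [hD0|[d dD0 hd]].
  by rewrite (subsetP sD0D) in hD.
by apply/set0Pn; exists d; rewrite inE dD0.
Qed.

Variables (j : nat) (solver : seq {set T} -> {set T}).
Hypotheses (solver_sound : forall L', list_colourable L' (solver L')).
Hypotheses (solver_optimal : optimal_upto j solver) (active_L : active_colours L <= j.+1).

Lemma weight_trace_class_le X : trace_class X != set0 ->
  weight w (trace_class X) <= weight w (solver (lists_of X)).
Proof.
case/set0Pn=> h /setIdP[hHD /eqP tr_h]; have /set0Pn[d] := trace_neq0 hHD.
rewrite tr_h => dX; have dD0 : d \in D0 by move: dX; rewrite -tr_h inE => /andP[].
apply: solver_optimal; first by rewrite size_map size_iota.
  by rewrite -ltnS; apply: leq_trans (active_colours_trace_lists dD0 dX) active_L.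
by exists col; apply: trace_lists_colouring.
Qed.

Lemma weight_trace_solutions_ge :
  weight w (H :\: D) <= weight w (trace_solutions e k r solver L guess).
Proof.
pose P := [set trace e D0 h | h in H :\: D].
have PP X : X \in P -> trace_class X != set0.
  by case/imsetP=> h hHD ->; apply/set0Pn; exists h; rewrite inE hHD eqxx.
have coverP : H :\: D \subset \bigcup_(X in P) trace_class X.
  apply/subsetP => h hHD; apply/bigcupP; exists (trace e D0 h); first exact: imset_f.
  by rewrite inE hHD eqxx.
apply: leq_trans (weightS w coverP) (leq_trans (weight_bigcup_le _ _ _) _).
apply: leq_trans (leq_sum _ (fun X XP => weight_trace_class_le (PP X XP))) _.
apply: weight_bigcup_disjoint => [X Y _ _ neqXY|X XP].
  rewrite -setI_eq0 -subset0; apply/subsetP => u /setIP[/(solver_trace solver_sound) tr_u].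
  by move=> /(solver_trace solver_sound) tr_u'; rewrite -tr_u -tr_u' eqxx in neqXY.
have /imsetP[h hHD ->] := XP; apply/subsetP => u u_sol; rewrite inE; apply/existsP; exists h.
by rewrite dominators_right_guess trace_neq0.
Qed.

Lemma dominated_solution_right_guess_ge :
  weight w H <= weight w (dominated_solution e k r solver L guess).
Proof.
rewrite /dominated_solution right_guess_consistent precoloured_right_guess.
rewrite weight_disjointU; last first.
  rewrite -setI_eq0 -subset0; apply/subsetP => u /setIP[uD].
  case/(trace_solutionsP solver_sound)=> _ u_sol.
  have [col' [in_list _]] := solver_sound (lists_of (trace e (dominators guess) u)).
  have [/(subsetP (allowed_sub _ _ _ _ _))/setDP[_]] := mem_trace_lists (in_list u u_sol).
  by rewrite precoloured_right_guess uD.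
by rewrite (weightID w H D) (setIidPr sDH) leq_add2l weight_trace_solutions_ge.
Qed.

End RightGuess.

Section Step.
Variables (j : nat) (solver : seq {set T} -> {set T}).
Hypotheses (solver_sound : forall L, list_colourable L (solver L)).
Hypothesis solver_optimal : optimal_upto j solver.

Lemma dominated_solution_ge L col H D0 : size L = k -> active_colours L <= j.+1 ->
  list_colouring L col H -> D0 \subset H -> H \subset nbhd e D0 -> #|D0| <= N1 ->
  exists g, [/\ g \in guesses, dominators g = D0, consistent e L g &
    weight w H <= weight w (dominated_solution e k r solver L g)].
Proof.
move=> size_L active_L lists sD0H domH card_D0.
have [D [sD0D sDH card_D in_pruned]] := decoupling_enlargement e_sym free lists sD0H.
exists (right_guess col D0 D); split.
- apply: (right_guess_in_guesses size_L lists) => //; rewrite size_L in card_D.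
  exact: leq_trans card_D (leq_enlargement_bound _ _ card_D0).
- exact: dominators_right_guess.
- exact: (right_guess_consistent lists).
exact: (dominated_solution_right_guess_ge size_L lists sD0D sDH domH in_pruned solver_sound
  solver_optimal).
Qed.

Lemma interior_solution_ge L col C D : size L = k -> active_colours L <= j.+1 ->
  list_colouring L col C -> D \subset C -> C \subset nbhd e D -> C \subset interior e L D ->
  #|D| <= N1 ->
  exists g, [/\ g \in guesses, dominators g = D, consistent e (restrict L (interior e L D)) g &
    weight w C <= weight w (interior_solution e k r solver L g)].
Proof.
move=> size_L active_L lists sDC domC intC card_D.
have [||g [g_guess dom_g cons weight_g]] :=
    dominated_solution_ge _ _ (list_colouring_restrict lists intC) sDC domC card_D.
- by rewrite size_map.
- exact: leq_trans (active_colours_restrict _ _) active_L.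
by exists g; rewrite /interior_solution dom_g.
Qed.

Lemma isolation_bound_le_dominators_bound : isolation_bound k <= N1.
Proof. by rewrite /dominators_bound mulSn; lia. Qed.

Lemma connected_piece L col C : size L = k -> active_colours L <= j.+1 ->
  ~~ has_p5 e (support L) -> list_colouring L col C -> connected e C -> C != set0 ->
  exists D S, [/\ D \subset C, S \in pieces e k r N1 N2 solver L, S \subset interior e L D &
    weight w C <= weight w S].
Proof.
move=> size_L active_L no_p5 lists connC /set0Pn[u uC].
have proper := list_colouring_proper lists; rewrite size_L in proper.
have sCL := list_colouring_support lists.
have [D [sDC [connD uD] domC card_D isolated]] :=
  isolating_dominating_set e_sym e_irr connC uC sCL proper no_p5.
have intC : C \subset interior e L D.
  apply/subsetP => x xC; apply/interiorP; split.
  - exact: (subsetP sCL).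
  - exact: (subsetP domC).
  by move=> y /setDP[yL yD]; rewrite e_sym; apply: isolated.
have [g [g_guess dom_g cons weight_g]] := interior_solution_ge size_L active_L lists sDC domC intC
  (leq_trans card_D isolation_bound_le_dominators_bound).
exists D, (interior_solution e k r solver L g); split=> //; last first.
  by have := interior_solution_sub k r e_sym solver_sound L g; rewrite dom_g.
apply: map_f; rewrite mem_filter g_guess andbT dom_g; apply/and3P; split=> //.
  by apply/set0Pn; exists u.
by apply/forall_inP => x xD; apply: connected_sub_component.
Qed.

Lemma heaviest_union_pieces_ge L H : size L = k -> active_colours L <= j.+1 ->
  ~~ has_p5 e (support L) -> list_colourable L H ->
  weight w H <= weight w (heaviest_union e w (pieces e k r N1 N2 solver L)).
Proof.
move=> size_L active_L no_p5 [col lists]; have sHL := list_colouring_support lists.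
have pieceP C : exists q : {set T} * {set T}, C \in components e H -> [/\ q.1 \subset C,
    q.2 \in pieces e k r N1 N2 solver L, q.2 \subset interior e L q.1 & weight w C <= weight w q.2].
  have [CH|_] := boolP (C \in components e H); last by exists (set0, set0).
  have connC : connected e C by apply: components_connected CH.
  have [D [S]] := connected_piece size_L active_L no_p5
    (list_colouringS (components_sub CH) lists) connC (components_neq0 CH).
  by exists (D, S).
have [q qP] := fin_all_exists pieceP.
apply: leq_trans (weightS w (sub_cover_components e H)) _.
apply: leq_trans (weight_bigcup_le w (components e H) id) _.
apply: (@leq_trans (\sum_(C in components e H) weight w (q C).2)).
  by apply: leq_sum => C /qP[].
apply: (heaviest_union_ge e_sym w no_p5) => [S|C CH|C C' CH C'H neqCC'].
- by case/(pieces_sound e_sym solver_sound).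
- by case: (qP C CH).
have [sD _ sI _] := qP C CH; have [sD' _ sI' _] := qP C' C'H.
have farCC' := components_untouched e_sym CH C'H neqCC'.
have sDL : (q C).1 \subset support L := subset_trans sD (subset_trans (components_sub CH) sHL).
exact: contra (touchS sI sI') (interior_untouched sDL (contra (touchS sD sD') farCC')).
Qed.

Section ManyComponents.
Variables (L : seq {set T}) (col : T -> nat) (H : {set T}).
Variables (P : {set {set T}}) (rep : {set T} -> T).
Hypotheses (size_L : size L = k) (active_L : active_colours L <= j.+1).
Hypotheses (lists : list_colouring L col H).
Hypotheses (sP : P \subset components e H) (card_P : #|P| = r.+1).
Hypothesis repP : {in P, forall C, rep C \in C}.

Let PH : {in P, forall C, C \in components e H} := subsetP sP.

Definition anchors C := [set rep C' | C' in P :\ C].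

Lemma card_anchors C : C \in P -> #|anchors C| = r.
Proof.
move=> CP; rewrite card_in_imset; first by have := cardsD1 C P; rewrite CP card_P => -[].
move=> A B /setD1P[_ AP] /setD1P[_ BP] eq_rep.
rewrite (components_eq e_sym (PH AP) (repP AP)) eq_rep.
by rewrite -(components_eq e_sym (PH BP) (repP BP)).
Qed.

Lemma components_nonadj C C' x y :
  C \in P -> C' \in P -> C != C' -> x \in C -> y \in C' -> ~~ e x y.
Proof. by move=> CP C'P neqC; apply/touchPn_adj/(components_untouched e_sym (PH CP) (PH C'P)). Qed.

Lemma anchors_nonadj C : {in anchors C &, forall x y, ~~ e x y}.
Proof.
move=> _ _ /imsetP[A /setD1P[_ AP] ->] /imsetP[B /setD1P[_ BP] ->].
have [->|neqAB] := eqVneq A B; first by rewrite e_irr.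
by apply: (components_nonadj AP BP); rewrite ?repP.
Qed.

(* The representatives of the other components leave a P5-free graph around the component C. *)
Lemma anchored_dominating_set C : C \in P -> exists D, [/\ D \subset C, rep C \in D,
  C \subset nbhd e D, #|D| <= isolation_bound k & forall x y, x \in C ->
    y \in support L :&: far_from e (anchors C) -> y \notin nbhd e D -> ~~ e x y].
Proof.
move=> CP; have sCH := components_sub (PH CP); have listsC := list_colouringS sCH lists.
have proper := list_colouring_proper listsC; rewrite size_L in proper.
have sCF : C \subset support L :&: far_from e (anchors C).
  rewrite subsetI (list_colouring_support listsC); apply/subsetP => x xC.
  apply/far_fromP => _ /imsetP[B /setD1P[neqB BP] ->].
  exact: components_nonadj BP CP neqB (repP BP) xC.
have no_p5 : ~~ has_p5 e (support L :&: far_from e (anchors C)).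
  apply: contra (free (card_anchors CP) (@anchors_nonadj C)).
  by apply: has_p5S; apply: subsetIr.
have connC : connected e C by apply: components_connected (PH CP).
have [D [sDC [_ repD] domC card_D isolated]] :=
  isolating_dominating_set e_sym e_irr connC (repP CP) sCF proper no_p5.
by exists D.
Qed.

Lemma many_components_dominating_set : exists D, [/\ D \subset cover P, cover P \subset nbhd e D,
  #|D| <= r.+1 * isolation_bound k, cover P \subset interior e L D & ~~ has_p5 e (outside e D)].
Proof.
have domP C : exists D, C \in P -> [/\ D \subset C, rep C \in D, C \subset nbhd e D,
    #|D| <= isolation_bound k & forall x y, x \in C ->
    y \in support L :&: far_from e (anchors C) -> y \notin nbhd e D -> ~~ e x y].
  by have [/anchored_dominating_set[D]|_] := boolP (C \in P); [exists D | exists set0].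
have [dom {}domP] := fin_all_exists domP; pose D := \bigcup_(C in P) dom C.
have sdomD C : C \in P -> dom C \subset D by move=> CP; apply: bigcup_sup.
have domD : cover P \subset nbhd e D.
  apply/bigcupsP => C CP; have [_ _ domC _ _] := domP C CP.
  exact: subset_trans domC (nbhdS e (sdomD C CP)).
have far_anchors C y : C \in P -> y \notin nbhd e D -> y \in far_from e (anchors C).
  move=> CP /notin_nbhd[_ far_y]; apply/far_fromP => _ /imsetP[B /setD1P[_ BP] ->].
  by rewrite e_sym; apply: far_y; apply: (subsetP (sdomD B BP)); case: (domP B BP).
exists D; split=> //.
- by apply/bigcupsP => C CP; have [sD _ _ _ _] := domP C CP;
  apply: subset_trans sD (bigcup_sup _ CP).
- by rewrite -card_P; apply: leq_card_bigcup => C /domP[].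
- apply/subsetP => x xP; have [C CP xC] := bigcupP xP; apply/interiorP; split.
  + have sCH := components_sub (PH CP).
    exact: subsetP (list_colouring_support lists) x (subsetP sCH x xC).
  + exact: subsetP domD x xP.
  move=> y /setDP[yL yD]; rewrite e_sym; have [_ _ _ _ isolated] := domP C CP.
  apply: isolated => //; first by rewrite in_setI yL far_anchors.
  by apply: contra yD; apply: (subsetP (nbhdS e (sdomD C CP))).
have [C CP] : exists C, C \in P by apply/card_gt0P; rewrite card_P.
apply: contra (free (card_anchors CP) (@anchors_nonadj C)); apply: has_p5S.
by apply/subsetP => y; rewrite in_setC; apply: far_anchors.
Qed.

Lemma outside_cover D : D \subset cover P -> H :\: cover P \subset outside e D.
Proof.
move=> sD; apply/subsetP => h /setDP[hH hP]; rewrite in_setC; apply: contra hP.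
case/nbhdP=> [/(subsetP sD)//|[d /(subsetP sD)/bigcupP[C CP dC] hd]]; apply/bigcupP; exists C => //.
have eqC := components_eq e_sym (PH CP) dC; rewrite eqC in dC *.
by apply: (component_closed dC hH); rewrite e_sym.
Qed.

Lemma split_solution_ge :
  exists2 g, g \in guesses & weight w H <= weight w (split_solution e w k r N1 N2 solver L g).
Proof.
have [D [sDP domP card_D intP no_p5]] := many_components_dominating_set.
have sPH : cover P \subset H by apply/bigcupsP => C /PH/components_sub.
have le_N1 : #|D| <= N1 by apply: leq_trans card_D (leq_addl _ _).
have [g [g_guess dom_g _ weight_g]] :=
  interior_solution_ge size_L active_L (list_colouringS sPH lists) sDP domP intP le_N1.
exists g => //; rewrite /split_solution weight_disjointU; last first.
  exact/untouched_disjoint/(split_solution_far w k r N1 N2 e_sym solver_sound).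
rewrite (weightID w H (cover P)) (setIidPr sPH) leq_add // dom_g.
apply: heaviest_union_pieces_ge.
- by rewrite size_map.
- exact: leq_trans (active_colours_restrict _ _) active_L.
- by apply: contra no_p5; apply/has_p5S/support_restrict.
exists col; apply: list_colouring_restrict (outside_cover sDP).
exact: list_colouringS (subsetDl _ _) lists.
Qed.

End ManyComponents.

End Step.

Lemma optimal_uptoS j : optimal_upto j (solve j) -> optimal_upto j.+1 (solve j.+1).
Proof.
move=> solve_optimal L H size_L active_L [col lists].
have sound := solve_colourable w k r N1 N2 e_sym j.
have proper := list_colouring_proper lists; rewrite size_L in proper.
have dominated D : D \subset H -> H \subset nbhd e D -> #|D| <= N1 ->
    weight w H <= weight w (solve j.+1 L).
  move=> sDH domH card_D; have [g [g_guess _ _ weight_g]] :=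
    dominated_solution_ge sound solve_optimal size_L active_L lists sDH domH card_D.
  by apply: leq_trans weight_g (heaviest_max w _); rewrite mem_cat map_f.
have [lt_r|le_r] := ltnP r #|components e H|.
  pose P := take_set r.+1 (components e H).
  have card_P : #|P| = r.+1 by rewrite card_take_set; apply/minn_idPl.
  have repP C : exists x, C \in components e H -> x \in C.
    have [/components_neq0/set0Pn[x xC]|_] := boolP (C \in _); first by exists x.
    have [C0] : exists C0, C0 \in P by apply/card_gt0P; rewrite card_P.
    by move=> /(subsetP (take_set_sub _ _))/components_neq0/set0Pn[x _]; exists x.
  have [rep {}repP] := fin_all_exists repP.
  have [C /(subsetP (take_set_sub _ _))/repP //|g g_guess weight_g] :=
    split_solution_ge sound solve_optimal size_L active_L lists
      (take_set_sub _ _) card_P (rep := rep).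
  by apply: leq_trans weight_g (heaviest_max w _); rewrite mem_cat map_f ?orbT.
have [p5|no_p5] := boolP (has_p5 e H).
  have [D [sDH domH card_D]] := p5_dominating_set free proper p5.
  by apply: dominated sDH domH (leq_trans card_D _); rewrite /dominators_bound -addnA leq_addr.
have [D [sDH domH card_D]] := components_dominating_set e_sym proper no_p5.
apply: dominated sDH domH (leq_trans card_D _); apply: leq_trans (leq_mul le_r (leqnn _)) _.
by rewrite /dominators_bound -addnA addnCA leq_addr.
Qed.

Lemma solve_optimal j : optimal_upto j (solve j).
Proof.
elim: j => [|j]; last exact: optimal_uptoS.
move=> L H size_L active_L [col lists]; have [in_list _] := lists.
have [lt_col _] := list_colouring_proper lists; rewrite size_L in lt_col.
suff -> : H = set0 by rewrite weight0.
apply/eqP; rewrite -subset0; apply/subsetP => h hH; move: active_L.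
rewrite leqn0 => /eqP/card0_eq/(_ (Ordinal (lt_col h hH))); rewrite inE /= => /negbFE/eqP nil.
by have := in_list h hH; rewrite nil.
Qed.

End Optimality.

(** * Running time *)

Lemma ptime_eq_pair (E : Type) (a : E -> tree) (A B : E -> eqType) (p q : forall x, A x * B x) :
  ptime a (fun x => enc_bool ((p x).1 == (q x).1)) ->
  ptime a (fun x => enc_bool ((p x).2 == (q x).2)) -> ptime a (fun x => enc_bool (p x == q x)).
Proof.
move=> eq1_ptime eq2_ptime; have := ptime_andb eq1_ptime eq2_ptime.
by apply: ptime_ext => x; case: (p x) (q x) => ? ? [].
Qed.

#[export] Hint Extern 3 (ptime _ (fun _ => enc_bool (eq_op _ _))) =>
  apply: ptime_eq_pair; ptime_auto : ptime.

Section GraphPrograms.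
Variables (E : Type) (a : E -> tree) (T : E -> finType) (e : forall x, rel (T x)).
Hypothesis e_ptime : ptime a (fun x => enc_rel (@e x)).
Implicit Types (A B D M V W : forall x, {set T x}) (u v c : forall x, T x).

Lemma ptime_nbhd D :
  ptime a (fun x => enc_subset (D x)) -> ptime a (fun x => enc_subset (nbhd (@e x) (D x))).
Proof. by move=> D_ptime; rewrite /nbhd; ptime_auto. Qed.

Lemma ptime_touch A B : ptime a (fun x => enc_subset (A x)) ->
  ptime a (fun x => enc_subset (B x)) ->
  ptime a (fun x => enc_bool (touch (@e x) (A x) (B x))).
Proof. by move=> A_ptime /ptime_nbhd B_ptime; rewrite /touch; ptime_auto. Qed.

Lemma ptime_component W u : ptime a (fun x => enc_subset (W x)) ->
  ptime a (fun x => enc_elt (u x)) -> ptime a (fun x => enc_subset (component (@e x) (W x) (u x))).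
Proof. by move=> W_ptime u_ptime; rewrite /component /component_step; ptime_auto. Qed.

Lemma ptime_hull c u v : ptime a (fun x => enc_elt (c x)) ->
  ptime a (fun x => enc_elt (u x)) -> ptime a (fun x => enc_elt (v x)) ->
  ptime a (fun x => enc_subset (hull (@e x) (c x) (u x) (v x))).
Proof. by move=> c_ptime u_ptime v_ptime; rewrite /hull /hull_step; ptime_auto. Qed.

Lemma ptime_vicinity c M : ptime a (fun x => enc_elt (c x)) ->
  ptime a (fun x => enc_subset (M x)) ->
  ptime a (fun x => enc_subset (vicinity (@e x) (c x) (M x))).
Proof. by move=> c_ptime M_ptime; rewrite /vicinity /nbhd; ptime_auto. Qed.

Lemma ptime_barrier V u (ds : forall x, seq (T x)) : ptime a (fun x => enc_subset (V x)) ->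
  ptime a (fun x => enc_elt (u x)) -> ptime a (fun x => enc_seq (@enc_elt (T x)) (ds x)) ->
  ptime a (fun x => enc_subset (barrier (@e x) (V x) (u x) (ds x))).
Proof.
move=> V_ptime u_ptime ds_ptime.
have near_ptime : ptime a (fun x => enc_subset (near (@e x) (u x) (ds x))).
  by rewrite /near /nbhd; ptime_auto.
by rewrite /barrier; ptime_auto.
Qed.

End GraphPrograms.

#[export] Hint Extern 1 (ptime _ (fun _ => enc_subset (nbhd _ _))) =>
  apply: ptime_nbhd; ptime_auto : ptime.
#[export] Hint Extern 1 (ptime _ (fun _ => enc_bool (touch _ _ _))) =>
  apply: ptime_touch; ptime_auto : ptime.
#[export] Hint Extern 1 (ptime _ (fun _ => enc_subset (component _ _ _))) =>
  apply: ptime_component; ptime_auto : ptime.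
#[export] Hint Extern 1 (ptime _ (fun _ => enc_subset (hull _ _ _ _))) =>
  apply: ptime_hull; ptime_auto : ptime.
#[export] Hint Extern 1 (ptime _ (fun _ => enc_subset (vicinity _ _ _))) =>
  apply: ptime_vicinity; ptime_auto : ptime.
#[export] Hint Extern 1 (ptime _ (fun _ => enc_subset (barrier _ _ _ _))) =>
  apply: ptime_barrier; ptime_auto : ptime.

Notation entry T := (T * {set T} * {set T})%type.
Notation part T := ({set T} * {set T})%type.
Notation enc_key := (enc_pair (@enc_elt _) (@enc_subset _)).
Notation enc_entry := (enc_pair enc_key (@enc_subset _)).
Notation enc_part := (enc_pair (@enc_subset _) (@enc_subset _)).

Section TablePrograms.
Variables (E : Type) (a : E -> tree) (T : E -> finType) (e : forall x, rel (T x)).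
Hypothesis e_ptime : ptime a (fun x => enc_rel (@e x)).
Implicit Types (tab : forall x, seq (entry (T x))) (ps : forall x, seq (part (T x))).

Lemma ptime_table_value (w : forall x, T x -> nat) tab B :
  ptime a (fun x => enc_weighting (@w x)) -> ptime a (fun x => enc_seq enc_entry (tab x)) ->
  ptime a (fun x => enc_subset (B x)) ->
  ptime a (fun x => enc_subset (table_value (@w x) (tab x) (B x))).
Proof. by move=> w_ptime tab_ptime B_ptime; rewrite /table_value; ptime_auto. Qed.

Lemma ptime_parts tab :
  ptime a (fun x => enc_seq enc_entry (tab x)) ->
    ptime a (fun x => enc_seq enc_part (parts (tab x))).
Proof. by move=> tab_ptime; rewrite /parts; ptime_auto. Qed.

Lemma ptime_compatible M ps :
  ptime a (fun x => enc_subset (M x)) -> ptime a (fun x => enc_seq enc_part (ps x)) ->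
  ptime a (fun x => enc_bool (compatible (@e x) (M x) (ps x))).
Proof. by move=> M_ptime ps_ptime; rewrite /compatible; ptime_auto. Qed.

Lemma ptime_initial_table : ptime a (fun x => enc_seq enc_entry (initial_table (@e x))).
Proof.
have keys_ptime : ptime a (fun x => enc_seq enc_key (keys (@e x))) by rewrite /keys; ptime_auto.
by rewrite /initial_table; ptime_auto.
Qed.

End TablePrograms.

#[export] Hint Extern 1 (ptime _ (fun _ => enc_subset (table_value _ _ _))) =>
  apply: ptime_table_value; ptime_auto : ptime.
#[export] Hint Extern 1 (ptime _ (fun _ => enc_seq _ (parts _))) =>
  apply: ptime_parts; ptime_auto : ptime.
#[export] Hint Extern 1 (ptime _ (fun _ => enc_bool (compatible _ _ _))) =>
  apply: ptime_compatible; ptime_auto : ptime.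

Section CandidatePrograms.
Variables (E : Type) (a : E -> tree) (T : E -> finType) (e : forall x, rel (T x)).
Variables (w : forall x, T x -> nat) (tab : forall x, seq (entry (T x))).
Hypotheses (e_ptime : ptime a (fun x => enc_rel (@e x)))
  (w_ptime : ptime a (fun x => enc_weighting (@w x)))
  (tab_ptime : ptime a (fun x => enc_seq enc_entry (tab x))).

Lemma ptime_component_values W (ps : forall x, seq (part (T x))) :
  ptime a (fun x => enc_subset (W x)) -> ptime a (fun x => enc_seq enc_part (ps x)) ->
  ptime a (fun x => enc_subset (component_values (@e x) (@w x) (tab x) (W x) (ps x))).
Proof. by move=> W_ptime ps_ptime; rewrite /component_values; ptime_auto. Qed.

Lemma ptime_combine W (ps : forall x, seq (part (T x))) :
  ptime a (fun x => enc_subset (W x)) -> ptime a (fun x => enc_seq enc_part (ps x)) ->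
  ptime a (fun x => enc_subset (combine (@e x) (@w x) (tab x) (W x) (ps x))).
Proof.
move=> W_ptime ps_ptime; have := ptime_component_values W_ptime ps_ptime.
by move=> values_ptime; rewrite /combine /parts_union; ptime_auto.
Qed.

End CandidatePrograms.

#[export] Hint Extern 1 (ptime _ (fun _ => enc_subset (component_values _ _ _ _ _))) =>
  apply: ptime_component_values; ptime_auto : ptime.
#[export] Hint Extern 1 (ptime _ (fun _ => enc_subset (combine _ _ _ _ _))) =>
  apply: ptime_combine; ptime_auto : ptime.

Lemma ptime_candidates (E : Type) (a : E -> tree) (T : E -> finType) (e : forall x, rel (T x))
    (w : forall x, T x -> nat) (tab : forall x, seq (entry (T x))) (c : forall x, T x) M :
  ptime a (fun x => enc_rel (@e x)) -> ptime a (fun x => enc_weighting (@w x)) ->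
  ptime a (fun x => enc_seq enc_entry (tab x)) -> ptime a (fun x => enc_elt (c x)) ->
  ptime a (fun x => enc_subset (M x)) ->
  ptime a (fun x => enc_seq (@enc_subset _) (candidates (@e x) (@w x) (tab x) (c x) (M x))).
Proof. by move=> e_ptime w_ptime tab_ptime c_ptime M_ptime; rewrite /candidates; ptime_auto. Qed.

#[export] Hint Extern 1 (ptime _ (fun _ => enc_seq _ (candidates _ _ _ _ _))) =>
  apply: ptime_candidates; ptime_auto : ptime.

Section IndependentSetPrograms.
Variables (E : Type) (a : E -> tree) (T : E -> finType) (e : forall x, rel (T x)).
Variable w : forall x, T x -> nat.
Hypotheses (e_ptime : ptime a (fun x => enc_rel (@e x)))
  (w_ptime : ptime a (fun x => enc_weighting (@w x))).

Lemma tree_size_table (U : finType) (t : seq (entry U)) :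
  tree_size (enc_seq enc_entry t) <= (size t * (size (enum U) * 10 + 9).+1).+1.
Proof.
apply: (leq_tree_size_seq (enc := fun=> Leaf) (h := fun=> size (enum U) * 10 + 9)) => // -[[c M] S].
rewrite /enc_pair /=; have := tree_size_subset S; have := tree_size_subset M.
by have := tree_size_elt c; move: (size _) => n; lia.
Qed.

Lemma size_iter_improve_table x t n :
  size (iter n (improve_table (@e x) (@w x)) t) = size t.
Proof. by elim: n => //= n <-; rewrite size_map. Qed.

Lemma ptime_final_table : ptime a (fun x => enc_seq enc_entry (final_table (@e x) (@w x))).
Proof.
have table_ptime := ptime_initial_table e_ptime; have enum_ptime := ptime_enum e_ptime.
have step_ptime : ptime (env a (fun x => enc_seq (enc_entry : entry (T x) -> tree)))
    (fun s => enc_seq enc_entry (improve_table (@e (tag s)) (@w (tag s)) (tagged s))).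
  by ptime_under; rewrite /improve_table; ptime_auto.
have size_table := ptime_size table_ptime; have size_enum := ptime_size enum_ptime.
pose bound x := (tree_size (enc_seq enc_entry (initial_table (@e x))) *
  (tree_size (enc_seq (@enc_elt _) (enum (T x))) * 10 + 9).+1).+1.
have bound_poly : poly_bounded a bound by rewrite /bound; poly_bound.
apply: ptime_ext (ptime_iter (enc := fun x => enc_seq (enc_entry : entry (T x) -> tree))
  (f := fun x => improve_table (@e x) (@w x)) (ptime_size_seq enum_ptime) table_ptime step_ptime
  bound_poly _) => [x|x i _]; first by rewrite /final_table -cardT.
apply: leq_trans (tree_size_table _) _; rewrite size_iter_improve_table ltnS.
by apply: leq_mul; rewrite ?ltnS ?leq_add2r ?leq_mul2r tree_size_seq; lia.
Qed.

Lemma ptime_heaviest_independent :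
  ptime a (fun x => enc_subset (heaviest_independent (@e x) (@w x))).
Proof.
have table_ptime := ptime_final_table.
by rewrite /heaviest_independent /solution_through /nonnbrs; ptime_auto.
Qed.

End IndependentSetPrograms.

Lemma enc_seq_enum_ord m (F : nat -> tree) :
  enc_seq (fun i : 'I_m => F i) (enum 'I_m) = enc_seq F (iota 0 m).
Proof. by rewrite -val_enum_ord enc_seq_map. Qed.

Lemma ptime_nat_of_ord (E : Type) (a : E -> tree) (m : E -> nat) (i : forall x, 'I_(m x)) :
  ptime a (fun x => enc_elt (i x)) -> ptime a (fun x => enc_unary (i x)).
Proof. by apply: ptime_ext => x; rewrite /enc_elt index_enum_ord. Qed.

#[export] Hint Extern 1 (ptime _ (fun _ => enc_unary (nat_of_ord _))) =>
  apply: ptime_nat_of_ord; ptime_auto : ptime.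

Section TouchGraphPrograms.
Variables (E : Type) (a : E -> tree) (T : E -> finType) (e : forall x, rel (T x)).
Variable cs : forall x, seq {set T x}.
Hypotheses (e_ptime : ptime a (fun x => enc_rel (@e x)))
  (cs_ptime : ptime a (fun x => enc_seq (@enc_subset (T x)) (cs x))).

Lemma ptime_touch_rel : ptime a (fun x => enc_rel (touch_rel (@e x) (cs x))).
Proof.
have iota_ptime := ptime_iota (ptime_size_seq cs_ptime).
apply: (ptime_ext (g := fun x => enc_seq (fun i => enc_seq (fun j => enc_bool ((i != j) &&
    touch (@e x) (nth set0 (cs x) i) (nth set0 (cs x) j)))
  (iota 0 (size (cs x)))) (iota 0 (size (cs x))))).
  move=> x; rewrite -enc_seq_enum_ord; apply: eq_in_enc_seq => i _; rewrite -enc_seq_enum_ord.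
  by apply: eq_in_enc_seq => j _; rewrite /touch_rel -(inj_eq val_inj).
apply: (ptime_enc_seq iota_ptime); ptime_under.
apply: (ptime_enc_seq (enc := fun=> enc_unary)); first by ptime_auto.
by ptime_under; ptime_auto.
Qed.

Lemma ptime_touch_weight (w : forall x, T x -> nat) : ptime a (fun x => enc_weighting (@w x)) ->
  ptime a (fun x => enc_weighting (touch_weight (@w x) (cs x))).
Proof.
move=> w_ptime; have iota_ptime := ptime_iota (ptime_size_seq cs_ptime).
apply: (ptime_ext (g := fun x =>
    enc_seq (fun i => enc_nat (weight (@w x) (nth set0 (cs x) i))) (iota 0 (size (cs x))))).
  by move=> x; rewrite -enc_seq_enum_ord.
by apply: (ptime_enc_seq iota_ptime); ptime_under; ptime_auto.
Qed.

End TouchGraphPrograms.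

Lemma ptime_heaviest_union (E : Type) (a : E -> tree) (T : E -> finType) (e : forall x, rel (T x))
    (w : forall x, T x -> nat) (cs : forall x, seq {set T x}) :
  ptime a (fun x => enc_rel (@e x)) -> ptime a (fun x => enc_weighting (@w x)) ->
  ptime a (fun x => enc_seq (@enc_subset (T x)) (cs x)) ->
  ptime a (fun x => enc_subset (heaviest_union (@e x) (@w x) (cs x))).
Proof.
move=> e_ptime w_ptime cs_ptime; have touch_ptime := ptime_touch_rel e_ptime cs_ptime.
have independent_ptime :=
  ptime_heaviest_independent touch_ptime (ptime_touch_weight e_ptime cs_ptime w_ptime).
by rewrite /heaviest_union; ptime_auto.
Qed.

#[export] Hint Extern 1 (ptime _ (fun _ => enc_subset (heaviest_union _ _ _))) =>
  apply: ptime_heaviest_union; ptime_auto : ptime.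

Notation guess T := (seq (T * nat) * seq (T * nat))%type.
Notation enc_colours := (enc_seq (enc_pair (@enc_elt _) enc_unary)).
Notation enc_guess := (enc_pair enc_colours enc_colours).

Section GuessPrograms.
Variables (E : Type) (a : E -> tree) (T : E -> finType) (e : forall x, rel (T x)).
Hypothesis e_ptime : ptime a (fun x => enc_rel (@e x)).
Implicit Types (L : forall x, seq {set T x}) (s : forall x, seq (T x * nat)).
Implicit Types (g : forall x, guess (T x)) (D R : forall x, {set T x}).

Lemma ptime_support L : ptime a (fun x => enc_seq (@enc_subset (T x)) (L x)) ->
  ptime a (fun x => enc_subset (support (L x))).
Proof. by move=> L_ptime; rewrite /support; ptime_auto. Qed.

Lemma ptime_restrict L R : ptime a (fun x => enc_seq (@enc_subset (T x)) (L x)) ->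
  ptime a (fun x => enc_subset (R x)) ->
  ptime a (fun x => enc_seq (@enc_subset (T x)) (restrict (L x) (R x))).
Proof. by move=> L_ptime R_ptime; rewrite /restrict; ptime_auto. Qed.

Lemma ptime_guessed s :
  ptime a (fun x => enc_colours (s x)) -> ptime a (fun x => enc_subset (guessed (s x))).
Proof. by move=> s_ptime; rewrite /guessed; ptime_auto. Qed.

Lemma ptime_guessed_class s (c : E -> nat) : ptime a (fun x => enc_colours (s x)) ->
  ptime a (fun x => enc_unary (c x)) ->
  ptime a (fun x => enc_subset (guessed_class (s x) (c x))).
Proof. by move=> s_ptime c_ptime; rewrite /guessed_class; ptime_auto. Qed.

Lemma ptime_dominators g :
  ptime a (fun x => enc_guess (g x)) -> ptime a (fun x => enc_subset (dominators (g x))).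
Proof. by move=> g_ptime; apply: ptime_guessed; apply: ptime_fst g_ptime. Qed.

Lemma ptime_precoloured g :
  ptime a (fun x => enc_guess (g x)) -> ptime a (fun x => enc_subset (precoloured (g x))).
Proof. by move=> g_ptime; apply: ptime_guessed; ptime_split g_ptime; ptime_auto. Qed.

Lemma ptime_trace D (v : forall x, T x) : ptime a (fun x => enc_subset (D x)) ->
  ptime a (fun x => enc_elt (v x)) ->
  ptime a (fun x => enc_subset (trace (@e x) (D x) (v x))).
Proof. by move=> D_ptime v_ptime; rewrite /trace; ptime_auto. Qed.

Lemma ptime_outside D :
  ptime a (fun x => enc_subset (D x)) -> ptime a (fun x => enc_subset (outside (@e x) (D x))).
Proof. by move=> D_ptime; rewrite /outside; ptime_auto. Qed.

Lemma ptime_connectedb D :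
  ptime a (fun x => enc_subset (D x)) -> ptime a (fun x => enc_bool (connectedb (@e x) (D x))).
Proof. by move=> D_ptime; rewrite /connectedb; ptime_auto. Qed.

Lemma ptime_interior L D : ptime a (fun x => enc_seq (@enc_subset (T x)) (L x)) ->
  ptime a (fun x => enc_subset (D x)) ->
  ptime a (fun x => enc_subset (interior (@e x) (L x) (D x))).
Proof.
move=> L_ptime D_ptime; have support_ptime := ptime_support L_ptime.
by rewrite /interior; ptime_auto.
Qed.

Lemma ptime_admissible r A D0 K D : ptime a (fun x => enc_subset (A x)) ->
  ptime a (fun x => enc_subset (D0 x)) -> ptime a (fun x => enc_subset (K x)) ->
  ptime a (fun x => enc_subset (D x)) ->
  ptime a (fun x => enc_subset (admissible (@e x) r (A x) (D0 x) (K x) (D x))).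
Proof. by move=> A_ptime D0_ptime K_ptime D_ptime; rewrite /admissible; ptime_auto. Qed.

Lemma ptime_guesses k N1 N2 : ptime a (fun x => enc_seq enc_guess (guesses (T x) k N1 N2)).
Proof. by rewrite /guesses /coloured_elements; ptime_auto. Qed.

End GuessPrograms.

#[export] Hint Extern 1 (ptime _ (fun _ => enc_seq _ (restrict _ _))) =>
  apply: ptime_restrict; ptime_auto : ptime.
#[export] Hint Extern 1 (ptime _ (fun _ => enc_subset (guessed_class _ _))) =>
  apply: ptime_guessed_class; ptime_auto : ptime.
#[export] Hint Extern 1 (ptime _ (fun _ => enc_subset (dominators _))) =>
  apply: ptime_dominators; ptime_auto : ptime.
#[export] Hint Extern 1 (ptime _ (fun _ => enc_subset (precoloured _))) =>
  apply: ptime_precoloured; ptime_auto : ptime.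
#[export] Hint Extern 1 (ptime _ (fun _ => enc_subset (trace _ _ _))) =>
  apply: ptime_trace; ptime_auto : ptime.
#[export] Hint Extern 1 (ptime _ (fun _ => enc_subset (outside _ _))) =>
  apply: ptime_outside; ptime_auto : ptime.
#[export] Hint Extern 1 (ptime _ (fun _ => enc_bool (connectedb _ _))) =>
  apply: ptime_connectedb; ptime_auto : ptime.
#[export] Hint Extern 1 (ptime _ (fun _ => enc_subset (interior _ _ _))) =>
  apply: ptime_interior; ptime_auto : ptime.
#[export] Hint Extern 1 (ptime _ (fun _ => enc_subset (admissible _ _ _ _ _ _))) =>
  apply: ptime_admissible; ptime_auto : ptime.
#[export] Hint Extern 1 (ptime _ (fun _ => enc_seq _ (guesses _ _ _ _))) =>
  apply: ptime_guesses; ptime_auto : ptime.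

Section ListPrograms.
Variables (E : Type) (a : E -> tree) (T : E -> finType) (e : forall x, rel (T x)).
Variables (L : forall x, seq {set T x}) (g : forall x, guess (T x)).
Hypotheses (e_ptime : ptime a (fun x => enc_rel (@e x)))
  (L_ptime : ptime a (fun x => enc_seq (@enc_subset (T x)) (L x)))
  (g_ptime : ptime a (fun x => enc_guess (g x))).

Lemma ptime_consistent : ptime a (fun x => enc_bool (consistent (@e x) (L x) (g x))).
Proof.
have dominators_ptime := ptime_dominators e_ptime g_ptime; ptime_split g_ptime.
by rewrite /consistent; ptime_auto.
Qed.

Lemma ptime_allowed r (c : E -> nat) : ptime a (fun x => enc_unary (c x)) ->
  ptime a (fun x => enc_subset (allowed (@e x) r (L x) (g x) (c x))).
Proof.
move=> c_ptime; have dominators_ptime := ptime_dominators e_ptime g_ptime.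
have precoloured_ptime := ptime_precoloured e_ptime g_ptime; ptime_split g_ptime.
have class_ptime : ptime a (fun x => enc_subset (guessed_class ((g x).1 ++ (g x).2) (c x))).
  by ptime_auto.
by rewrite /allowed /pruned; ptime_auto.
Qed.

End ListPrograms.

#[export] Hint Extern 1 (ptime _ (fun _ => enc_bool (consistent _ _ _))) =>
  apply: ptime_consistent; ptime_auto : ptime.
#[export] Hint Extern 1 (ptime _ (fun _ => enc_subset (allowed _ _ _ _ _))) =>
  apply: ptime_allowed; ptime_auto : ptime.

Lemma ptime_trace_lists (E : Type) (a : E -> tree) (T : E -> finType) (e : forall x, rel (T x)) k r
    (L : forall x, seq {set T x}) (g : forall x, guess (T x)) (X : forall x, {set T x}) :
  ptime a (fun x => enc_rel (@e x)) -> ptime a (fun x => enc_seq (@enc_subset (T x)) (L x)) ->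
  ptime a (fun x => enc_guess (g x)) -> ptime a (fun x => enc_subset (X x)) ->
  ptime a (fun x => enc_seq (@enc_subset (T x)) (trace_lists (@e x) k r (L x) (g x) (X x))).
Proof. by move=> e_ptime L_ptime g_ptime X_ptime; rewrite /trace_lists; ptime_auto. Qed.

#[export] Hint Extern 1 (ptime _ (fun _ => enc_seq _ (trace_lists _ _ _ _ _ _))) =>
  apply: ptime_trace_lists; ptime_auto : ptime.

Section SolverPrograms.
Variables k r N1 N2 j : nat.

Definition solve_polynomial := forall (E : Type) (a : E -> tree) (T : E -> finType)
    (e : forall x, rel (T x)) (w : forall x, T x -> nat) (L : forall x, seq {set T x}),
  ptime a (fun x => enc_rel (@e x)) -> ptime a (fun x => enc_weighting (@w x)) ->
  ptime a (fun x => enc_seq (@enc_subset (T x)) (L x)) ->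
  ptime a (fun x => enc_subset (solve (@e x) (@w x) k r N1 N2 j (L x))).

Hypothesis solve_ptime : solve_polynomial.

#[local] Hint Extern 1 (ptime _ (fun _ => enc_subset (solve _ _ _ _ _ _ _ _))) =>
  apply: solve_ptime; ptime_auto : ptime.

Variables (E : Type) (a : E -> tree) (T : E -> finType) (e : forall x, rel (T x)).
Variables (w : forall x, T x -> nat) (L : forall x, seq {set T x}) (g : forall x, guess (T x)).
Hypotheses (e_ptime : ptime a (fun x => enc_rel (@e x)))
  (w_ptime : ptime a (fun x => enc_weighting (@w x)))
  (L_ptime : ptime a (fun x => enc_seq (@enc_subset (T x)) (L x)))
  (g_ptime : ptime a (fun x => enc_guess (g x))).

Lemma ptime_dominated_solution : ptime a (fun x => enc_subset
  (dominated_solution (@e x) k r (solve (@e x) (@w x) k r N1 N2 j) (L x) (g x))).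
Proof. by rewrite /dominated_solution /trace_solutions; ptime_auto. Qed.

End SolverPrograms.

#[export] Hint Extern 1 (ptime _ (fun _ => enc_subset (dominated_solution _ _ _ _ _ _))) =>
  apply: ptime_dominated_solution; ptime_auto : ptime.

Lemma ptime_pieces k r N1 N2 j (E : Type) (a : E -> tree) (T : E -> finType)
    (e : forall x, rel (T x)) (w : forall x, T x -> nat) (L : forall x, seq {set T x}) :
  solve_polynomial k r N1 N2 j ->
  ptime a (fun x => enc_rel (@e x)) -> ptime a (fun x => enc_weighting (@w x)) ->
  ptime a (fun x => enc_seq (@enc_subset (T x)) (L x)) ->
  ptime a (fun x => enc_seq (@enc_subset (T x))
    (pieces (@e x) k r N1 N2 (solve (@e x) (@w x) k r N1 N2 j) (L x))).
Proof.
by move=> solve_ptime e_ptime w_ptime L_ptime; rewrite /pieces /interior_solution; ptime_auto.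
Qed.

#[export] Hint Extern 1 (ptime _ (fun _ => enc_seq _ (pieces _ _ _ _ _ _ _))) =>
  apply: ptime_pieces; ptime_auto : ptime.

Lemma ptime_solve k r N1 N2 j : solve_polynomial k r N1 N2 j.
Proof.
elim: j => [|j solve_ptime] E a T e w L e_ptime w_ptime L_ptime.
  exact: ptime_set0 (ptime_enum e_ptime).
by rewrite /= /split_solution /interior_solution; ptime_auto.
Qed.

(** * Colourings of induced subgraphs *)

Lemma embedding_not_induced_free (F G : sgraph) (f : F -> G) : injective f ->
  (forall x y, adj (f x) (f y) = adj x y) -> ~ induced_free F G.
Proof.
move=> f_inj f_adj /(_ [set f x | x : F]); apply.
have preimage (y : {y : G | y \in [set f x | x : F]}) : exists x, f x = sval y.
  by case: y => y /= /imsetP[x _ ->]; exists x.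
have [g gK] := fin_all_exists preimage.
have mem_f x : f x \in [set f z | z : F] by apply: imset_f.
exists g => [|x y]; last by rewrite -f_adj !gK.
exists (fun x => exist _ (f x) (mem_f x)) => [y|x]; first by apply: val_inj; rewrite /= gK.
by apply: f_inj; rewrite gK.
Qed.

Lemma induced_p5_nth (T : finType) (e : rel T) a b c d f : symmetric e -> irreflexive e ->
  induced_p5 e a b c d f ->
  forall i j : 'I_5, e (nth a [:: a; b; c; d; f] i) (nth a [:: a; b; c; d; f] j) = path_adj i j.
Proof.
move=> e_sym e_irr /and5P[ab bc cd df /and5P[ac ad af bd /andP[bf cf]]].
case=> [[|[|[|[|[|i]]]]] lt_i] [[|[|[|[|[|j]]]]] lt_j] //; rewrite /path_adj /= ?e_irr //;
  first [ exact/idP | exact/negbTE | by rewrite e_sym; first [exact/idP | exact/negbTE] ].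
Qed.

Lemma path5_neighbour (i : 'I_5) : exists j : 'I_5, path_adj i j.
Proof.
exists (inord (if i < 4 then i.+1 else 3)).
by case: i => [[|[|[|[|[|i]]]]] lt_i] //; rewrite /path_adj inordK.
Qed.

Lemma induced_free_P5rK1 (G : sgraph) r :
  induced_free (dunion (path_graph 5) (edgeless_graph r)) G -> P5rK1_free (@adj G) r.
Proof.
move=> free J card_J indJ; apply/has_p5P => -[a [b [c [d [f [/and5P[aF bF cF dF fF] path]]]]]].
have adj_s := induced_p5_nth (@adj_sym G) (@adj_irr G) path.
have uniq_s := induced_p5_uniq (@adj_sym G) (@adj_irr G) path.
set s := [:: a; b; c; d; f] in adj_s uniq_s.
have far_s (i : 'I_5) : nth a s i \in far_from (@adj G) J by case: i => [[|[|[|[|[|i]]]]] lt_i].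
pose g (j : 'I_r) : G := enum_val (cast_ord (esym card_J) j).
have gJ j : g j \in J by apply: enum_valP.
have far_sg i j : adj (g j) (nth a s (i : 'I_5)) = false.
  by apply/negbTE; have /far_fromP := far_s i; apply.
have neq_sg i j : nth a s (i : 'I_5) != g j.
  have [z iz] := path5_neighbour i; apply: contraTneq iz => eq_ij.
  by rewrite -adj_s eq_ij far_sg.
pose h (x : dunion (path_graph 5) (edgeless_graph r)) : G :=
  match x with inl i => nth a s (i : 'I_5) | inr j => g j end.
apply: (@embedding_not_induced_free _ _ h _ _ free) => -[i|i] [j|j] //=.
- by move/eqP; rewrite nth_uniq // => /eqP/val_inj->.
- by move/eqP; rewrite (negPf (neq_sg i j)).
- by move/esym/eqP; rewrite (negPf (neq_sg j i)).
- by move=> /enum_val_inj/cast_ord_inj->.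
- by rewrite adj_sym far_sg.
by apply/negbTE/indJ.
Qed.

Lemma colourable_list_colourable k (G : sgraph) (S : {set G}) :
  colourable k (induced S) <-> list_colourable (@adj G) (nseq k setT) S.
Proof.
split=> [[c proper]|[col lists]].
  pose col v := if insub v is Some y then nat_of_ord (c y) else 0.
  have colE v (vS : v \in S) : col v = c (exist _ v vS) by rewrite /col insubT.
  exists col; split=> [v vS|u v uS vS uv]; first by rewrite nth_nseq colE ltn_ord in_setT.
  by rewrite !colE; apply: (proper (exist _ u uS) (exist _ v vS)).
have [lt_col proper] := list_colouring_proper lists; rewrite size_nseq in lt_col.
exists (fun y : {x : G | x \in S} => Ordinal (lt_col (sval y) (svalP y))) => x y.
exact: (proper _ _ (svalP x) (svalP y)).
Qed.

Lemma ptime_full_lists (E : Type) (a : E -> tree) (T : E -> finType) k :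
  ptime a (fun x => enc_seq (@enc_elt (T x)) (enum (T x))) ->
  ptime a (fun x => enc_seq (@enc_subset (T x)) (nseq k setT)).
Proof.
move=> enum_ptime; elim: k => [|k IH]; first exact: (ptime_const a Leaf).
apply: (ptime_cons (enc := fun x => @enc_subset (T x)) (u := fun=> setT)) IH.
apply: (ptime_ext (g := fun x => enc_subset (~: (set0 : {set T x})))); last by ptime_auto.
by move=> x; rewrite setC0.
Qed.

Lemma horner_succ d n : ((('X + 1%:P) ^+ d : {poly nat}).[n])%R = n.+1 ^ d.
Proof.
elim: d => [|d IH]; first by rewrite GRing.expr0 hornerC.
rewrite GRing.exprS hornerM IH hornerD hornerX hornerC expnS.
by change ((n + 1) * n.+1 ^ d = n.+1 * n.+1 ^ d); rewrite addn1.
Qed.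

Lemma ptime_runs_within (E : Type) (a g : E -> tree) : ptime a g ->
  exists (c : cmd) (p : {poly nat}),
    forall x, runs_within c (a x) (g x) (p.[tree_size (a x)])%R.
Proof.
move=> [c [F [[d bound_F] run_c]]]; exists (c 0), (('X + 1%:P) ^+ d)%R => x.
have [t [s [exec_c s0 _ le_t]]] := run_c x 0 (init_store (a x)) (update_same _ _ _).
by exists t, s; split=> //; rewrite horner_succ; apply: leq_trans le_t (bound_F x).
Qed.

Theorem theorem1p1 (k r : nat) :
  exists (c : cmd) (p : {poly nat}),
    forall (G : sgraph) (w : G -> nat),
      induced_free (dunion (path_graph 5) (edgeless_graph r)) G ->
      exists S : {set G},
        max_weight_colourable k w S /\
        runs_within c (enc_instance w) (enc_set S)
          (p.[tree_size (enc_instance w)])%R.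
Proof.
pose N1 := dominators_bound k r; pose N2 := enlargement_bound r k N1.
pose instance (x : {G : sgraph & G -> nat}) := enc_instance (tagged x).
have adj_ptime : ptime instance (fun x => enc_rel (@adj (tag x))) := ptime_hd (ptime_id _).
have w_ptime : ptime instance (fun x => enc_weighting (tagged x)) := ptime_tl (ptime_id _).
have lists_ptime := ptime_full_lists k (ptime_enum adj_ptime).
have [c [p run_c]] := ptime_runs_within (ptime_solve k r N1 N2 k adj_ptime w_ptime lists_ptime).
exists c, p => G w free; exists (solve (@adj G) w k r N1 N2 k (nseq k setT)).
split; last exact: run_c (existT _ G w).
split; first exact/colourable_list_colourable/solve_colourable/adj_sym.
move=> S' /colourable_list_colourable.
apply: (solve_optimal w (@adj_sym G) (@adj_irr G) (induced_free_P5rK1 free)).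
  exact: size_nseq.
by apply: leq_trans (max_card _) _; rewrite card_ord.
Qed.
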